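(* Let $0\neq p(x)\in\mathbb C((x))$, $\phi(x,z)=e^{zp(x)\frac{d}{dx}}(x)$, let $W$ be a complex vector space and let $S$ be a quasi local subset of $\mathcal E(W)=\mathrm{Hom}(W,W((z)))$. Then $(\langle S\rangle_\phi,Y_{\mathcal E}^\phi,1_W)$ is a vertex algebra with $S$ as a generating set, and $W$ is a faithful $\phi$-coordinated quasi $\langle S\rangle_\phi$-module with $Y_W(a(z),z_0)=a(z_0)$ for $a(z)\in\langle S\rangle_\phi$. Furthermore, if $S$ is local, then $W$ is a $\phi$-coordinated $\langle S\rangle_\phi$-module.
   Context: $\phi(x,z)=\sum_{n\ge0}\frac{z^n}{n!}\left(p(x)\frac{d}{dx}\right)^n(x)\in\mathbb C((x))[[z]]$. $W((z_1,z_2))=W[[z_1,z_2]][z_1^{-1},z_2^{-1}]$. For $A(z_1,z)\in\mathrm{Hom}(W,W((z_1,z)))$, the substitution $A(z_1,z)|_{z_1=\phi(z,z_0)}$ is $\left(e^{z_0p(z_1)\partial/\partial z_1}A(z_1,z)\right)|_{z_1=z}\in\mathcal E(W)[[z_0]]$. A pair $(a(z),b(z))$ in $\mathcal E(W)$ is quasi local if there is a nonzero polynomial $q(z_1,z_2)\in\mathbb C[z_1,z_2]$ with $q(z_1,z_2)[a(z_1),b(z_2)]=0$, and local if $q$ can be taken of the form $(z_1-z_2)^n$, $n\in\mathbb N$. A subset of $\mathcal E(W)$ is (quasi) local if every pair of its elements (including pairs of equal elements) is (quasi) local. For a quasi local pair $(a(z),b(z))$ in $\mathcal E(W)$ and a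 nonzero polynomial $q(z_1,z_2)\in\mathbb C[z_1,z_2]$ with $q(z_1,z_2)[a(z_1),b(z_2)]=0$, one has $q(z_1,z)a(z_1)b(z)\in\mathrm{Hom}(W,W((z_1,z)))$ and one defines $Y_{\mathcal E}^\phi(a(z),z_0)b(z)=\sum_{n\in\mathbb Z}a(z)_n^\phi b(z)\,z_0^{-n-1}\in\mathcal E(W)((z_0))$ by $$Y_{\mathcal E}^\phi(a(z),z_0)b(z)=q(\phi(z,z_0),z)^{-1}\left(q(z_1,z)a(z_1)b(z)\right)|_{z_1=\phi(z,z_0)},$$ where the inverse is taken in $\mathbb C((z))((z_0))$; this is independent of $q$. A quasi local subspace $U$ of $\mathcal E(W)$ is $Y_{\mathcal E}^\phi$-closed if $a(z)_n^\phi b(z)\in U$ for all $a(z),b(z)\in U$, $n\in\mathbb Z$. $\langle S\rangle_\phi$ denotes the smallest $Y_{\mathcal E}^\phi$-closed quasi local subspace of $\mathcal E(W)$ containing $S$ and $1_W$. For a vertex algebra $(V,Y,\mathbf 1)$, a $\phi$-coordinated quasi $V$-module is a vector space $W$ with a linear map $Y_W(\cdot,z):V\to\mathrm{Hom}(W,W((z)))$ such that $Y_W(\mathbf 1,z)=1_W$ and for all $u,v\in V$ there is a nonzero polynomial $f(z_1,z_2)\in\mathbb C[z_1,z_2]$ with $f(z_1,z_2)Y_W(u,z_1)Y_W(v,z_2)\in\mathrm{Hom}(W,W((z_1,z_2)))$ and $f(\phi(z_2,z_0),z_2)Y_W(Y(u,z_0)v,z_2)=\left(f(z_1,z_2)Y_W(u,z_1)Y_W(v,z_2)\right)|_{z_1=\phi(z_2,z_0)}$.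 It is a $\phi$-coordinated $V$-module if $f$ can always be taken of the form $(z_1-z_2)^k$, $k\in\mathbb N$. It is faithful if $v\mapsto Y_W(v,z)$ is injective. *)

(* Defs.v *)
From HB Require Import structures.
From mathcomp Require Import all_boot all_order all_algebra.
From mathcomp Require Import boolp classical_sets functions fsbigop reals.
From mathcomp Require Export complex.

Set Implicit Arguments.
Unset Strict Implicit.
Unset Printing Implicit Defensive.

Import Order.TTheory GRing.Theory Num.Theory.
Local Open Scope classical_set_scope.
Local Open Scope ring_scope.

(* A formal series in one variable x with coefficients in M is a function
   f : int -> M, where f n is the coefficient of x^n. A series in two variables
   is F : int -> int -> M, where F m n is the coefficient of z1^m z2^n.
   In the case of M((z))((z0)), the first index is the exponent of z0.

   The sums \sum_(i \in setT) are the finitely supported sums of fsbigop: they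
   are 0 when infinitely many terms are nonzero, which does not happen for the
   products and substitutions below when they are applied to truncated series. *)

Section FormalSeries.

Definition lower_truncated (M : nmodType) (f : int -> M) : Prop :=
  exists N : int, forall n, n < N -> f n = 0.

(* M((z1, z2)) = M[[z1, z2]][z1^-1, z2^-1] *)
Definition lower_truncated2 (M : nmodType) (F : int -> int -> M) : Prop :=
  exists N : int, forall m n, (m < N) || (n < N) -> F m n = 0.

Definition cauchy (A B : Type) (M : nmodType) (op : A -> B -> M)
    (f : int -> A) (g : int -> B) : int -> M :=
  fun n => \sum_(i \in setT) op (f i) (g (n - i)).

Definition derivative (K : pzRingType) (M : lmodType K) (f : int -> M) :
  int -> M := fun n => (n + 1)%:~R *: f (n + 1).

(* p(x) d/dx; with M a space of series in z, it is p(z1) d/dz1 on series in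
   z1 and z. *)
Definition derivation (K : pzRingType) (M : lmodType K) (p : int -> K)
    (f : int -> M) : int -> M :=
  cauchy *:%R p (derivative f).

(* e^{z D} a as a series in z *)
Definition exp_series (K : unitRingType) (T : lmodType K) (D : T -> T) (a : T) :
  int -> T :=
  fun k => if k is Posz m then (m`!%:R)^-1 *: iter m D a else 0.

(* F(z, z) *)
Definition diag_eval (M : nmodType) (F : int -> int -> M) : int -> M :=
  fun n => \sum_(i \in setT) F i (n - i).

(* F(z1, z)|_{z1 = phi(z, z0)}; the first index of the result is the exponent
   of z0, the second one that of z. *)
Definition subst_phi (K : unitRingType) (M : lmodType K) (p : int -> K)
    (F : int -> int -> M) : int -> int -> M :=
  fun k => diag_eval (exp_series (derivation p) F k).

End FormalSeries.

Section ScalarSeries.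
Variable K : fieldType.
Implicit Types (p : int -> K) (f g : int -> int -> K).
Implicit Types q : {poly {poly K}}.

Definition monomial (m : int) : int -> K := fun n => (n == m)%:R.

(* z0^l z^m *)
Definition monomial2 (l m : int) : int -> int -> K :=
  fun k n => ((k == l) && (n == m))%:R.

Definition phi p : int -> int -> K :=
  exp_series (derivation (M := K^o) p) (monomial 1).

(* the product of K((z))((z0)) *)
Definition mul2 : (int -> int -> K) -> (int -> int -> K) -> int -> int -> K :=
  cauchy (cauchy *%R).

Definition one2 : int -> int -> K := monomial2 0 0.

(* the inverse in K((z))((z0)) *)
Definition inv2 f : int -> int -> K :=
  xget 0 [set g | [/\ lower_truncated g, (forall k, lower_truncated (g k))
                    & mul2 g f = one2]].

(* q(phi(z, z0), z). The variables z1 and z2 of q(z1, z2) are 'X and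
   'Y = 'X%:P, so q`_i`_j is the coefficient of z1^i z2^j. *)
Definition eval_phi p q : int -> int -> K :=
  \sum_(i < size q) \sum_(j < size q`_i)
    (fun k n => q`_i`_j * mul2 (iter i (mul2 (phi p)) one2)
                               (monomial2 0 j%:Z) k n).

(* q(z1, z2) F(z1, z2) *)
Definition pmul (M : lmodType K) q (F : int -> int -> M) : int -> int -> M :=
  fun m n => \sum_(i < size q) \sum_(j < size q`_i)
    q`_i`_j *: F (m - i%:Z) (n - j%:Z).

(* the action of K((z))((z0)) on M((z))((z0)) *)
Definition scale2 (M : lmodType K) f (F : int -> int -> M) : int -> int -> M :=
  cauchy (cauchy *:%R) f F.

End ScalarSeries.

Section Fields.
Variables (K : fieldType) (W : lmodType K).

(* For a : W -> int -> W, the vector a w n is the coefficient of z^n in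
   a(z)w. *)
Implicit Types a b : W -> int -> W.
Implicit Types q : {poly {poly K}}.

(* E(W) = Hom(W, W((z))) *)
Definition calE : set (W -> int -> W) :=
  [set a | linear a /\ forall w, lower_truncated (a w)].

Definition id_field : W -> int -> W := fun w n => if n == 0 then w else 0.

(* a(z1)b(z2)w *)
Definition field_prod a b (w : W) : int -> int -> W := fun m n => a (b w n) m.

(* [a(z1), b(z2)]w *)
Definition field_comm a b (w : W) : int -> int -> W :=
  fun m n => a (b w n) m - b (a w m) n.

Definition annihilates q a b : Prop := forall w, pmul q (field_comm a b w) = 0.

Definition quasi_local_pair a b : Prop :=
  exists2 q, q != 0 & annihilates q a b.

Definition local_pair a b : Prop :=
  exists n : nat, annihilates (('X - 'Y) ^+ n) a b.

Definition quasi_local (S : set (W -> int -> W)) : Prop :=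
  forall a b, S a -> S b -> quasi_local_pair a b.

Definition local (S : set (W -> int -> W)) : Prop :=
  forall a b, S a -> S b -> local_pair a b.

(* Y_E^phi(a(z), z0)b(z)w, computed with a chosen nonzero q such that
   q(z1, z2)[a(z1), b(z2)] = 0 *)
Definition YE (p : int -> K) a b (w : W) : int -> int -> W :=
  let q := xget 0 [set q | q != 0 /\ annihilates q a b] in
  scale2 (inv2 (eval_phi p q)) (subst_phi p (pmul q (field_prod a b w))).

(* a(z)_n^phi b(z) *)
Definition YE_mode (p : int -> K) a (n : int) b : W -> int -> W :=
  fun w => YE p a b w (- n - 1).

Definition YE_closed_subspace (p : int -> K) (U : set (W -> int -> W)) : Prop :=
  [/\ U `<=` calE,
      U 0,
      (forall (c : K) a b, U a -> U b -> U (c *: a + b)),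
      quasi_local U
    & forall a b n, U a -> U b -> U (YE_mode p a n b)].

(* <S>_phi *)
Definition YE_span (p : int -> K) (S : set (W -> int -> W)) :
    set (W -> int -> W) :=
  smallest (YE_closed_subspace p) (S `|` [set id_field]).

End Fields.

Arguments calE {K} W.
Arguments id_field {K} W.

Section VertexAlgebra.
Variables (K : fieldType) (V : lmodType K).

Definition gbinom (l : int) (i : nat) : K :=
  (\prod_(j < i) (l%:~R - j%:R)) / i`!%:R.

(* Y(u, z)v = \sum_n (Y u n v) z^{-n-1}. The last axiom is the Jacobi identity
     z0^-1 delta((z1 - z2)/z0) Y(u, z1)Y(v, z2)
     - z0^-1 delta((z2 - z1)/(- z0)) Y(v, z2)Y(u, z1)
     = z2^-1 delta((z1 - z0)/z2) Y(Y(u, z0)v, z2),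
   at the coefficient of z0^{-l-1} z1^{-m-1} z2^{-n-1}. *)
Record vertex_algebra (Y : V -> int -> V -> V) (one : V) : Prop := {
  va_linearl : forall n v, linear (fun u => Y u n v);
  va_linearr : forall u n, linear (Y u n);
  va_truncated : forall u v, exists N : int, forall n, N <= n -> Y u n v = 0;
  va_vacuum : forall n v, Y one n v = if n == -1 then v else 0;
  va_creation : forall v, Y v (-1) one = v /\ forall n, 0 <= n -> Y v n one = 0;
  va_jacobi : forall (u v w : V) (l m n : int),
    \sum_(i \in [set: nat]) (((-1) ^+ i * gbinom l i) *:
       (Y u (m + l - i%:Z) (Y v (n + i%:Z) w)
        - (-1) ^ l *: Y v (n + l - i%:Z) (Y u (m + i%:Z) w)))
    = \sum_(i \in [set: nat])
        (gbinom m i *: Y (Y u (l + i%:Z) v) (m + n - i%:Z) w)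
}.

Definition vertex_subalgebra (Y : V -> int -> V -> V) (one : V)
    (U : set V) : Prop :=
  [/\ U one,
      (forall (c : K) u v, U u -> U v -> U (c *: u + v))
    & forall u v n, U u -> U v -> U (Y u n v)].

Definition generating_set (Y : V -> int -> V -> V) (one : V)
    (T : set V) : Prop :=
  smallest (vertex_subalgebra Y one) T = setT.

End VertexAlgebra.

Section CoordinatedModules.
Variables (K : fieldType) (V W : lmodType K) (p : int -> K).
Variables (Y : V -> int -> V -> V) (one : V) (YW : V -> W -> int -> W).

Definition phi_associative (f : {poly {poly K}}) (u v : V) : Prop :=
  (forall w, lower_truncated2 (pmul f (field_prod (YW u) (YW v) w))) /\
  forall w,
    scale2 (eval_phi p f) (fun k => YW (Y u (- k - 1) v) w)
    = subst_phi p (pmul f (field_prod (YW u) (YW v) w)).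

Record phi_coordinated (Q : set {poly {poly K}}) : Prop := {
  phi_linear : linear YW;
  phi_calE : forall v, calE W (YW v);
  phi_vacuum : YW one = id_field W;
  phi_assoc : forall u v, exists2 f, Q f & phi_associative f u v
}.

Definition phi_coordinated_quasi_module : Prop :=
  phi_coordinated [set f | f != 0].

Definition phi_coordinated_module : Prop :=
  phi_coordinated [set f | exists k : nat, f = ('X - 'Y) ^+ k].

Definition faithful : Prop := injective YW.

End CoordinatedModules.

(* <S>_phi as a vector space with its induced operations *)
Section SpanAlgebra.
Variables (K : fieldType) (W : lmodType K) (p : int -> K).
Variable S : set (W -> int -> W).

Definition YE_span_pred : pred (W -> int -> W) := fun a => `[< YE_span p S a >].

Fact YE_span_submod : submod_closed YE_span_pred.
Proof.
split; first by apply/asboolP => U [[]].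
move=> c a b /asboolP Sa /asboolP Sb; apply/asboolP => U HU.
by have [[_ _ lin _ _] _] := HU; apply: lin; [apply: Sa | apply: Sb].
Qed.

HB.instance Definition _ :=
  GRing.isSubmodClosed.Build K (W -> int -> W) YE_span_pred YE_span_submod.

Definition YE_spanT : Type := {a : W -> int -> W | YE_span_pred a}.

HB.instance Definition _ := SubType.on YE_spanT.
HB.instance Definition _ := [Choice of YE_spanT by <:].
HB.instance Definition _ := [SubChoice_isSubLmodule of YE_spanT by <:].

Fact YE_span_one_subproof : YE_span_pred (id_field W).
Proof. by apply/asboolP => U [_]; apply; right. Qed.

Definition YE_span_one : YE_spanT :=
  Sub (id_field W) YE_span_one_subproof.

Fact YE_span_mode_subproof (a b : YE_spanT) (n : int) :
  YE_span_pred (YE_mode p (val a) n (val b)).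
Proof.
apply/asboolP => U HU; have [[_ _ _ _ cl] _] := HU.
by apply: cl; [case: a => a /= /asboolP | case: b => b /= /asboolP]; apply.
Qed.

Definition YE_span_mode (a : YE_spanT) (n : int) (b : YE_spanT) : YE_spanT :=
  Sub (YE_mode p (val a) n (val b)) (YE_span_mode_subproof a b n).

Definition YE_span_action (a : YE_spanT) : W -> int -> W := val a.

End SpanAlgebra.

Arguments YE_span_mode {K W} p S.
Arguments YE_span_action {K W} p S.

(* Main.v *)
(* Fix q with q(z1, z2) [a(z1), b(z2)] = 0. Up to the factor q(z1, z), the series
   a(z1) b(z) w lies in W((z1, z)), and Y_E(a, x) b is the extension of the
   substitution z1 = phi(z, x) to such series (hat). This extension is linear
   over C((z)), commutes with operators on W, and carries p d/dz to
   p d/dz - d/dx.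

   If q1 kills [a, u] and q2 kills [a, v], then q2(z1, z) q1(z1, phi(z, x)) kills
   [a(z1), Y_E(u, x) v(z)]; since its constant term in x is q2 q1, a power of
   q2 q1 kills each [a, u_n v]. Hence everything generated by S is pairwise
   quasi local, and local if S is.

   Substituting z1 = phi(z, x1) and z2 = phi(z, x2) in q(z1, z2) a(z1) b(z2) c(z)
   gives the same series whichever of Y_E(a, x1) Y_E(b, x2) c and
   Y_E(b, x2) Y_E(a, x1) c it is obtained from. As phi(z, x1) - phi(z, x2) is
   x1 - x2 times a unit, q(phi(z, x1), phi(z, x2)) is a power of x1 - x2 times a
   unit of C((z))[[x1, x2]], so the fields Y_E(a, x) are mutually local even when
   S is only quasi local.

   Finally, locality, creation and translation covariance imply the Jacobi
   identity: locality applied to the vacuum gives skew symmetry, which turns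
   locality into associativity; the defect of the Jacobi identity at (l, m, n)
   thus vanishes for large l and for large m, hence everywhere by the recursion
   relating (l + 1, m, n), (l, m + 1, n) and (l, m, n + 1). *)

(* The obstacle: Y_E(a, x1) Y_E(b, x2) c is a series in x1 inside one in x2, while the product in
   the other order is a series in x2 inside one in x1. The two rings of scalars differ, so one
   cannot simply divide both by the same series. Only double power series can be compared. Hence q
   is split as (z1 - z2)^k q' with q'(z, z) nonzero. The cofactor of (x1 - x2)^k has constant term
   q'(z, z) p^k, which is invertible in C((z)); its inverse is a double power series with the same
   coefficients in either order. The exponent k, being the multiplicity of z1 - z2 in q, is chosen
   before c, as locality demands.

   The substitution is handled by replacing z1^i with phi(z, x)^i, not by exponentiating p(z1)
   d/dz1: multiplication by z1 then becomes multiplication by phi because e^{xD} is multiplicative.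
   Coefficient functions are first turned into nested Laurent series, so that denominators are
   cancelled in the field C((z))((x)). *)
Require Import Defs.
From HB Require Import structures.
From mathcomp Require Import all_boot all_order all_algebra polyXY.
From mathcomp Require Import boolp classical_sets functions fsbigop reals.
From mathcomp Require Import zify ring.
Set Implicit Arguments.
Unset Strict Implicit.
Unset Printing Implicit Defensive.
Import Order.TTheory GRing.Theory Num.Theory.
Local Open Scope classical_set_scope.
Local Open Scope ring_scope.

(** * Sums over the integers *)

Notation isum F := (\sum_(i \in [set: int]) F i).

Section IntegerSums.
Variable M : zmodType.
Implicit Types F G : int -> M.

Definition within (N : nat) F := forall i : int, (N < `|i|)%N -> F i = 0.

Lemma isum_range (a : int) (N : nat) F :
  (forall i, (i < a) || (a + N%:Z <= i) -> F i = 0) ->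
  isum F = \sum_(k < N) F (a + k%:Z).
Proof.
move=> F0; rewrite (fsbigE ([seq a + k%:Z | k <- iota 0 N] : seq int)).
- rewrite big_map -[N in iota 0 N]subn0 -/(index_iota 0 N) big_mkord.
  by apply: eq_bigl => k; rewrite in_setT.
- by rewrite map_inj_uniq ?iota_uniq // => i j; lia.
- by [].
- move=> i _ iN; apply: F0; apply: contraR iN => iN.
  by apply/mapP; exists (absz (i - a)); rewrite ?mem_iota; lia.
Qed.

Lemma isumE N F :
  within N F -> isum F = \sum_(k < (N + N).+1) F (- N%:Z + k%:Z).
Proof. by move=> FN; apply: isum_range => i iN; apply: FN; lia. Qed.

Lemma within_widen N N' F : (N <= N')%N -> within N F -> within N' F.
Proof. by move=> NN FN i iN; apply: FN; lia. Qed.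

Lemma within_between (a b : int) F :
  (forall i, (i < a) || (b < i) -> F i = 0) -> within (`|a| + `|b|) F.
Proof. by move=> H i iN; apply: H; lia. Qed.

Lemma isum1 (j : int) F : (forall i, i != j -> F i = 0) -> isum F = F j.
Proof.
move=> Fj; rewrite (fsbigE [:: j]) ?big_cons ?big_nil ?in_setT //= ?addr0 //.
by move=> i _; rewrite inE; apply: Fj.
Qed.

Lemma isum0 F : (forall i, F i = 0) -> isum F = 0.
Proof. by move=> F0; rewrite (isum1 (j := 0)) // F0. Qed.

Lemma eq_isum F G : F =1 G -> isum F = isum G.
Proof. by move=> /funext ->. Qed.

Lemma isumD N F G : within N F -> within N G ->
  isum (fun i => F i + G i) = isum F + isum G.
Proof.
move=> FN GN; rewrite !(isumE (N := N)) ?big_split //.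
by move=> i iN; rewrite FN // GN // addr0.
Qed.

Lemma isum_shift (c : int) F : isum (fun i => F (i + c)) = isum F.
Proof.
rewrite [RHS](reindex_fsbigT (fun i => i + c)) //.
exists (fun i => i - c) => i; first by rewrite addrK.
by rewrite subrK.
Qed.

Lemma isum_refl (c : int) F : isum (fun i => F (c - i)) = isum F.
Proof.
rewrite [RHS](reindex_fsbigT (fun i => c - i)) //.
by exists (fun i => c - i) => i; rewrite subKr.
Qed.

(** A common box is assumed because a finitely supported sum is 0 on infinite support; without a
    uniform bound the two iterated sums may differ. *)
Lemma isum_exchange N (F : int -> int -> M) :
  (forall i j, (N < `|i|)%N || (N < `|j|)%N -> F i j = 0) ->
  isum (fun i => isum (fun j => F i j)) = isum (fun j => isum (fun i => F i j)).
Proof.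
move=> FN.
rewrite (isumE (N := N)); last first.
  by move=> i iN; apply: isum0 => j; rewrite FN ?iN.
rewrite (isumE (N := N)); last first.
  by move=> j jN; apply: isum0 => i; rewrite FN ?jN ?orbT.
under eq_bigr => k _.
  rewrite (isumE (N := N)); last by move=> j jN; rewrite FN ?jN ?orbT.
  over.
rewrite exchange_big; apply: eq_bigr => k _.
by rewrite (isumE (N := N)) // => i iN; rewrite FN ?iN.
Qed.

End IntegerSums.


Lemma isum_sum (M : zmodType) (I : Type) (r : seq I) N (F : I -> int -> M) :
  (forall k, within N (F k)) ->
  isum (fun i => \sum_(k <- r) F k i) = \sum_(k <- r) isum (F k).
Proof.
move=> FN; elim: r => [|k r IH].
  by rewrite big_nil; apply: isum0 => i; rewrite big_nil.
rewrite big_cons -IH -(isumD (N := N)) //.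
  by apply: eq_isum => i; rewrite big_cons.
by move=> i iN; apply: big1 => l _; apply: FN.
Qed.

Lemma isum_morph (M M' : zmodType) (f : M -> M') N (F : int -> M) :
  {morph f : x y / x + y} -> within N F -> f (isum F) = isum (fun i => f (F i)).
Proof.
move=> fD FN.
have f0 : f 0 = 0 by apply: (addrI (f 0)); rewrite -fD !addr0.
rewrite !(isumE (N := N)) ?(big_morph f fD f0) //.
by move=> i iN; rewrite FN.
Qed.

(** * Laurent series *)

Definition below (M : nmodType) (N : int) (f : int -> M) :=
  forall n, n < N -> f n = 0.

Section Cauchy.

Definition biadditive (A B M : zmodType) (op : A -> B -> M) :=
  (forall a, {morph op a : x y / x + y}) /\
  (forall b, {morph op^~ b : x y / x + y}).

Lemma biadditive0l (A B M : zmodType) (op : A -> B -> M) b :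
  biadditive op -> op 0 b = 0.
Proof. by move=> [_ opD]; apply: (addrI (op 0 b)); rewrite -opD !addr0. Qed.

Lemma biadditive0r (A B M : zmodType) (op : A -> B -> M) a :
  biadditive op -> op a 0 = 0.
Proof. by move=> [opD _]; apply: (addrI (op a 0)); rewrite -opD !addr0. Qed.

Lemma cauchy_within (A B M : zmodType) (op : A -> B -> M) f g a b n :
  biadditive op -> below a f -> below b g ->
  within (`|a| + `|n - b|) (fun i => op (f i) (g (n - i))).
Proof.
move=> opA fa gb; apply: within_between => i /orP[ia|ib].
  by rewrite fa // biadditive0l.
by rewrite gb ?biadditive0r //; lia.
Qed.

Lemma cauchy_below (A B M : zmodType) (op : A -> B -> M) f g a b :
  biadditive op -> below a f -> below b g -> below (a + b) (cauchy op f g).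
Proof.
move=> opA fa gb n nab; apply: isum0 => i.
have [ia|ia] := ltP i a; first by rewrite fa // biadditive0l.
by rewrite gb ?biadditive0r //; lia.
Qed.

(** Four operations are kept apart so that one proof serves both the product of [laurent A] and its
    action on [laurent M]. *)
Lemma cauchyA (A B C AB BC M : zmodType)
  (op1 : A -> B -> AB) (op2 : AB -> C -> M) (op3 : B -> C -> BC)
  (op4 : A -> BC -> M) f g h a b c :
  biadditive op1 -> biadditive op2 -> biadditive op3 -> biadditive op4 ->
  (forall x y z, op2 (op1 x y) z = op4 x (op3 y z)) ->
  below a f -> below b g -> below c h ->
  cauchy op2 (cauchy op1 f g) h =1 cauchy op4 f (cauchy op3 g h).
Proof.
move=> b1 b2 b3 b4 opA fa gb hc n; rewrite /cauchy.
transitivity (isum (fun i => isum (fun j =>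
    op2 (op1 (f j) (g (i - j))) (h (n - i))))).
  apply: eq_isum => i.
  by rewrite (isum_morph (f := op2^~ _) (b2.2 _) (cauchy_within b1 fa gb)).
rewrite (@isum_exchange _ (`|a| + `|b| + `|c| + `|n|)); last first.
  move=> i j ij.
  have [ja|ja] := ltP j a; first by rewrite fa // !(biadditive0l _ b1, biadditive0l _ b2).
  have [ib|ib] := ltP (i - j) b.
    by rewrite gb // (biadditive0r _ b1) (biadditive0l _ b2).
  by rewrite hc ?(biadditive0r _ b2) //; lia.
apply: eq_isum => j.
rewrite (isum_morph (f := op4 _) (b4.1 _) (cauchy_within b3 gb hc)).
rewrite -[LHS](isum_shift j); apply: eq_isum => i.
by rewrite opA addrK; congr (op4 _ (op3 _ (h _))); lia.
Qed.

Lemma cauchyDl (A B M : zmodType) (op : A -> B -> M) f f' g a b :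
  biadditive op -> below a f -> below a f' -> below b g ->
  cauchy op (fun i => f i + f' i) g =1
  (fun n => cauchy op f g n + cauchy op f' g n).
Proof.
move=> opA fa fa' gb n; rewrite /cauchy.
rewrite -(isumD (cauchy_within opA fa gb) (cauchy_within opA fa' gb)).
by apply: eq_isum => i; rewrite opA.2.
Qed.

Lemma cauchyDr (A B M : zmodType) (op : A -> B -> M) f g g' a b :
  biadditive op -> below a f -> below b g -> below b g' ->
  cauchy op f (fun i => g i + g' i) =1
  (fun n => cauchy op f g n + cauchy op f g' n).
Proof.
move=> opA fa gb gb' n; rewrite /cauchy.
rewrite -(isumD (cauchy_within opA fa gb) (cauchy_within opA fa gb')).
by apply: eq_isum => i; rewrite opA.1.
Qed.

End Cauchy.

Lemma biadditive_mul (R : pzRingType) : biadditive (@GRing.mul R).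
Proof. by split=> [a x y|b x y] /=; rewrite ?mulrDr ?mulrDl. Qed.

Lemma biadditive_scale (R : pzRingType) (M : lmodType R) :
  biadditive (@GRing.scale R M).
Proof. by split=> [a x y|b x y] /=; rewrite ?scalerDr ?scalerDl. Qed.

Section Laurent.
Variable M : zmodType.

Definition laurent_pred : pred (int -> M) := fun f => `[< lower_truncated f >].

Fact laurent_zmod_closed : zmod_closed laurent_pred.
Proof.
split; first by apply/asboolP; exists 0.
move=> f g; rewrite !unfold_in => /asboolP[a fa] /asboolP[b gb]; apply/asboolP.
exists (Num.min a b) => n; rewrite lt_min => /andP[na nb].
by rewrite [LHS](_ : _ = f n - g n) // fa // gb // subr0.
Qed.

HB.instance Definition _ :=
  GRing.isZmodClosed.Build (int -> M) laurent_pred laurent_zmod_closed.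

Record laurent : Type := Laurent {
  lcoef :> int -> M;
  _ : laurent_pred lcoef
}.

HB.instance Definition _ := [isSub for lcoef].
HB.instance Definition _ := [Choice of laurent by <:].
HB.instance Definition _ := [SubChoice_isSubZmodule of laurent by <:].

Lemma lcoefP (f : laurent) : exists N, below N f.
Proof. exact/asboolP/(valP f). Qed.

Lemma laurentP (f g : laurent) : (forall n, f n = g n) -> f = g.
Proof. by move=> fg; apply: val_inj; apply/funext. Qed.

Lemma lcoef0 n : (0 : laurent) n = 0. Proof. by []. Qed.

Lemma lcoefD (f g : laurent) n : (f + g) n = f n + g n. Proof. by []. Qed.

Lemma lcoefN (f : laurent) n : (- f) n = - f n. Proof. by []. Qed.

Lemma lcoefB (f g : laurent) n : (f - g) n = f n - g n. Proof. by []. Qed.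

Lemma lcoef_sum (I : Type) (r : seq I) (P : pred I) (F : I -> laurent) n :
  (\sum_(i <- r | P i) F i) n = \sum_(i <- r | P i) F i n.
Proof. by elim/big_rec2: _ => // i x y _ <-. Qed.

Lemma lcoefMn (f : laurent) k n : (f *+ k) n = f n *+ k.
Proof. by elim: k => // k IH; rewrite !mulrS lcoefD IH. Qed.

Lemma lcoefMz (f : laurent) k n : (f *~ k) n = f n *~ k.
Proof. by case: k => k; rewrite ?lcoefN lcoefMn. Qed.

(* mkL is opaque, so that unification does not unfold the operations that
   are defined with it. *)
Fact mkL_exists (f : int -> M) :
  {g : laurent | forall N, below N f -> g =1 f}.
Proof.
exists (insubd (0 : laurent) f) => N fN n.
by rewrite -[LHS]/(val _ n) insubdK //; apply/asboolP; exists N.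
Qed.

Definition mkL (f : int -> M) : laurent := sval (mkL_exists f).

Lemma mkLE f N n : below N f -> mkL f n = f n.
Proof. by move=> fN; rewrite /mkL; case: mkL_exists => g /= /(_ N fN). Qed.

Lemma mkLK (f : laurent) : mkL f = f.
Proof. by have [N fN] := lcoefP f; apply: laurentP => n; rewrite (mkLE _ fN). Qed.

Definition lmon (m : int) (a : M) : laurent :=
  mkL (fun n => if n == m then a else 0).

Lemma lmonE m a n : lmon m a n = if n == m then a else 0.
Proof. by rewrite (@mkLE _ m) // => i im; rewrite lt_eqF. Qed.

Lemma lmonD m a b : lmon m (a + b) = lmon m a + lmon m b.
Proof.
by apply: laurentP => n; rewrite lcoefD !lmonE; case: eqP; rewrite ?addr0.
Qed.

Lemma lmonN m a : lmon m (- a) = - lmon m a.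
Proof.
by apply: laurentP => n; rewrite lcoefN !lmonE; case: eqP; rewrite ?oppr0.
Qed.

End Laurent.

Arguments lmon {M} m a.

Section LaurentMap.
Variables (M M' : zmodType) (h : M -> M').

Definition lmap (f : laurent M) : laurent M' := mkL (fun n => h (f n)).

Hypothesis hD : {morph h : x y / x + y}.

Let h0 : h 0 = 0. Proof. by apply: (addrI (h 0)); rewrite -hD !addr0. Qed.

Lemma lmapE f n : lmap f n = h (f n).
Proof.
by have [N fN] := lcoefP f; rewrite (@mkLE _ _ N) // => i iN; rewrite fN.
Qed.

Lemma lmapD : {morph lmap : f g / f + g}.
Proof. by move=> f g; apply: laurentP => n; rewrite lcoefD !lmapE lcoefD hD. Qed.

Lemma lmap_mon m a : lmap (lmon m a) = lmon m (h a).
Proof. by apply: laurentP => n; rewrite lmapE !lmonE; case: eqP. Qed.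

End LaurentMap.

Section LaurentRing.
Variable A : comNzRingType.
Implicit Types f g h : laurent A.

Definition lmul f g : laurent A := mkL (cauchy *%R f g).

Let bm := @biadditive_mul A.

Lemma lmul_raw f g : lcoef (lmul f g) = cauchy *%R f g.
Proof.
have [[a fa] [b gb]] := (lcoefP f, lcoefP g).
by apply/funext => n; rewrite (mkLE _ (cauchy_below bm fa gb)).
Qed.

Fact lmulA : associative lmul.
Proof.
move=> f g h; have [[a fa] [b gb] [c hc]] := And3 (lcoefP f) (lcoefP g) (lcoefP h).
apply: laurentP => n; rewrite !lmul_raw; apply/esym.
by apply: cauchyA fa gb hc _; do ?[exact: bm]; move=> x y z; rewrite mulrA.
Qed.

Fact lmulC : commutative lmul.
Proof.
move=> f g; apply: laurentP => n; rewrite !lmul_raw /cauchy -(isum_refl n).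
by apply: eq_isum => i; rewrite mulrC subKr.
Qed.

Fact lmul1 : left_id (lmon 0 1) lmul.
Proof.
move=> f; apply: laurentP => n; rewrite lmul_raw /cauchy (isum1 (j := 0)).
  by rewrite lmonE eqxx mul1r subr0.
by move=> i /negPf i0; rewrite lmonE i0 mul0r.
Qed.

Fact lmulDl : left_distributive lmul +%R.
Proof.
move=> f g h; have [[a fa] [b gb] [c hc]] := And3 (lcoefP f) (lcoefP g) (lcoefP h).
apply: laurentP => n; rewrite lcoefD !lmul_raw.
rewrite -(@cauchyDl _ _ _ _ _ _ _ (Num.min a b) c) //.
- by move=> i; rewrite lt_min => /andP[ia _]; apply: fa.
- by move=> i; rewrite lt_min => /andP[_ ib]; apply: gb.
Qed.

Fact lone_neq0 : lmon 0 1 != 0 :> laurent A.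
Proof.
by apply/eqP => /(congr1 (fun f : laurent A => f 0)); rewrite lmonE => /eqP; rewrite oner_eq0.
Qed.

HB.instance Definition _ := GRing.Zmodule_isComNzRing.Build (laurent A)
  lmulA lmulC lmul1 lmulDl lone_neq0.

Lemma lcoefM f g n : (f * g) n = isum (fun i => f i * g (n - i)).
Proof. by rewrite -[LHS]/(lcoef (lmul f g) n) lmul_raw. Qed.

Lemma lcoef1 n : (1 : laurent A) n = (n == 0)%:R.
Proof. by rewrite [LHS]lmonE; case: eqP. Qed.

Lemma lmonM m a f n : (lmon m a * f) n = a * f (n - m).
Proof.
rewrite lcoefM (isum1 (j := m)) ?lmonE ?eqxx // => i /negPf im.
by rewrite lmonE im mul0r.
Qed.

Lemma lmon_mul m m' (a b : A) : lmon m a * lmon m' b = lmon (m + m') (a * b).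
Proof.
apply: laurentP => n; rewrite lmonM !lmonE subr_eq [m' + m]addrC.
by case: eqP; rewrite ?mulr0.
Qed.

Definition lcst (a : A) : laurent A := lmon 0 a.

Fact lcst_zmod : zmod_morphism lcst.
Proof. by move=> a b; rewrite /lcst lmonD lmonN. Qed.

Fact lcst_monoid : monoid_morphism lcst.
Proof. by split=> // a b; rewrite /lcst lmon_mul. Qed.

HB.instance Definition _ := GRing.isZmodMorphism.Build A (laurent A) lcst lcst_zmod.
HB.instance Definition _ := GRing.isMonoidMorphism.Build A (laurent A) lcst lcst_monoid.

Lemma lcstM a f n : (lcst a * f) n = a * f n.
Proof. by rewrite lmonM subr0. Qed.

Lemma below_mul a b f g : below a f -> below b g -> below (a + b) (f * g).
Proof. by move=> fa gb n nab; rewrite lcoefM; apply: (cauchy_below bm fa gb nab). Qed.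

Lemma lcoefM_lead a b f g : below a f -> below b g ->
  (f * g) (a + b) = f a * g b.
Proof.
move=> fa gb; rewrite lcoefM (isum1 (j := a)) => [|i ia].
  by rewrite addrC addKr.
have [ia'|ia'] := ltP i a; first by rewrite fa ?mul0r.
by rewrite gb ?mulr0 //; lia.
Qed.

End LaurentRing.

Arguments lcst {A} a.

Section LaurentModule.
Variables (A : comNzRingType) (M : lmodType A).
Implicit Types (f g : laurent A) (m : laurent M).

Definition lscale f m : laurent M := mkL (cauchy *:%R f m).

Let bm := @biadditive_mul A.
Let bs := @biadditive_scale A M.

Lemma lscale_raw f m : lcoef (lscale f m) = cauchy *:%R f m.
Proof.
have [[a fa] [b mb]] := (lcoefP f, lcoefP m).
by apply/funext => n; rewrite (mkLE _ (cauchy_below bs fa mb)).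
Qed.

Fact lscaleA f g m : lscale f (lscale g m) = lscale (f * g) m.
Proof.
have [[a fa] [b gb] [c mc]] := And3 (lcoefP f) (lcoefP g) (lcoefP m).
apply: laurentP => n; rewrite !lscale_raw.
rewrite (_ : lcoef (f * g) = cauchy *%R f g); last exact: lmul_raw.
apply/esym; apply: cauchyA fa gb mc _; do ?[exact: bm|exact: bs].
by move=> x y z; rewrite scalerA.
Qed.

Fact lscale1 : left_id 1 lscale.
Proof.
move=> m; apply: laurentP => n; rewrite lscale_raw /cauchy (isum1 (j := 0)).
  by rewrite lcoef1 eqxx scale1r subr0.
by move=> i /negPf i0; rewrite lcoef1 i0 scale0r.
Qed.

Fact lscaleDr : right_distributive lscale +%R.
Proof.
move=> f m m'; have [[a fa] [b mb] [c mc]] := And3 (lcoefP f) (lcoefP m) (lcoefP m').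
apply: laurentP => n; rewrite lcoefD !lscale_raw.
rewrite -(@cauchyDr _ _ _ _ _ _ _ a (Num.min b c)) //.
- by move=> i; rewrite lt_min => /andP[ia _]; apply: mb.
- by move=> i; rewrite lt_min => /andP[_ ib]; apply: mc.
Qed.

Fact lscaleDl m : {morph lscale^~ m : f g / f + g}.
Proof.
move=> f g; have [[a fa] [b gb] [c mc]] := And3 (lcoefP f) (lcoefP g) (lcoefP m).
apply: laurentP => n; rewrite lcoefD !lscale_raw.
rewrite -(@cauchyDl _ _ _ _ _ _ _ (Num.min a b) c) //.
- by move=> i; rewrite lt_min => /andP[ia _]; apply: fa.
- by move=> i; rewrite lt_min => /andP[_ ib]; apply: gb.
Qed.

HB.instance Definition _ := GRing.Zmodule_isLmodule.Build (laurent A) (laurent M)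
  lscaleA lscale1 lscaleDr lscaleDl.

Lemma lcoefZ f m n : (f *: m) n = isum (fun i => f i *: m (n - i)).
Proof. by rewrite -[LHS]/(lcoef (lscale f m) n) lscale_raw. Qed.

Lemma lmonZ k a m n : (lmon k a *: m) n = a *: m (n - k).
Proof.
rewrite lcoefZ (isum1 (j := k)) ?lmonE ?eqxx // => i /negPf im.
by rewrite lmonE im scale0r.
Qed.

Lemma lcstZ a m n : (lcst a *: m) n = a *: m n.
Proof. by rewrite lmonZ subr0. Qed.

Lemma scale_within f m a b n : below a f -> below b m ->
  within (`|a| + `|n - b|) (fun i => f i *: m (n - i)).
Proof. exact: cauchy_within. Qed.

Lemma below_scale a b f m : below a f -> below b m -> below (a + b) (f *: m).
Proof. by move=> fa gb n nab; rewrite lcoefZ; apply: (cauchy_below bs fa gb nab). Qed.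

End LaurentModule.

Lemma lcoefM_nat (A : comNzRingType) (f g : laurent A) (n : nat) :
  below 0 f -> below 0 g ->
  (f * g) n%:Z = \sum_(i < n.+1) f i%:Z * g (n%:Z - i%:Z).
Proof.
move=> f0 g0; rewrite lcoefM (isum_range (a := 0) (N := n.+1)).
  by apply: eq_bigr => i _; rewrite add0r.
by move=> i ni; have [/f0->|i0] := ltP i 0; rewrite ?mul0r // g0 ?mulr0 //; lia.
Qed.

Section PowerSeriesInverse.
Variables (A : comNzRingType) (C : A -> Prop).
Hypothesis C0 : C 0.
Hypothesis CB : forall x y, C x -> C y -> C (x - y).
Hypothesis CM : forall x y, C x -> C y -> C (x * y).
Variables (f : laurent A) (u : A).
Hypotheses (f0 : below 0 f) (Cf : forall i, C (f i)) (Cu : C u) (uf : u * f 0 = 1).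

(** The whole list h_0, ..., h_n is carried along, since each coefficient of the inverse depends on
    all earlier ones. *)
Let hs := fix hs n := if n is m.+1 then
  rcons (hs m) (0 - u * \sum_(i < m.+1) f (m.+1%:Z - i%:Z) * nth 0 (hs m) i)
  else [:: u].

Let size_hs n : size (hs n) = n.+1.
Proof. by elim: n => //= n IH; rewrite size_rcons IH. Qed.

Let hs_nth m i : (i <= m)%N -> nth 0 (hs m) i = nth 0 (hs i) i.
Proof.
elim: m => [|m IH]; first by rewrite leqn0 => /eqP->.
rewrite leq_eqVlt => /orP[/eqP->//|im].
by rewrite [hs m.+1]/= nth_rcons size_hs im IH.
Qed.

(** The recursion uses only differences and products, so the coefficients never leave [C]. With [C]
    the power series in another variable this yields inverses of double power series; over a field
    [C] is trivial. *)
Lemma series_inverse : exists h : laurent A,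
  [/\ below 0 h, (forall i, C (h i)) & f * h = 1].
Proof.
pose hn n := nth 0 (hs n) n.
have hnS n : hn n.+1 = 0 - u * \sum_(i < n.+1) f (n.+1%:Z - i%:Z) * hn i.
  rewrite /hn [in LHS]/= nth_rcons size_hs ltnn eqxx; congr (_ - _ * _).
  by apply: eq_bigr => i _; rewrite hs_nth // -ltnS.
have Chn n : C (hn n).
  have [m] := ubnP n; elim: m n => // m IH [|n] nm //.
  rewrite hnS; apply: CB => //; apply: CM => //.
  elim/big_ind: _ => // [x y Cx Cy|i _].
    by rewrite -[y]opprK -[- y]sub0r; apply: CB => //; apply: CB.
  by apply: CM => //; apply: IH; have := ltn_ord i; lia.
pose hr (i : int) := if i is Posz n then hn n else 0.
have hr0 : below 0 hr by case.
have hE i : mkL hr i = hr i by rewrite (mkLE _ hr0).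
have h0 : below 0 (mkL hr) by move=> i i0; rewrite hE hr0.
exists (mkL hr); split=> // [i|]; first by rewrite hE; case: i.
apply: laurentP => -[n|n]; last by rewrite (below_mul f0 h0) ?lcoef1.
rewrite lcoefM_nat // lcoef1.
case: n => [|n]; first by rewrite big_ord1 subr0 hE /= mulrC -[hn 0%N]/u uf.
rewrite big_ord_recl subr0 hE /hr hnS sub0r mulrN mulrA [f _ * u]mulrC uf mul1r.
rewrite addrC; apply/eqP; rewrite subr_eq0; apply/eqP.
rewrite [RHS](reindex_inj rev_ord_inj) /=.
apply: eq_bigr => i _; rewrite hE.
have iln := ltn_ord i.
have -> : n.+1%:Z - (bump 0 i)%:Z = (n.+1 - i.+1)%N%:Z by rewrite /bump; lia.
by congr (f _ * _); rewrite /bump; lia.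
Qed.

End PowerSeriesInverse.

Lemma laurent_lead (M : zmodType) (f : laurent M) : f != 0 ->
  exists2 v, below v f & f v != 0.
Proof.
move=> fn0; have [N fN] := lcoefP f.
have exk : exists k : nat, f (N + k%:Z) != 0.
  apply: contrapT => /forallNP H; case/eqP: fn0; apply: laurentP => n.
  have [/fN//|nN] := ltP n N.
  have /negP := H (absz (n - N)); rewrite negbK (_ : N + _ = n) ?lcoef0; last by lia.
  by move/eqP.
case: (ex_minnP exk) => k fk mink; exists (N + k%:Z) => // n nk.
have [/fN//|nN] := ltP n N; apply/eqP; apply/negP => /negP fn.
by have := mink (absz (n - N)); rewrite (_ : N + _ = n); [move=> /(_ fn)|]; lia.
Qed.

Lemma laurent_factor (K : fieldType) (f : laurent K) : f != 0 ->
  exists v, exists g : laurent K,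
    [/\ below 0 g, g 0 != 0 & f = lmon v 1 * g].
Proof.
move=> /laurent_lead[v fv fv0]; exists v, (lmon (- v) 1 * f); split.
- by move=> i i0; rewrite lmonM fv ?mulr0 //; lia.
- by rewrite lmonM opprK add0r mul1r.
- by rewrite mulrA lmon_mul subrr mulr1 -[lmon 0 1]/(1 : laurent K) mul1r.
Qed.

Section LaurentField.
Variable K : fieldType.

Lemma laurent_unit (f : laurent K) : f != 0 -> exists g, g * f = 1.
Proof.
move=> /laurent_factor[v [g [g0 gn0 ->]]].
have [h [_ _ gh]] : exists h : laurent K,
    [/\ below 0 h, (forall i, (fun=> True) (h i)) & g * h = 1].
  have CT (x y : K) : (fun=> True) x -> (fun=> True) y -> True by [].
  exact: (@series_inverse K (fun=> True) I CT CT g (g 0)^-1 g0 (fun=> I) I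
    (mulVf gn0)).
exists (lmon (- v) 1 * h).
by rewrite mulrACA lmon_mul addNr mulr1 [h * g]mulrC gh mulr1.
Qed.

Definition linv (f : laurent K) : laurent K :=
  if f == 0 then 0 else xget 0 [set g | g * f = 1].

Fact lmulV f : f != 0 -> linv f * f = 1.
Proof. by move=> f0; rewrite /linv (negPf f0); apply: (xgetPex 0 (laurent_unit f0)). Qed.

Fact linv0 : linv 0 = 0. Proof. by rewrite /linv eqxx. Qed.

HB.instance Definition _ := GRing.ComNzRing_isField.Build (laurent K) lmulV linv0.

End LaurentField.

(** * Termwise derivation and the Leibniz rule *)

Section Derivative.

Lemma biadditiveMzl (A B M : zmodType) (op : A -> B -> M) a b k :
  biadditive op -> op (a *~ k) b = op a b *~ k.
Proof.
move=> opA; have opN x : op (- x) b = - op x b.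
  by apply: (addIr (op x b)); rewrite -opA.2 !addNr biadditive0l.
have opn n : op (a *+ n) b = op a b *+ n.
  by elim: n => [|n IH]; rewrite ?biadditive0l // !mulrS opA.2 IH.
by case: k => k; rewrite ?NegzE ?mulrNz ?opN opn.
Qed.

Lemma biadditiveMzr (A B M : zmodType) (op : A -> B -> M) a b k :
  biadditive op -> op a (b *~ k) = op a b *~ k.
Proof.
by move=> [opl opr]; apply: (@biadditiveMzl B A M (fun b a => op a b)); split.
Qed.

Lemma cauchy_derivative (A B M : zmodType) (op : A -> B -> M) f g a b n :
  biadditive op -> below a f -> below b g ->
  cauchy op f g (n + 1) *~ (n + 1) =
  cauchy op (fun i => f (i + 1) *~ (i + 1)) g n +
  cauchy op f (fun i => g (i + 1) *~ (i + 1)) n.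
Proof.
move=> opA fa gb; rewrite /cauchy.
have fgw := cauchy_within (n := n + 1) opA fa gb.
rewrite (isum_morph (f := fun x => x *~ (n + 1)) _ fgw); last first.
  by move=> x y; rewrite mulrzDl.
pose u i := op (f i) (g (n + 1 - i)) *~ i.
pose v i := op (f i) (g (n + 1 - i)) *~ (n + 1 - i).
transitivity (isum (fun i => u i + v i)).
  by apply: eq_isum => i; rewrite /u /v -mulrzDr; congr (_ *~ _); lia.
rewrite (isumD (N := (`|a| + absz (n + 1 - b)%R)%N)); try by move=> i iN; rewrite /u /v fgw // mul0rz.
rewrite -(isum_shift 1 u); congr (_ + _); apply: eq_isum => i.
  by rewrite /u biadditiveMzl // (_ : n + 1 - (i + 1) = n - i) //; lia.
by rewrite /v biadditiveMzr // (_ : n - i + 1 = n + 1 - i) //; lia.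
Qed.

Section Der.
Variable M : zmodType.

(** The factor n + 1 acts by [*~], so that [der] makes sense over any abelian group, in particular
    as d/dx on series in x whose coefficients are series in z. *)
Definition der (f : laurent M) : laurent M :=
  mkL (fun n => f (n + 1) *~ (n + 1)).

Lemma derE f n : der f n = f (n + 1) *~ (n + 1).
Proof.
have [N fN] := lcoefP f; rewrite (@mkLE _ _ (N - 1)) // => i iN.
by rewrite fN ?mul0rz //; lia.
Qed.

Lemma derD : {morph der : f g / f + g}.
Proof. by move=> f g; apply: laurentP => n; rewrite lcoefD !derE lcoefD mulrzDl. Qed.

Lemma der_mon m a : der (lmon m a) = lmon (m - 1) (a *~ m).
Proof.
apply: laurentP => n; rewrite derE !lmonE eq_sym -subr_eq eq_sym.
by case: eqP => [->|]; rewrite ?subrK ?mul0rz.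
Qed.

Lemma der_cst a : der (lmon 0 a) = 0.
Proof. by rewrite der_mon; apply: laurentP => n; rewrite lmonE; case: eqP. Qed.

Lemma below_der a (f : laurent M) : below a f -> below (a - 1) (der f).
Proof. by move=> fa n na; rewrite derE fa ?mul0rz //; lia. Qed.

End Der.

Lemma derM (A : comNzRingType) (f g : laurent A) :
  der (f * g) = der f * g + f * der g.
Proof.
have [[a fa] [b gb]] := (lcoefP f, lcoefP g).
apply: laurentP => n; rewrite lcoefD derE !lcoefM.
have /= := cauchy_derivative n (@biadditive_mul A) fa gb; rewrite /cauchy => ->.
by congr (_ + _); apply: eq_isum => i; rewrite derE.
Qed.

Lemma derZ (A : comNzRingType) (M : lmodType A) (f : laurent A) (m : laurent M) :
  der (f *: m) = der f *: m + f *: der m.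
Proof.
have [[a fa] [b gb]] := (lcoefP f, lcoefP m).
apply: laurentP => n; rewrite lcoefD derE !lcoefZ.
have /= := cauchy_derivative n (@biadditive_scale A M) fa gb; rewrite /cauchy => ->.
by congr (_ + _); apply: eq_isum => i; rewrite derE.
Qed.

End Derivative.

Lemma lcoefZ_nat (A : comNzRingType) (M : lmodType A) (f : laurent A)
    (g : laurent M) (n : nat) :
  below 0 f -> below 0 g ->
  (f *: g) n%:Z = \sum_(i < n.+1) f i%:Z *: g (n%:Z - i%:Z).
Proof.
move=> f0 g0; rewrite lcoefZ (isum_range (a := 0) (N := n.+1)).
  by apply: eq_bigr => i _; rewrite add0r.
by move=> i ni; have [/f0->|i0] := ltP i 0; rewrite ?scale0r // g0 ?scaler0 //; lia.
Qed.

(** * Locally finite sums of Laurent series *)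

Section LocallyFiniteSums.
Variable W : zmodType.
Implicit Types G : int -> laurent W.

(** Each coefficient of the sum receives finitely many terms. This is the shape of \sum_i phi^i F_i:
    the x^k-coefficient of phi^i has order at least i - e k in z, with e depending only on p. *)
Definition conv (N : int) G :=
  forall i n, (i < N) || (n < i + N) -> G i n = 0.

Definition lsum G : laurent W := mkL (fun n => isum (fun i => G i n)).

Lemma conv_within N G n : conv N G -> within (`|N| + `|n - N|) (fun i => G i n).
Proof. by move=> GN; apply: within_between => i iN; apply: GN; lia. Qed.

Lemma lsumE N G n : conv N G -> lsum G n = isum (fun i => G i n).
Proof.
move=> GN; rewrite (@mkLE _ _ (N + N)) // => m mN; apply: isum0 => i.
by apply: GN; lia.
Qed.

Lemma conv_le N N' G : N' <= N -> conv N G -> conv N' G.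
Proof. by move=> NN GN i n iN; apply: GN; lia. Qed.

Lemma convD N G G' : conv N G -> conv N G' -> conv N (fun i => G i + G' i).
Proof. by move=> GN GN' i n iN; rewrite lcoefD GN // GN' // addr0. Qed.

Lemma lsumD N G G' : conv N G -> conv N G' ->
  lsum (fun i => G i + G' i) = lsum G + lsum G'.
Proof.
move=> GN GN'; apply: laurentP => n; rewrite lcoefD (lsumE _ (convD GN GN')).
rewrite (lsumE _ GN) (lsumE _ GN').
exact: (isumD (conv_within GN) (conv_within GN')).
Qed.

Lemma lsum_sum N (I : Type) (r : seq I) (G : I -> int -> laurent W) :
  (forall k, conv N (G k)) ->
  lsum (fun i => \sum_(k <- r) G k i) = \sum_(k <- r) lsum (G k).
Proof.
move=> GN.
have cs s : conv N (fun i => \sum_(k <- s) G k i).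
  by move=> i n iN; rewrite lcoef_sum big1 // => k _; apply: GN.
apply: laurentP => n; rewrite lcoef_sum (lsumE _ (cs r)).
transitivity (\sum_(k <- r) isum (fun i => G k i n)).
  rewrite -(isum_sum r (fun k => conv_within (n := n) (GN k))).
  by apply: eq_isum => i; rewrite lcoef_sum.
by apply: eq_bigr => k _; rewrite (lsumE _ (GN k)).
Qed.

Lemma lsum_shift c G : lsum (fun i => G (i + c)) = lsum G.
Proof.
rewrite /lsum; congr mkL; apply/funext => n.
exact: (isum_shift c (fun i => G i n)).
Qed.

Lemma der_lsum N G : conv N G -> der (lsum G) = lsum (fun i => der (G i)).
Proof.
move=> GN; have cd : conv (N - 1) (fun i => der (G i)).
  by move=> i n iN; rewrite derE GN ?mul0rz //; lia.
apply: laurentP => n; rewrite derE (lsumE _ cd) (lsumE _ GN).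
rewrite (isum_morph (f := fun x => x *~ (n + 1)) _ (conv_within GN)).
  by apply: eq_isum => i; rewrite derE.
by move=> x y; rewrite mulrzDl.
Qed.

Lemma lsum_exchange N (G : int -> int -> laurent W) :
  (forall i j n, [|| i < N, j < N, n < i + N | n < j + N] -> G i j n = 0) ->
  lsum (fun i => lsum (fun j => G i j)) = lsum (fun j => lsum (fun i => G i j)).
Proof.
move=> GN.
have cr i : conv N (fun j => G i j) by move=> j n jn; apply: GN; lia.
have cl j : conv N (fun i => G i j) by move=> i n jn; apply: GN; lia.
have c1 : conv N (fun i => lsum (fun j => G i j)).
  by move=> i n iN; rewrite (lsumE _ (cr i)); apply: isum0 => j; apply: GN; lia.
have c2 : conv N (fun j => lsum (fun i => G i j)).
  by move=> i n iN; rewrite (lsumE _ (cl i)); apply: isum0 => j; apply: GN; lia.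
apply: laurentP => n; rewrite (lsumE _ c1) (lsumE _ c2).
transitivity (isum (fun i => isum (fun j => G i j n))).
  by apply: eq_isum => i; rewrite (lsumE _ (cr i)).
rewrite (@isum_exchange _ (`|N| + `|N| + `|n|)%N).
  by apply: eq_isum => i; rewrite (lsumE _ (cl i)).
by move=> i j ij; apply: GN; lia.
Qed.

End LocallyFiniteSums.

Lemma lmap_lsum (W W' : zmodType) (h : W -> W') N (G : int -> laurent W) :
  {morph h : x y / x + y} -> conv N G ->
  lmap h (lsum G) = lsum (fun i => lmap h (G i)).
Proof.
move=> hD GN; have h0 : h 0 = 0 by apply: (addrI (h 0)); rewrite -hD !addr0.
have ch : conv N (fun i => lmap h (G i)).
  by move=> i n iN; rewrite lmapE // GN.
apply: laurentP => n; rewrite lmapE // (lsumE _ ch) (lsumE _ GN).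
rewrite (isum_morph hD (conv_within GN)).
by apply: eq_isum => i; rewrite lmapE.
Qed.

Lemma scale_conv (A : comNzRingType) (M : lmodType A) a (f : laurent A) N (G : int -> laurent M) :
  below a f -> conv N G -> conv (N - `|a|) (fun i => f *: G i).
Proof.
move=> fa GN i n iN; have [iN'|iN'] := ltP i N.
  by rewrite lcoefZ isum0 // => j; rewrite GN ?scaler0 ?iN'.
by apply: (below_scale (a := a) (b := i + N)) => // [j jN|]; [apply: GN|]; lia.
Qed.

Lemma scale_lsum (A : comNzRingType) (M : lmodType A) (f : laurent A) N (G : int -> laurent M) :
  conv N G -> f *: lsum G = lsum (fun i => f *: G i).
Proof.
move=> GN; have [a fa] := lcoefP f.
apply: laurentP => n; rewrite lcoefZ (lsumE _ (scale_conv fa GN)).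
transitivity (isum (fun j => isum (fun i => f j *: G i (n - j)))).
  apply: eq_isum => j; rewrite (lsumE _ GN).
  rewrite (isum_morph (f := fun x => f j *: x) _ (conv_within GN)) //.
  by move=> x y; rewrite scalerDr.
rewrite (@isum_exchange _ (`|a| + `|N| + `|N| + `|n|)%N).
  by apply: eq_isum => i; rewrite lcoefZ.
move=> j i ij; have [/fa->|ja] := ltP j a; first by rewrite scale0r.
by rewrite GN ?scaler0 //; lia.
Qed.

Lemma lsum_scale (A : comNzRingType) (M : lmodType A) N (f : int -> laurent A) (m : laurent M) :
  conv N f -> lsum f *: m = lsum (fun i => f i *: m).
Proof.
move=> fN; have [a ma] := lcoefP m.
have cm : conv (N - `|a|) (fun i => f i *: m).
  move=> i n iN; have [iN'|iN'] := ltP i N.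
    by rewrite lcoefZ isum0 // => j; rewrite fN ?scale0r ?iN'.
  by apply: (below_scale (a := i + N) (b := a)) => // [j jN|]; [apply: fN|]; lia.
apply: laurentP => n; rewrite lcoefZ (lsumE _ cm).
transitivity (isum (fun j => isum (fun i => f i j *: m (n - j)))).
  apply: eq_isum => j; rewrite (lsumE _ fN).
  rewrite (isum_morph (f := fun x => x *: m (n - j)) _ (conv_within fN)) //.
  by move=> x y; rewrite scalerDl.
rewrite (@isum_exchange _ (`|a| + `|N| + `|N| + `|n|)%N).
  by apply: eq_isum => i; rewrite lcoefZ.
move=> j i ij; have [ja|ja] := ltP (n - j) a; first by rewrite ma ?scaler0.
by rewrite fN ?scale0r //; lia.
Qed.

(** * The substitution z1 = phi(z, x) *)

Section Substitution.
Variables (K : fieldType) (p : laurent K).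
Local Notation L := (laurent K).
Implicit Types f g : L.

Definition dL f : L := p * der f.

Definition expc (k : nat) f : L := lcst (k`!%:R^-1) * iter k dL f.

Lemma dLM f g : dL (f * g) = dL f * g + f * dL g.
Proof. by rewrite /dL derM mulrDr mulrA mulrCA. Qed.

Lemma dLD : {morph dL : f g / f + g}.
Proof. by move=> f g; rewrite /dL derD mulrDr. Qed.

Lemma dL0 : dL 0 = 0.
Proof. by apply: (addrI (dL 0)); rewrite -dLD !addr0. Qed.

Lemma dL_cst a : dL (lcst a) = 0.
Proof. by rewrite /dL der_cst mulr0. Qed.

Lemma dL_sum (I : Type) (r : seq I) (F : I -> L) :
  dL (\sum_(i <- r) F i) = \sum_(i <- r) dL (F i).
Proof. exact: (big_morph _ dLD dL0). Qed.

Lemma expc0 f : expc 0 f = f.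
Proof. by rewrite /expc invr1 [lcst 1]rmorph1 mul1r. Qed.

Lemma below_dL (e : nat) v f : below (1 - e%:Z) p -> below v f ->
  below (v - e%:Z) (dL f).
Proof.
move=> pe fv; rewrite (_ : v - e%:Z = 1 - e%:Z + (v - 1)); last by lia.
by apply: below_mul => //; apply: below_der.
Qed.

Lemma below_expc (e : nat) v f k : below (1 - e%:Z) p -> below v f ->
  below (v - (e * k)%:Z) (expc k f).
Proof.
move=> pe fv n nv; rewrite lcstM.
suff H : below (v - (e * k)%:Z) (iter k dL f) by rewrite H ?mulr0.
elim: k {nv} => [|k IH]; first by move=> m mv; apply: fv; lia.
by move=> m mv; apply: (below_dL pe IH); lia.
Qed.

Hypothesis char0 : forall n, n.+1%:R != 0 :> K.

Lemma expcS k f : lcst k.+1%:R * expc k.+1 f = dL (expc k f).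
Proof.
have kE : k.+1%:R * (k.+1`!%:R)^-1 = (k`!%:R)^-1 :> K.
  by rewrite factS natrM invfM mulVKf ?char0.
by rewrite /expc dLM dL_cst mul0r add0r mulrA -rmorphM kE.
Qed.

Lemma expc_dL k f : lcst k.+1%:R * expc k.+1 f = expc k (dL f).
Proof. by rewrite expcS /expc dLM dL_cst mul0r add0r -iterSr. Qed.

Lemma lcst_nat_inj k f g : lcst k.+1%:R * f = lcst k.+1%:R * g -> f = g.
Proof.
move=> fg; apply: laurentP => n.
by have := congr1 (fun h : L => h n) fg; rewrite !lcstM => /(mulfI (char0 k)).
Qed.

(* The coefficients of e^{xD} f are multiplicative in f because D is a
   derivation. *)
Lemma expcM k f g :
  expc k (f * g) = \sum_(r < k.+1) expc r f * expc (k - r) g.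
Proof.
elim: k => [|k IH]; first by rewrite big_ord1 !expc0.
apply: (@lcst_nat_inj k); rewrite expcS IH dL_sum.
transitivity (\sum_(r < k.+1) lcst r.+1%:R * expc r.+1 f * expc (k - r) g +
    \sum_(r < k.+1) lcst (k.+1 - r)%:R * (expc r f * expc (k.+1 - r) g)).
  rewrite -big_split; apply: eq_bigr => r _ /=.
  rewrite dLM -expcS; congr (_ + _).
  by rewrite -expcS mulrCA (subSn (leq_ord r)).
rewrite mulr_sumr.
transitivity (\sum_(r < k.+2) (lcst r%:R * (expc r f * expc (k.+1 - r) g) +
    lcst (k.+1 - r)%:R * (expc r f * expc (k.+1 - r) g))).
  rewrite big_split /=; congr (_ + _).
    rewrite [RHS]big_ord_recl rmorph0 mul0r add0r; apply: eq_bigr => r _.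
    by rewrite lift0 subSS mulrA.
  by rewrite [RHS]big_ord_recr /= subnn rmorph0 mul0r addr0.
apply: eq_bigr => r _.
have kE : k.+1%:R = r%:R + (k.+1 - r)%:R :> K by rewrite -natrD subnKC // -ltnS.
by rewrite kE rmorphD mulrDl.
Qed.

(* phi(z, x)^i = \sum_k (pow_coef k i) x^k *)
Definition pow_coef (k : nat) (i : int) : L := expc k (lmon i 1).

Definition series_of_nat (M : zmodType) (c : nat -> M) : laurent M :=
  mkL (fun k => if k is Posz m then c m else 0).

Lemma series_of_natE (M : zmodType) (c : nat -> M) k :
  series_of_nat c k = if k is Posz m then c m else 0.
Proof. by rewrite (@mkLE _ _ 0) // => -[]. Qed.

Lemma series_of_nat_below (M : zmodType) (c : nat -> M) :
  below 0 (series_of_nat c).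
Proof. by move=> k k0; rewrite series_of_natE; case: k k0. Qed.

Definition lphi : laurent L := series_of_nat (fun k => pow_coef k 1).

(** Comparing coefficients of x^k in phi^(i+1) = phi phi^i. *)
Lemma pow_coefS k i :
  pow_coef k (i + 1) = \sum_(r < k.+1) pow_coef r 1 * pow_coef (k - r) i.
Proof. by rewrite -expcM lmon_mul mulr1 addrC. Qed.

Lemma below_pow_coef (e : nat) k i : below (1 - e%:Z) p ->
  below (i - (e * k)%:Z) (pow_coef k i).
Proof.
move=> pe; apply: below_expc => // n ni.
by rewrite lmonE; case: eqP => // nE; lia.
Qed.

Lemma pow_coef0 i : pow_coef 0 i = lmon i 1.
Proof. exact: expc0. Qed.

Lemma pow_coef_cst k : pow_coef k 0 = (k == 0%N)%:R.
Proof.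
case: k => [|k]; first by rewrite pow_coef0.
by apply: (@lcst_nat_inj k); rewrite expc_dL dL_cst /expc mulr0 iter_fix ?dL0 // mulr0.
Qed.

Lemma pow_coef11 : pow_coef 1 1 = p.
Proof.
rewrite /pow_coef /expc /= invr1 [lcst 1]rmorph1 mul1r /dL der_mon subrr.
by rewrite -[lmon 0 _]/(1 : L) mulr1.
Qed.

Lemma p_below : exists e : nat, below (1 - e%:Z) p.
Proof.
have [N pN] := lcoefP p; exists (absz N).+1 => n nN; apply: pN; lia.
Qed.

Section Module.
Variable W : lmodType K.
Local Notation M := (laurent W).
Implicit Types F : int -> M.

(* the elements of W((z1, z)) *)
Definition bitrunc F := exists N : int, forall i n, (i < N) || (n < N) -> F i n = 0.

Lemma bitruncD F F' : bitrunc F -> bitrunc F' -> bitrunc (fun i => F i + F' i).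
Proof.
move=> [N FN] [N' FN']; exists (Num.min N N') => i n iN.
by rewrite lcoefD FN ?FN' ?addr0 //; lia.
Qed.

Lemma bitruncZ F f : bitrunc F -> bitrunc (fun i => f *: F i).
Proof.
move=> [N FN]; have [a fa] := lcoefP f.
exists (N - `|a|) => i n iN; have [iN'|iN'] := ltP i N.
  by rewrite lcoefZ isum0 // => j; rewrite FN ?scaler0 ?iN'.
apply: (below_scale (a := a) (b := N)) => // [j jN|]; last by lia.
by apply: FN; rewrite jN orbT.
Qed.

Lemma bitrunc_shift F c : bitrunc F -> bitrunc (fun i => F (i - c)).
Proof. by move=> [N FN]; exists (N - `|c|) => i n iN; apply: FN; lia. Qed.

Lemma bitrunc0 : bitrunc (fun=> 0). Proof. by exists 0. Qed.

Lemma bitrunc_sum (I : Type) (r : seq I) (F : I -> int -> M) :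
  (forall k, bitrunc (F k)) -> bitrunc (fun i => \sum_(k <- r) F k i).
Proof.
move=> HF; elim: r => [|k r IH].
  by under eq_fun do rewrite big_nil; apply: bitrunc0.
by under eq_fun do rewrite big_cons; apply: bitruncD.
Qed.

Lemma pow_coef_conv F k : bitrunc F -> exists N, conv N (fun i => pow_coef k i *: F i).
Proof.
move=> [N FN]; have [e pe] := p_below; exists (N - `|N| - (e * k)%:Z) => i n iN.
have [iN'|iN'] := ltP i N.
  by rewrite lcoefZ isum0 // => j; rewrite FN ?scaler0 ?iN'.
apply: (below_scale (a := i - (e * k)%:Z) (b := N)).
- exact: below_pow_coef.
- by move=> j jN; apply: FN; rewrite jN orbT.
- by lia.
Qed.

(** Here z1^i is replaced by phi(z, x)^i; [subst_phi_raw] identifies this with the exponential of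
    p(z1) d/dz1 followed by z1 = z. *)
Definition subst_coef k F : M := lsum (fun i => pow_coef k i *: F i).

Definition lsubst F : laurent M := series_of_nat (fun k => subst_coef k F).

Lemma conv_max N N' (G G' : int -> M) : conv N G -> conv N' G' ->
  conv (Num.min N N') G /\ conv (Num.min N N') G'.
Proof. by move=> GN GN'; split; [apply: conv_le GN|apply: conv_le GN']; rewrite ge_min lexx ?orbT. Qed.

Lemma subst_coefD k F F' : bitrunc F -> bitrunc F' ->
  subst_coef k (fun i => F i + F' i) = subst_coef k F + subst_coef k F'.
Proof.
move=> /(pow_coef_conv k)[N FN] /(pow_coef_conv k)[N' FN'].
have [c1 c2] := conv_max FN FN'.
rewrite /subst_coef -(lsumD c1 c2); congr lsum.
by apply/funext => i; rewrite scalerDr.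
Qed.

Lemma subst_coefZ k F f : bitrunc F ->
  subst_coef k (fun i => f *: F i) = f *: subst_coef k F.
Proof.
move=> /(pow_coef_conv k)[N FN]; rewrite /subst_coef (scale_lsum _ FN).
by congr lsum; apply/funext => i; rewrite !scalerA mulrC.
Qed.

Lemma lsum0 : lsum (fun=> 0 : M) = 0.
Proof.
by apply: laurentP => n; rewrite (@lsumE _ 0) // isum0.
Qed.

Lemma subst_coef0 k : subst_coef k (fun=> 0) = 0.
Proof. by rewrite /subst_coef; under eq_fun do rewrite scaler0; apply: lsum0. Qed.

Lemma subst_coef_shift k F : bitrunc F ->
  subst_coef k (fun i => F (i - 1)) =
  \sum_(r < k.+1) pow_coef r 1 *: subst_coef (k - r) F.
Proof.
move=> HF; rewrite /subst_coef -(lsum_shift 1).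
have cN (r : 'I_k.+1) : exists N, conv N (fun i => pow_coef (k - r) i *: F i).
  exact: pow_coef_conv.
have [N HN] : exists N, forall r : 'I_k.+1,
    conv N (fun i => (pow_coef r 1 * pow_coef (k - r) i) *: F i).
  (* The finitely many bounds, one for each r, are merged by adding up their absolute values. *)
  have [Nf HNf] := @choice _ _ _ cN.
  have [af Haf] := @choice _ _ _ (fun r : 'I_k.+1 => lcoefP (pow_coef r 1)).
  exists (- \sum_(r < k.+1) (`|Nf r| + `|af r|)) => r.
  have cr := scale_conv (Haf r) (HNf r).
  rewrite (_ : (fun i => _) = fun i => pow_coef r 1 *: (pow_coef (k - r) i *: F i)).
    2: by apply/funext => i; rewrite scalerA.
  apply: conv_le cr; rewrite (bigD1 r) //=.
  have : 0 <= \sum_(i < k.+1 | i != r) (`|Nf i| + `|af i|).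
    by apply: sumr_ge0 => i _; lia.
  by move: (\sum_(i < _ | _) _) => s s0; lia.
transitivity (lsum (fun i => \sum_(r < k.+1)
    (pow_coef r 1 * pow_coef (k - r) i) *: F i)).
  by congr lsum; apply/funext => i; rewrite addrK pow_coefS scaler_suml.
rewrite (lsum_sum _ HN); apply: eq_bigr => r _; have [N' HN'] := cN r.
rewrite (scale_lsum _ HN'); congr lsum; apply/funext => i.
by rewrite scalerA.
Qed.

Lemma lsubstD F F' : bitrunc F -> bitrunc F' ->
  lsubst (fun i => F i + F' i) = lsubst F + lsubst F'.
Proof.
move=> HF HF'; apply: laurentP => k; rewrite lcoefD !series_of_natE.
by case: k => k; rewrite ?addr0 // subst_coefD.
Qed.

Lemma lsubstZ F f : bitrunc F -> lsubst (fun i => f *: F i) = lcst f *: lsubst F.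
Proof.
move=> HF; apply: laurentP => k; rewrite lcstZ !series_of_natE.
by case: k => k; rewrite ?scaler0 // subst_coefZ.
Qed.

Lemma lsubst0 : lsubst (fun=> 0) = 0.
Proof.
by apply: laurentP => k; rewrite series_of_natE; case: k => k; rewrite ?subst_coef0.
Qed.

Lemma below_lsubst F : below 0 (lsubst F).
Proof. exact: series_of_nat_below. Qed.

(** The shift of F is multiplication by z1. Together with additivity and [lsubstZ] this gives the
    compatibility with all polynomials in z1, [lsubst_pact]. *)
Lemma lsubst_shift F : bitrunc F ->
  lsubst (fun i => F (i - 1)) = lphi *: lsubst F.
Proof.
move=> HF; apply: laurentP => -[k|k]; last first.
  by rewrite below_lsubst // (below_scale (@series_of_nat_below _ _) (@below_lsubst F)).
rewrite series_of_natE subst_coef_shift //.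
rewrite (lcoefZ_nat _ (@series_of_nat_below _ _) (@below_lsubst F)).
apply: eq_bigr => r _; rewrite subzn; last by rewrite -ltnS.
by rewrite /lphi /lsubst !series_of_natE.
Qed.

End Module.
End Substitution.

(** * Action of polynomials in z1 on arbitrary, possibly two-sided, families *)

Section PolynomialAction.
Variables (A : comNzRingType) (M : lmodType A).
Implicit Types (P Q : {poly A}) (F : int -> M).

(* Q(z1) F(z1) *)
Definition pact Q F : int -> M :=
  fun i => \sum_(j < size Q) Q`_j *: F (i - j%:Z).

Lemma pactE N Q F i : (size Q <= N)%N ->
  pact Q F i = \sum_(j < N) Q`_j *: F (i - j%:Z).
Proof.
move=> QN; rewrite /pact (big_ord_widen N (fun j => Q`_j *: F (i - j%:Z)) QN).
rewrite big_mkcond; apply: eq_bigr => j _; case: ltnP => // jN.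
by rewrite nth_default ?scale0r.
Qed.

Lemma pactDl P Q F i : pact (P + Q) F i = pact P F i + pact Q F i.
Proof.
pose N := maxn (size P) (size Q).
rewrite !(@pactE N) ?size_polyD ?leq_maxl ?leq_maxr // -big_split /=.
by apply: eq_bigr => j _; rewrite coefD scalerDl.
Qed.

Lemma pactDr Q F F' i : pact Q (fun i => F i + F' i) i = pact Q F i + pact Q F' i.
Proof.
by rewrite /pact -big_split; apply: eq_bigr => j _; rewrite scalerDr.
Qed.

Lemma pact0l F i : pact 0 F i = 0.
Proof. by rewrite /pact size_poly0 big_ord0. Qed.

Lemma pact0r Q i : pact Q (fun=> 0) i = 0.
Proof. by rewrite /pact big1 // => j _; rewrite scaler0. Qed.

Lemma pactC c F i : pact c%:P F i = c *: F i.
Proof.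
by rewrite (@pactE 1) ?size_polyC_leq1 // big_ord1 coefC subr0.
Qed.

Lemma pact_shift Q F c i : pact Q (fun i => F (i - c)) i = pact Q F (i - c).
Proof. by apply: eq_bigr => j _; rewrite addrAC. Qed.

Lemma pactZr Q F c i : pact Q (fun i => c *: F i) i = c *: pact Q F i.
Proof.
by rewrite /pact scaler_sumr; apply: eq_bigr => j _; rewrite !scalerA mulrC.
Qed.

Lemma pactMX Q F i : pact (Q * 'X) F i = pact Q (fun i => F (i - 1)) i.
Proof.
rewrite (@pactE (size Q).+1); last first.
  by rewrite (leq_trans (size_polyMleq _ _)) // size_polyX addn2.
rewrite big_ord_recl coefMX scale0r add0r; apply: eq_bigr => j _.
by rewrite coefMX /= /bump /=; congr (_ *: F _); lia.
Qed.

Lemma pactZl c Q F i : pact (c *: Q) F i = c *: pact Q F i.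
Proof.
rewrite (@pactE (size Q)) ?size_scale_leq // /pact scaler_sumr.
by apply: eq_bigr => j _; rewrite coefZ scalerA.
Qed.

Lemma pactM P Q F : pact (P * Q) F = pact P (pact Q F).
Proof.
elim/poly_ind: P F => [|P c IH] F; apply/funext => i.
  by rewrite mul0r !pact0l.
rewrite mulrDl !pactDl mulrAC !pactMX mul_polyC pactZl pactC IH.
congr (pact P _ _ + _); apply/funext => j; exact: pact_shift.
Qed.

Lemma pact1 F : pact 1 F = F.
Proof. by apply/funext => i; rewrite pactC scale1r. Qed.

Lemma pact_comm P Q F : pact P (pact Q F) = pact Q (pact P F).
Proof. by rewrite -!pactM mulrC. Qed.

Lemma pact_sum (I : Type) (r : seq I) Q (F : I -> int -> M) i :
  pact Q (fun i => \sum_(k <- r) F k i) i = \sum_(k <- r) pact Q (F k) i.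
Proof.
rewrite /pact exchange_big; apply: eq_bigr => j _ /=.
by rewrite scaler_sumr.
Qed.

End PolynomialAction.

Lemma pact_map (A A' : comNzRingType) (M : lmodType A) (M' : lmodType A')
    (h : M -> M') (s : A -> A') (Q : {poly A}) (Q' : {poly A'}) F i :
  {morph h : x y / x + y} -> (forall j, Q'`_j = s Q`_j) ->
  (forall c m, h (c *: m) = s c *: h m) ->
  h (pact Q F i) = pact Q' (fun i => h (F i)) i.
Proof.
move=> hD QQ hZ; have h0 : h 0 = 0 by apply: (addrI (h 0)); rewrite -hD !addr0.
pose N := maxn (size Q) (size Q').
rewrite !(@pactE _ _ N) ?leq_maxl ?leq_maxr // (big_morph h hD h0).
by apply: eq_bigr => j _; rewrite hZ QQ.
Qed.

Section SubstitutionOfPolynomials.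
Variables (K : fieldType) (p : laurent K).
Hypothesis char0 : forall n, n.+1%:R != 0 :> K.
Local Notation L := (laurent K).
Implicit Types Q : {poly L}.

(* Q(phi(z, x)) *)
Definition evphi Q : laurent L := (map_poly lcst Q).[lphi p].

Lemma evphiD Q Q' : evphi (Q + Q') = evphi Q + evphi Q'.
Proof. by rewrite /evphi rmorphD hornerD. Qed.

Lemma evphiM Q Q' : evphi (Q * Q') = evphi Q * evphi Q'.
Proof. by rewrite /evphi rmorphM hornerM. Qed.

Lemma evphiC c : evphi c%:P = lcst c.
Proof. by rewrite /evphi map_polyC hornerC. Qed.

Lemma evphiX : evphi 'X = lphi p.
Proof. by rewrite /evphi map_polyX hornerX. Qed.

Lemma evphi0 : evphi 0 = 0.
Proof. by rewrite -polyC0 evphiC rmorph0. Qed.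

Lemma lcst_below (A : comNzRingType) (c : A) : below 0 (lcst c).
Proof. by move=> n n0; rewrite lmonE lt_eqF. Qed.

Lemma below_evphi Q : below 0 (evphi Q).
Proof.
elim/poly_ind: Q => [|Q c IH]; first by rewrite evphi0.
rewrite evphiD evphiM evphiX evphiC => n n0.
by rewrite lcoefD lcst_below // addr0 (below_mul IH (@series_of_nat_below _ _)).
Qed.

Lemma evphi_coef0 Q : (evphi Q) 0 = Q.[lmon 1 1].
Proof.
elim/poly_ind: Q => [|Q c IH]; first by rewrite evphi0 horner0.
rewrite evphiD evphiM evphiX evphiC lcoefD hornerMXaddC -IH lmonE eqxx.
have := lcoefM_lead (@below_evphi Q) (@series_of_nat_below _ (pow_coef p ^~ 1)).
by rewrite addr0 series_of_natE /= pow_coef0 => <-.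
Qed.

Hypothesis p_neq0 : p != 0.

(** Split off from Q the largest power of z1 - z. The cofactor is nonzero at z1 = z, and its value
    there is the constant term in x after the substitution; the factor phi(z, x) - z has
    x-coefficient p, nonzero by assumption. *)
Lemma evphi_neq0 Q : Q != 0 -> evphi Q != 0.
Proof.
move=> Q0; have [m [R]] := multiplicity_XsubC Q (lmon 1 1).
rewrite Q0 /= => Rz ->; rewrite evphiM mulf_neq0 //.
  by apply: contra Rz => /eqP R0; rewrite /root -evphi_coef0 R0.
have -> : evphi (('X - (lmon 1 1)%:P) ^+ m) = (evphi ('X - (lmon 1 1)%:P)) ^+ m.
  by rewrite /evphi rmorphXn horner_exp.
rewrite expf_neq0 //; apply: contra p_neq0 => /eqP.
rewrite -polyCN evphiD evphiX evphiC => /(congr1 (fun f : laurent L => f 1)).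
by rewrite lcoefD lmonE /= addr0 series_of_natE /= pow_coef11 => ->.
Qed.

Variable W : lmodType K.
Local Notation M := (laurent W).
Implicit Types F : int -> M.

Lemma bitrunc_pact Q F : bitrunc F -> bitrunc (pact Q F).
Proof.
by move=> HF; apply: bitrunc_sum => j; apply: bitruncZ; apply: bitrunc_shift.
Qed.

Lemma lsubst_pact Q F : bitrunc F ->
  lsubst p (pact Q F) = evphi Q *: lsubst p F.
Proof.
elim/poly_ind: Q F => [|Q c IH] F HF.
  rewrite evphi0 scale0r -[RHS](@lsubst0 _ p W); congr lsubst.
  by apply/funext => i; rewrite pact0l.
have -> : pact (Q * 'X + c%:P) F =
    fun i => pact Q (fun i => F (i - 1)) i + c *: F i.
  by apply/funext => i; rewrite pactDl pactMX pactC.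
have HF1 := bitrunc_shift 1 HF.
rewrite lsubstD; [|exact: bitrunc_pact|exact: bitruncZ].
rewrite IH // lsubstZ // lsubst_shift // evphiD evphiM evphiX evphiC.
by rewrite scalerDl scalerA.
Qed.

End SubstitutionOfPolynomials.

Section SubstitutionNaturality.
Variables (K : fieldType) (p : laurent K).
Variables (W W' : lmodType K) (h : W -> W').
Hypothesis h_lin : linear h.

Let hD : {morph h : x y / x + y}.
Proof. by move=> x y; have := h_lin 1 x y; rewrite !scale1r. Qed.

Let h0 : h 0 = 0.
Proof. by apply: (addrI (h 0)); rewrite -hD !addr0. Qed.

Let hZ c x : h (c *: x) = c *: h x.
Proof. by have := h_lin c x 0; rewrite h0 !addr0. Qed.

Lemma lmapZ (f : laurent K) m : lmap h (f *: m) = f *: lmap h m.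
Proof.
have [[a fa] [b mb]] := (lcoefP f, lcoefP m).
apply: laurentP => n; rewrite lmapE // !lcoefZ.
rewrite (isum_morph hD (scale_within fa mb)); apply: eq_isum => i.
by rewrite hZ lmapE.
Qed.

Lemma bitrunc_lmap (F : int -> laurent W) :
  bitrunc F -> bitrunc (fun i => lmap h (F i)).
Proof. by move=> [N FN]; exists N => i n iN; rewrite lmapE // FN. Qed.

Lemma lsubst_lmap (F : int -> laurent W) : bitrunc F ->
  lsubst p (fun i => lmap h (F i)) = lmap (lmap h) (lsubst p F).
Proof.
move=> HF; have hDD := lmapD hD.
apply: laurentP => k; rewrite lmapE // !series_of_natE.
have lh0 : lmap h 0 = 0 by apply: laurentP => n; rewrite lmapE // !lcoef0.
case: k => k //; have [N HN] := pow_coef_conv p k HF.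
rewrite /subst_coef (lmap_lsum hD HN); congr lsum; apply/funext => i.
by rewrite lmapZ.
Qed.

End SubstitutionNaturality.

Section IteratedSubstitution.
Variables (K : fieldType) (p : laurent K) (W : lmodType K).
Local Notation M := (laurent W).

(* the elements of W((z1, z2, z)) *)
Definition tritrunc (G : int -> int -> M) :=
  exists N : int, forall i j n, [|| i < N, j < N | n < N] -> G i j n = 0.

Lemma tritrunc_bitrunc G i : tritrunc G -> bitrunc (G i).
Proof. by move=> [N GN]; exists N => j n jn; apply: GN; rewrite jn orbT. Qed.

Lemma tritrunc_swap G : tritrunc G -> tritrunc (fun j i => G i j).
Proof. by move=> [N GN]; exists N => j i n ji; apply: GN; lia. Qed.

(** Substituting for the second variable keeps uniform lower bounds in z1 and z, so that z1 can be
    substituted next. *)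
Lemma subst_coef_bitrunc G k : tritrunc G ->
  bitrunc (fun i => subst_coef p k (G i)).
Proof.
move=> [N GN]; have [e pe] := p_below p.
have GC i : conv (N - `|N| - (e * k)%:Z) (fun j => pow_coef p k j *: G i j).
  move=> j n jN; have [jN'|jN'] := ltP j N.
    by rewrite lcoefZ isum0 // => l; rewrite GN ?scaler0 // jN' orbT.
  apply: (below_scale (a := j - (e * k)%:Z) (b := N)).
  - exact: below_pow_coef.
  - by move=> l lN; apply: GN; rewrite lN !orbT.
  - by lia.
exists (N - `|N| - (e * k)%:Z + (N - `|N| - (e * k)%:Z)) => i n iN.
rewrite (lsumE _ (GC i)); apply: isum0 => j.
have [iN'|iN'] := ltP i N.
  by rewrite lcoefZ isum0 // => l; rewrite GN ?scaler0 // iN'.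
by apply: GC; lia.
Qed.

(** The coefficients of the powers of phi are commuting scalars in C((z)); the work lies in bounding
    the double sum so that it may be exchanged. *)
Lemma subst_coef_exchange G s t : tritrunc G ->
  subst_coef p s (fun i => subst_coef p t (G i)) =
  subst_coef p t (fun j => subst_coef p s (fun i => G i j)).
Proof.
move=> GT; have [N GN] := GT; have [e pe] := p_below p.
pose H i j := pow_coef p s i *: (pow_coef p t j *: G i j).
transitivity (lsum (fun i => lsum (fun j => H i j))).
  rewrite [LHS]/subst_coef; congr lsum; apply/funext => i.
  have [N' cN'] := pow_coef_conv p t (tritrunc_bitrunc i GT).
  by rewrite /subst_coef (scale_lsum _ cN').
transitivity (lsum (fun j => lsum (fun i => H i j))).
  apply: (@lsum_exchange _ (N - `|N| - `|N| - (e * s)%:Z - (e * t)%:Z)) => i j n ijn.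
  have [iN|iN] := ltP i N.
    rewrite /H lcoefZ isum0 // => l; rewrite lcoefZ isum0 ?scaler0 // => l'.
    by rewrite GN ?iN ?scaler0.
  have [jN|jN] := ltP j N.
    rewrite /H lcoefZ isum0 // => l; rewrite lcoefZ isum0 ?scaler0 // => l'.
    by rewrite GN ?jN ?orbT ?scaler0.
  apply: (below_scale (below_pow_coef (k := s) (i := i) pe)
    (below_scale (below_pow_coef (k := t) (i := j) pe) (b := N) _)).
    by move=> l lN; apply: GN; rewrite lN !orbT.
  by lia.
rewrite [RHS]/subst_coef; congr lsum; apply/funext => j.
have [N' cN'] := pow_coef_conv p s (tritrunc_bitrunc j (tritrunc_swap GT)).
rewrite /subst_coef (scale_lsum _ cN'); congr lsum; apply/funext => i.
by rewrite /H !scalerA mulrC.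
Qed.

End IteratedSubstitution.

Lemma lmap_leibniz_raw (A B M : zmodType) (op : A -> B -> M) dA dB dM
    (f : int -> A) (g : int -> B) a b n :
  biadditive op -> {morph dA : x y / x + y} -> {morph dB : x y / x + y} ->
  {morph dM : x y / x + y} ->
  (forall x y, dM (op x y) = op (dA x) y + op x (dB y)) ->
  below a f -> below b g ->
  dM (cauchy op f g n) = cauchy op (dA \o f) g n + cauchy op f (dB \o g) n.
Proof.
move=> opA aD bD mD opL fa gb.
have dA0 : dA 0 = 0 by apply: (addrI (dA 0)); rewrite -aD !addr0.
have dB0 : dB 0 = 0 by apply: (addrI (dB 0)); rewrite -bD !addr0.
have dfa : below a (dA \o f) by move=> i ia; rewrite /= fa.
have dgb : below b (dB \o g) by move=> i ia; rewrite /= gb.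
rewrite /cauchy (isum_morph mD (cauchy_within opA fa gb)).
rewrite -(isumD (cauchy_within opA dfa gb) (cauchy_within opA fa dgb)).
by apply: eq_isum => i; rewrite opL.
Qed.

Lemma laurent_scaleI (K : fieldType) (M : lmodType K) (f : laurent K)
    (x y : laurent M) : f != 0 -> f *: x = f *: y -> x = y.
Proof. by move=> f0; apply: (@scalerI _ (laurent M)). Qed.

Lemma laurent_scaleKV (K : fieldType) (M : lmodType K) (f : laurent K)
    (m : laurent M) : f != 0 -> f *: (f^-1 *: m) = m.
Proof. by move=> f0; rewrite scalerA divff // scale1r. Qed.

(** * The substitution on tame series and its behaviour under p d/dz *)

Section Hat.
Variables (K : fieldType) (p : laurent K).
Hypothesis char0 : forall n, n.+1%:R != 0 :> K.
Hypothesis p_neq0 : p != 0.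
Local Notation L := (laurent K).
Variable W : lmodType K.
Local Notation M := (laurent W).
Implicit Types (F : int -> M) (Q : {poly L}) (Y : laurent M).

Definition dM (m : M) : M := p *: der m.

Lemma dMD : {morph dM : x y / x + y}.
Proof. by move=> x y; rewrite /dM derD scalerDr. Qed.

Lemma dM0 : dM 0 = 0.
Proof. by apply: (addrI (dM 0)); rewrite -dMD !addr0. Qed.

Lemma dMZ (f : L) m : dM (f *: m) = dL p f *: m + f *: dM m.
Proof. by rewrite /dM derZ scalerDr /dL !scalerA [f * p]mulrC. Qed.

Lemma dM_lsum N (G : int -> M) : conv N G -> dM (lsum G) = lsum (fun i => dM (G i)).
Proof.
move=> GN; rewrite /dM (der_lsum GN) (@scale_lsum _ _ _ (N - 1)) //.
by move=> i n iN; rewrite derE GN ?mul0rz //; lia.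
Qed.

Lemma bitrunc_dM F : bitrunc F -> bitrunc (fun i => dM (F i)).
Proof.
move=> [N FN]; apply: bitruncZ; exists (N - 1) => i n iN.
by rewrite derE FN ?mul0rz //; lia.
Qed.

(** Leibniz rule on D^k(z^i)/k! F_i: differentiating the first factor gives k + 1 times
    D^(k+1)(z^i)/(k+1)!. *)
Lemma dM_subst_coef k F : bitrunc F ->
  dM (subst_coef p k F) =
  subst_coef p k.+1 F *+ k.+1 + subst_coef p k (fun i => dM (F i)).
Proof.
move=> HF; have [N HN] := pow_coef_conv p k HF.
have [N1 HN1] := pow_coef_conv p k.+1 HF.
have [N2 HN2] := pow_coef_conv p k (bitrunc_dM HF).
rewrite [in LHS]/subst_coef (dM_lsum HN).
have HN1' : conv N1 (fun i => lcst (k.+1%:R : K) *: (pow_coef p k.+1 i *: F i)).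
  by move=> i n iN; rewrite lcstZ HN1 ?scaler0.
have [c1 c2] := conv_max HN1' HN2.
have -> : subst_coef p k.+1 F *+ k.+1 = lcst (k.+1%:R : K) *: subst_coef p k.+1 F.
  by rewrite rmorph_nat scaler_nat.
rewrite {1}/subst_coef (scale_lsum _ HN1) -(lsumD c1 c2).
congr lsum; apply/funext => i.
by rewrite dMZ scalerA expcS.
Qed.

(** The operator p d/dz - d/dx; translation covariance of the modes is read off its coefficients. *)
Definition nabla Y : laurent M := lmap dM Y - der Y.

Definition nablaL (f : laurent L) : laurent L := lmap (dL p) f - der f.

Lemma nablaZ (f : laurent L) Y : nabla (f *: Y) = nablaL f *: Y + f *: nabla Y.
Proof.
have [[a fa] [b Yb]] := (lcoefP f, lcoefP Y).
rewrite /nabla /nablaL derZ scalerBl scalerBr opprD addrACA; congr (_ + _).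
apply: laurentP => n; rewrite lmapE; last exact: dMD.
rewrite lcoefD !lcoefZ.
have := @lmap_leibniz_raw _ _ _ _ _ _ _ _ _ _ _ n
  (@biadditive_scale L M) (@dLD _ p) dMD dMD dMZ fa Yb.
rewrite /cauchy => ->; congr (_ + _); apply: eq_isum => i /=.
  by rewrite lmapE //; exact: dLD.
by rewrite lmapE //; exact: dMD.
Qed.

Lemma nablaLM (f g : laurent L) : nablaL (f * g) = nablaL f * g + f * nablaL g.
Proof.
have [[a fa] [b Yb]] := (lcoefP f, lcoefP g).
rewrite /nablaL derM mulrBl mulrBr opprD addrACA; congr (_ + _).
apply: laurentP => n; rewrite lmapE; last exact: dLD.
rewrite lcoefD (lcoefM f g) (lcoefM (lmap (dL p) f) g) (lcoefM f (lmap (dL p) g)).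
have := @lmap_leibniz_raw _ _ _ _ _ _ _ _ _ _ _ n
  (@biadditive_mul L) (@dLD _ p) (@dLD _ p) (@dLD _ p) (@dLM _ p) fa Yb.
rewrite /cauchy => ->; congr (_ + _); apply: eq_isum => i /=.
  by rewrite lmapE //; exact: dLD.
by rewrite lmapE //; exact: dLD.
Qed.

Lemma nablaLD : {morph nablaL : x y / x + y}.
Proof. by move=> x y; rewrite /nablaL (lmapD (@dLD _ p)) derD opprD addrACA. Qed.

Lemma nablaL_cst c : nablaL (lcst c) = lcst (dL p c).
Proof. by rewrite /nablaL lmap_mon ?der_cst ?subr0 //; exact: dLD. Qed.

(* d/dx and p d/dz agree on phi(z, x) = e^{x p d/dz} z. *)
Lemma nablaL_phi : nablaL (lphi p) = 0.
Proof.
apply: laurentP => k; rewrite lcoefB lmapE; last exact: dLD.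
rewrite derE; case: k => k.
  rewrite /lphi -[k%:Z + 1]/(k + 1)%N%:Z addn1 !series_of_natE -expcS //.
  by rewrite rmorph_nat mulr_natl subrr.
rewrite !series_of_natE dL0; case: k => [|k]; first by rewrite mulr0z subr0.
by rewrite (_ : Negz k.+1 + 1 = Negz k) ?mul0rz ?subr0 //; lia.
Qed.

Definition polyD Q : {poly L} := \poly_(i < size Q) dL p Q`_i.

Lemma coef_polyD Q i : (polyD Q)`_i = dL p Q`_i.
Proof. by rewrite coef_poly; case: ltnP => // iQ; rewrite nth_default // dL0. Qed.

(** Since phi is killed, a derivation can only reach the coefficients of Q. *)
Lemma nabla_evphi Q : nablaL (evphi p Q) = evphi p (polyD Q).
Proof.
elim/poly_ind: Q => [|Q c IH].
  have -> : polyD 0 = 0 by apply/polyP => i; rewrite coef_polyD coef0 dL0.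
  by rewrite evphi0 -[0 in LHS](rmorph0 (@lcst L)) nablaL_cst dL0 rmorph0.
have -> : polyD (Q * 'X + c%:P) = polyD Q * 'X + (dL p c)%:P.
  apply/polyP => i; rewrite coef_polyD !coefD dLD !coefMX !coefC.
  by case: i => [|i] /=; rewrite ?coef_polyD ?dL0.
rewrite !evphiD !evphiM !evphiX !evphiC nablaLD nablaLM IH nablaL_phi mulr0 addr0.
by rewrite nablaL_cst.
Qed.

Lemma dM_pact Q F i : dM (pact Q F i) =
  pact (polyD Q) F i + pact Q (fun i => dM (F i)) i.
Proof.
rewrite (@pactE _ _ (size Q) (polyD Q)) ?size_poly // -big_split /=.
rewrite (big_morph dM dMD dM0); apply: eq_bigr => j _.
by rewrite dMZ coef_polyD.
Qed.

(** In F(phi(z, x), z) the derivation p d/dz also reaches z through phi; that part equals d/dx and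
    cancels. *)
Lemma nabla_lsubst F : bitrunc F ->
  nabla (lsubst p F) = lsubst p (fun i => dM (F i)).
Proof.
move=> HF; apply: laurentP => k; rewrite lcoefB lmapE; last exact: dMD.
rewrite derE; case: k => k.
  rewrite /lsubst -[k%:Z + 1]/(k + 1)%N%:Z addn1 !series_of_natE.
  by rewrite dM_subst_coef // addrC addKr.
rewrite !series_of_natE dM0; case: k => [|k]; first by rewrite mulr0z subr0.
by rewrite (_ : Negz k.+1 + 1 = Negz k) ?mul0rz ?subr0 //; lia.
Qed.

(* F(z1, z) lies in W((z1, z)) up to a nonzero polynomial factor. *)
Definition tame F := exists2 Q : {poly L}, Q != 0 & bitrunc (pact Q F).

(* The extension of the substitution z1 = phi(z, x) to tame series. *)
Definition hat F : laurent M :=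
  let Q := xget 0 [set Q : {poly L} | Q != 0 /\ bitrunc (pact Q F)] in
  (evphi p Q)^-1 *: lsubst p (pact Q F).

(** Independence of the denominator: after multiplication by the one chosen in [hat], the claim is
    that two polynomial actions commute, and a nonzero [evphi] cancels in the field [laurent L]. *)
Lemma hatE Q F : Q != 0 -> bitrunc (pact Q F) ->
  evphi p Q *: hat F = lsubst p (pact Q F).
Proof.
move=> Q0 HQ; rewrite /hat; set R := xget _ _.
have [R0 HR] : R != 0 /\ bitrunc (pact R F).
  apply: (@xgetPex _ 0 [set Q : {poly L} | Q != 0 /\ bitrunc (pact Q F)]).
  by exists Q.
apply: (laurent_scaleI (evphi_neq0 p_neq0 R0)).
rewrite scalerA mulrC -scalerA laurent_scaleKV ?evphi_neq0 //.
by rewrite -!lsubst_pact // pact_comm.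
Qed.

Lemma hat_uniq Q F Y : Q != 0 -> bitrunc (pact Q F) ->
  evphi p Q *: Y = lsubst p (pact Q F) -> hat F = Y.
Proof.
move=> Q0 HQ EY; apply: (laurent_scaleI (evphi_neq0 p_neq0 Q0)).
by rewrite EY; apply: hatE.
Qed.

Lemma bitrunc_tame F : bitrunc F -> tame F.
Proof. by move=> HF; exists 1; rewrite ?oner_neq0 ?pact1. Qed.

Lemma hat_bitrunc F : bitrunc F -> hat F = lsubst p F.
Proof.
move=> HF; apply: (@hat_uniq 1); rewrite ?oner_neq0 ?pact1 //.
by rewrite evphiC rmorph1 scale1r.
Qed.

Lemma tame_pact R F : tame F -> tame (pact R F).
Proof.
by move=> [Q Q0 HQ]; exists Q => //; rewrite pact_comm; apply: bitrunc_pact.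
Qed.

Lemma hat_pact R F : tame F -> hat (pact R F) = evphi p R *: hat F.
Proof.
move=> [Q Q0 HQ]; apply: (@hat_uniq Q) => //.
  by rewrite pact_comm; apply: bitrunc_pact.
by rewrite scalerA mulrC -scalerA (hatE Q0 HQ) pact_comm [RHS]lsubst_pact.
Qed.

Lemma pactDfun Q F F' : pact Q (fun i => F i + F' i) =
  fun i => pact Q F i + pact Q F' i.
Proof. by apply/funext => i; apply: pactDr. Qed.

Lemma tameD F F' : tame F -> tame F' -> tame (fun i => F i + F' i).
Proof.
move=> [Q Q0 HQ] [Q' Q0' HQ']; exists (Q * Q'); first by rewrite mulf_neq0.
rewrite pactDfun; apply: bitruncD.
  by rewrite (mulrC Q Q') pactM; apply: bitrunc_pact.
by rewrite pactM; apply: bitrunc_pact.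
Qed.

Lemma hatD F F' : tame F -> tame F' ->
  hat (fun i => F i + F' i) = hat F + hat F'.
Proof.
move=> [Q Q0 HQ] [Q' Q0' HQ'].
have H1 : bitrunc (pact (Q * Q') F) by rewrite (mulrC Q Q') pactM; apply: bitrunc_pact.
have H2 : bitrunc (pact (Q * Q') F') by rewrite pactM; apply: bitrunc_pact.
have QQ : Q * Q' != 0 by rewrite mulf_neq0.
apply: (@hat_uniq (Q * Q')) => //; rewrite pactDfun; first exact: bitruncD.
by rewrite lsubstD // scalerDr !hatE.
Qed.

Lemma hatZ (c : L) F : tame F -> hat (fun i => c *: F i) = lcst c *: hat F.
Proof.
move=> HF; rewrite -(evphiC p) -hat_pact //; congr hat.
by apply/funext => i; rewrite pactC.
Qed.

Lemma tameZ (c : L) F : tame F -> tame (fun i => c *: F i).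
Proof.
move=> /(tame_pact c%:P); congr tame.
by apply/funext => i; rewrite pactC.
Qed.

Lemma hat_sum (I : Type) (r : seq I) (F : I -> int -> M) :
  (forall k, tame (F k)) ->
  tame (fun i => \sum_(k <- r) F k i) /\
  hat (fun i => \sum_(k <- r) F k i) = \sum_(k <- r) hat (F k).
Proof.
move=> HF; elim: r => [|k r [IHt IH]].
  rewrite big_nil; under eq_fun do rewrite big_nil.
  by rewrite (hat_bitrunc (bitrunc0 W)) lsubst0; split=> //; apply/bitrunc_tame/bitrunc0.
rewrite big_cons -IH; under eq_fun do rewrite big_cons.
by split; [apply: tameD|rewrite hatD].
Qed.

(** Quotient rule: Q^2 D(F) = Q D(Q F) - D(Q) Q F, where D(Q) differentiates the coefficients of Q;
    hence the square. *)
Lemma tame_dM F : tame F -> tame (fun i => dM (F i)).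
Proof.
move=> [Q Q0 HQ]; exists (Q * Q); first by rewrite mulf_neq0.
have -> : pact (Q * Q) (fun i => dM (F i)) =
    fun i => pact Q (fun i => dM (pact Q F i)) i + (- 1) *: pact (polyD Q) (pact Q F) i.
  apply/funext => i; rewrite pactM pact_comm scaleN1r.
  under [X in pact Q X i + _]eq_fun do rewrite dM_pact.
  rewrite pactDr pact_comm -[pact Q (pact Q _) _]/(pact Q (pact Q (fun i => dM (F i))) i).
  by rewrite addrC addKr.
apply: bitruncD; last exact/bitruncZ/bitrunc_pact.
exact/bitrunc_pact/bitrunc_dM.
Qed.

(** Apply [nabla] to Q(phi) hat(F) = (Q F)(phi, z). The terms in which Q is differentiated agree on
    both sides and cancel. *)
Lemma nabla_hat F : tame F -> nabla (hat F) = hat (fun i => dM (F i)).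
Proof.
move=> HF; have HdF := tame_dM HF; have [Q Q0 HQ] := HF.
apply: (laurent_scaleI (evphi_neq0 p_neq0 Q0)).
have := congr1 nabla (hatE Q0 HQ).
rewrite nablaZ nabla_evphi nabla_lsubst // -hat_bitrunc; last exact: bitrunc_dM.
under [in RHS]eq_fun do rewrite dM_pact.
by rewrite hatD ?hat_pact //; [move/addrI|exact: tame_pact..].
Qed.

End Hat.

(** * Coefficient functions as Laurent series *)

Section RawSeries.
Variables (A B M : zmodType) (op : A -> B -> M).
Hypothesis opA : biadditive op.

Lemma cauchy_cauchyE (f : int -> int -> A) (g : int -> int -> B) a b k n :
  below a f -> below b g ->
  cauchy (cauchy op) f g k n = isum (fun i => cauchy op (f i) (g (k - i)) n).
Proof.
move=> fa gb; rewrite {1}/cauchy.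
rewrite (isum_morph (f := fun h : int -> M => h n) (N := (`|a| + absz (k - b)%R)%N)) //.
apply: within_between => i /orP[ia|ib]; apply/funext => m; apply: isum0 => j.
  by rewrite fa // biadditive0l.
by rewrite gb ?biadditive0r //; lia.
Qed.

End RawSeries.

Section RawCorrespondence.
Variables (K : fieldType) (p : laurent K).
Local Notation L := (laurent K).

Definition raw2 (M : zmodType) (Y : laurent (laurent M)) : int -> int -> M :=
  fun k n => Y k n.

Lemma raw2_below (M : zmodType) a (Y : laurent (laurent M)) :
  below a Y -> below a (raw2 Y).
Proof. by move=> Ya k ka; apply/funext => n; rewrite /raw2 Ya. Qed.

Lemma raw2_inj (M : zmodType) (Y Y' : laurent (laurent M)) :
  raw2 Y = raw2 Y' -> Y = Y'.
Proof.
move=> YY; apply: laurentP => k; apply: laurentP => n.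
exact: (congr1 (fun F => F k n) YY).
Qed.

Lemma mul2_raw (f g : laurent L) : mul2 (raw2 f) (raw2 g) = raw2 (f * g).
Proof.
have [[a fa] [b gb]] := (lcoefP f, lcoefP g).
apply/funext => k; apply/funext => n; rewrite /mul2.
rewrite (cauchy_cauchyE (@biadditive_mul K) _ _ (raw2_below fa) (raw2_below gb)).
rewrite /raw2 lcoefM (isum_morph (f := fun h : L => h n) _
  (cauchy_within (@biadditive_mul L) fa gb)) //.
by apply: eq_isum => i; rewrite lcoefM.
Qed.

Lemma scale2_raw (W : lmodType K) (f : laurent L) (F : laurent (laurent W)) :
  scale2 (raw2 f) (raw2 F) = raw2 (f *: F).
Proof.
have [[a fa] [b gb]] := (lcoefP f, lcoefP F).
apply/funext => k; apply/funext => n; rewrite /scale2.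
rewrite (cauchy_cauchyE (@biadditive_scale K W) _ _ (raw2_below fa) (raw2_below gb)).
rewrite /raw2 lcoefZ (isum_morph (f := fun h : laurent W => h n) _
  (cauchy_within (@biadditive_scale L (laurent W)) fa gb)) //.
by apply: eq_isum => i; rewrite lcoefZ.
Qed.

Lemma one2_raw : @one2 K = raw2 (1 : laurent L).
Proof.
apply/funext => k; apply/funext => n; rewrite /raw2 lcoef1 /one2 /monomial2.
by case: eqP => //= _; rewrite ?lcoef1.
Qed.

(** [inv2] selects some inverse among coefficient functions. Its truncation conditions turn it into
    an element of the field [laurent L], where the inverse is unique. *)
Lemma inv2_raw (f : laurent L) : f != 0 -> inv2 (raw2 f) = raw2 f^-1.
Proof.
move=> f0; rewrite /inv2; set S := [set _ | _].
have S1 : S (raw2 f^-1).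
  have Vf : f^-1 * f = 1 by apply: mulVf.
  split; last by rewrite mul2_raw Vf one2_raw.
    by have [N HN] := lcoefP f^-1; exists N => k kN; apply: (raw2_below HN).
  by move=> k; have [N HN] := lcoefP (f^-1 k); exists N.
have [[N gN] gt fg] : S (xget 0 S) by apply: (xgetPex 0); exists (raw2 f^-1).
move: gN gt fg; set g := xget 0 S => gN gt fg.
pose G : laurent L := mkL (fun k => mkL (g k)).
have GE : raw2 G = g.
  apply/funext => k; apply/funext => n; rewrite /raw2.
  have [N' gN'] := gt k; rewrite (@mkLE _ _ N) ?(mkLE _ gN') // => m mN.
  by apply: laurentP => j; rewrite gN // (@mkLE _ _ 0).
move: fg; rewrite -GE mul2_raw one2_raw => /raw2_inj fG; congr raw2.
have fV : f * f^-1 = 1 by apply: mulfV.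
by rewrite -[G]mulr1 -fV mulrA fG mul1r.
Qed.

Lemma derivation_lL (f : L) :
  derivation (M := K^o) p f = lcoef (dL p f) :> (int -> K).
Proof.
apply/funext => n; rewrite lcoefM; apply: eq_isum => i.
by rewrite derE -mulrzl.
Qed.

Lemma phi_raw : phi p = raw2 (lphi p).
Proof.
apply/funext => k; apply/funext => n; rewrite /raw2 series_of_natE /phi /exp_series.
case: k => // k; rewrite lcstM.
suff -> : iter k (derivation (M := K^o) p) (monomial K 1) =
    lcoef (iter k (dL p) (lmon 1 1)) by [].
elim: k => [|k IH]; last by rewrite !iterS IH derivation_lL.
by apply/funext => m; rewrite /= lmonE /monomial; case: eqP.
Qed.

(* r(z) *)
Definition polyL (r : {poly K}) : L := (map_poly lcst r).[lmon 1 1].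

Fact polyL_zmod : zmod_morphism polyL.
Proof. by move=> r s; rewrite /polyL rmorphB hornerD hornerN. Qed.

Fact polyL_monoid : monoid_morphism polyL.
Proof.
split; first by rewrite /polyL rmorph1 hornerC.
by move=> r s; rewrite /polyL rmorphM hornerM.
Qed.

HB.instance Definition _ := GRing.isZmodMorphism.Build {poly K} L polyL polyL_zmod.
HB.instance Definition _ := GRing.isMonoidMorphism.Build {poly K} L polyL polyL_monoid.

Lemma lmonX (A : comNzRingType) j : (lmon 1 1 : laurent A) ^+ j = lmon j 1.
Proof. by elim: j => // j IH; rewrite exprS IH lmon_mul mulr1. Qed.

Lemma polyLE r : polyL r = \sum_(j < size r) lmon j%:Z r`_j.
Proof.
rewrite /polyL (@horner_coef_wide _ (size r)) ?size_poly //.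
apply: eq_bigr => j _; rewrite coef_map lmonX /= /lcst lmon_mul add0r mulr1 //.
Qed.

Lemma polyL_coef r (j : nat) : polyL r j = r`_j.
Proof.
rewrite polyLE lcoef_sum; have [jr|rj] := ltnP j (size r).
  rewrite (bigD1 (Ordinal jr)) //= lmonE eqxx big1 ?addr0 // => i ij.
  by rewrite lmonE eqz_nat; case: eqP => // ji; case/eqP: ij; apply: val_inj.
rewrite nth_default // big1 // => i _; rewrite lmonE eqz_nat.
by case: eqP => // ji; have := ltn_ord i; lia.
Qed.

Lemma polyL_inj : injective polyL.
Proof. by move=> r s rs; apply/polyP => j; rewrite -!polyL_coef rs. Qed.

(* q(z1, z) as a polynomial in z1 *)
Definition polyLL (q : {poly {poly K}}) : {poly L} := map_poly polyL q.

Lemma polyLL_eq0 q : (polyLL q == 0) = (q == 0).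
Proof.
apply/eqP/eqP => [q0|->]; last by rewrite /polyLL rmorph0.
apply/polyP => i; apply: polyL_inj.
by rewrite coef0 rmorph0 -coef_map -/(polyLL q) q0 coef0.
Qed.

Lemma eval_phi_raw q : eval_phi p q = raw2 (evphi p (polyLL q)).
Proof.
apply/funext => k; apply/funext => n.
have -> : evphi p (polyLL q) = \sum_(i < size q) \sum_(j < size q`_i)
    lcst (lmon j%:Z q`_i`_j) * lphi p ^+ i.
  have sq : (size (map_poly lcst (polyLL q)) <= size q)%N.
    by rewrite (leq_trans (size_poly _ _)) // size_poly.
  rewrite /evphi (horner_coef_wide _ sq); apply: eq_bigr => i _.
  by rewrite !coef_map /= polyLE rmorph_sum mulr_suml.
rewrite /raw2 !lcoef_sum /eval_phi.
rewrite 2!fct_sumE; apply: eq_bigr => i _; rewrite !lcoef_sum 2!fct_sumE.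
apply: eq_bigr => j _.
have -> : iter i (mul2 (phi p)) (@one2 K) = raw2 (lphi p ^+ i).
  elim: (i : nat) => [|l IH]; first by rewrite one2_raw.
  by rewrite iterS IH phi_raw mul2_raw exprS.
have -> : monomial2 K 0 j%:Z = raw2 (lcst (lmon j%:Z 1)).
  apply/funext => k'; apply/funext => n'; rewrite /raw2 /monomial2 lmonE.
  by case: eqP => //= _; rewrite lmonE; case: eqP.
rewrite mul2_raw /raw2 [lphi p ^+ i * _]mulrC.
by rewrite (lcstM (lmon j%:Z 1)) (lcstM (lmon j%:Z q`_i`_j)) !lmonM mul1r.
Qed.

(** * Agreement of the two forms of the substitution *)

Section ModuleCorrespondence.
Variable W : lmodType K.
Local Notation M := (laurent W).
Implicit Types F : int -> M.

Definition rawF F : int -> int -> W := fun i n => F i n.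

Lemma polyL_scale r (m : M) n :
  (polyL r *: m) n = \sum_(j < size r) r`_j *: m (n - j%:Z).
Proof.
rewrite polyLE scaler_suml lcoef_sum; apply: eq_bigr => j _.
by rewrite lmonZ.
Qed.

Lemma pmul_raw q F : pmul q (rawF F) = rawF (pact (polyLL q) F).
Proof.
apply/funext => i; apply/funext => n.
rewrite /rawF /pmul (@pactE _ _ (size q)) ?size_poly // lcoef_sum.
by apply: eq_bigr => j _; rewrite coef_map /= polyL_scale.
Qed.

(** p(z1) d/dz1, summed over the exponent j being differentiated: z1^j contributes j p_(l-j+1) to
    z1^l. In this form its sum over j can be exchanged with the sum over l. *)
Definition z1_derivation F : int -> M :=
  fun l => lsum (fun j => lcst (p (l - j + 1) *~ j) *: F j).

Lemma z1_derivation_conv e N F l : below (1 - e%:Z) p ->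
  (forall i n, (i < N) || (n < N) -> F i n = 0) ->
  conv (N - `|N| - `|l| - e%:Z) (fun j => lcst (p (l - j + 1) *~ j) *: F j).
Proof.
move=> pe FN j n jn; rewrite lcstZ.
have [jN|jN] := ltP j N; first by rewrite FN ?jN // scaler0.
have [nN|nN] := ltP n N; first by rewrite FN ?nN ?orbT // scaler0.
by rewrite pe ?mul0rz ?scale0r //; lia.
Qed.

Lemma z1_derivation_bitrunc F : bitrunc F -> bitrunc (z1_derivation F).
Proof.
move=> [N FN]; have [e pe] := p_below p; exists (N - e%:Z) => l n ln.
rewrite (lsumE _ (z1_derivation_conv pe FN)); apply: isum0 => j; rewrite lcstZ.
have [jN|jN] := ltP j N; first by rewrite FN ?jN // scaler0.
have [nN|nN] := ltP n N; first by rewrite FN ?nN ?orbT // scaler0.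
by rewrite pe ?mul0rz ?scale0r //; lia.
Qed.

Lemma derivation_rawF F : bitrunc F ->
  derivation p (rawF F) = rawF (z1_derivation F).
Proof.
move=> [N FN]; have [e pe] := p_below p.
apply/funext => l; apply/funext => n.
rewrite /derivation /cauchy.
rewrite (isum_morph (f := fun h : int -> W => h n)
  (N := (e + `|l| + `|N| + 2)%N)) //; last first.
  move=> i iN; apply/funext => m; rewrite /derivative /rawF.
  rewrite -[LHS]/(p i *: ((l - i + 1)%:~R *: F (l - i + 1) m)).
  have [/pe->|ie] := ltP i (1 - e%:Z); first by rewrite scale0r.
  by rewrite FN ?scaler0 //; lia.
rewrite /rawF (lsumE _ (z1_derivation_conv pe FN)) -[RHS](isum_refl (l + 1)).
apply: eq_isum => i.
rewrite -[LHS]/(p i *: ((l - i + 1)%:~R *: F (l - i + 1) n)) lcstZ.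
rewrite (_ : l + 1 - i = l - i + 1); last by lia.
rewrite (_ : l - (l - i + 1) + 1 = i); last by lia.
by rewrite scaler_int -[p i *~ _]mulrzl -scalerA scaler_int scalerMzr.
Qed.

Lemma mul_lsum (f : L) N (G : int -> L) :
  conv N G -> f * lsum G = lsum (fun i => f * G i).
Proof. exact: (@scale_lsum K K^o f N G). Qed.

Lemma expc_lsum k N (G : int -> L) :
  conv N G -> expc p k (lsum G) = lsum (fun i => expc p k (G i)).
Proof.
have [e pe] := p_below p.
move=> GN; suff [GkN GE] : conv (N - (e * k)%N%:Z) (fun i => iter k (dL p) (G i)) /\
    iter k (dL p) (lsum G) = lsum (fun i => iter k (dL p) (G i)).
  by rewrite /expc GE (mul_lsum _ GkN).
elim: k => [|k [IHc IH]]; first by split=> // i n iN; apply: GN; lia.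
split.
  move=> i n iN; rewrite iterS; have [iN'|iN'] := ltP i (N - (e * k)%N%:Z).
    rewrite lcoefM isum0 // => j; rewrite derE IHc ?mul0rz ?mulr0 //.
    by rewrite iN'.
  apply: (@below_dL _ _ e (i + N - (e * k)%N%:Z)) => //; last by lia.
  by move=> j jN; apply: IHc; lia.
have cd : conv (N - (e * k)%N%:Z - 1) (fun i => der (iter k (dL p) (G i))).
  by move=> i n iN; rewrite derE IHc ?mul0rz //; lia.
by rewrite iterS IH /dL (der_lsum IHc) (mul_lsum _ cd).
Qed.

Lemma expcZ k c (f : L) : expc p k (lcst c * f) = lcst c * expc p k f.
Proof.
rewrite /expc mulrCA; congr (_ * _); elim: k => // k IH.
by rewrite !iterS IH dLM dL_cst mul0r add0r.
Qed.

Lemma z1_derivation_mon_conv e j : below (1 - e%:Z) p ->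
  conv (- `|j| - e%:Z) (fun l => lcst (p (l - j + 1) *~ j) * lmon l 1).
Proof.
move=> pe l n ln; rewrite lcstM lmonE; case: eqP => [nl|]; last by rewrite mulr0.
by rewrite pe ?mul0rz ?mul0r //; lia.
Qed.

Lemma dL_mon (j : int) :
  dL p (lmon j 1) = lsum (fun l => lcst (p (l - j + 1) *~ j) * lmon l 1).
Proof.
have [e pe] := p_below p.
apply: laurentP => n; rewrite (lsumE _ (z1_derivation_mon_conv (j := j) pe)).
rewrite (isum1 (j := n)) => [|i in_]; last first.
  by rewrite lcstM lmonE eq_sym (negPf in_) mulr0.
rewrite lcstM lmonE eqxx mulr1 /dL der_mon mulrC lmonM.
by rewrite mulrzl (_ : n - (j - 1) = n - j + 1) //; lia.
Qed.

Hypothesis char0 : forall n, n.+1%:R != 0 :> K.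

(* Integration by parts: the derivation acting on F(z1, z) can be moved to
   the powers of z1. *)
Lemma subst_coef_derivation k F : bitrunc F ->
  subst_coef p k (z1_derivation F) = subst_coef p k.+1 F *+ k.+1.
Proof.
move=> HF; have [N FN] := HF; have [e pe] := p_below p.
have [N1 cN1] := pow_coef_conv p k.+1 HF.
pose H l j := (pow_coef p k l * lcst (p (l - j + 1) *~ j)) *: F j.
have ck j : conv (- `|j| - e%:Z - (e * k)%N%:Z)
    (fun l => lcst (p (l - j + 1) *~ j) * pow_coef p k l).
  move=> l n ln; rewrite lcstM.
  have [lj|lj] := ltP (l - j + 1) (1 - e%:Z).
    by rewrite pe // mul0rz mul0r.
  by rewrite (below_pow_coef (k := k) pe) ?mulr0 //; lia.
transitivity (lsum (fun l => lsum (fun j => H l j))).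
  rewrite [LHS]/subst_coef; congr lsum; apply/funext => l.
  rewrite (scale_lsum _ (z1_derivation_conv pe FN)); congr lsum.
  by apply/funext => j; rewrite scalerA.
transitivity (lsum (fun j => lsum (fun l => H l j))).
  apply: (@lsum_exchange _ (N - `|N| - `|N| - e%:Z - e%:Z - (e * k)%N%:Z)) => l j n ljn.
  have [jN|jN] := ltP j N.
    by rewrite /H lcoefZ isum0 // => i; rewrite FN ?jN ?scaler0.
  rewrite /H mulrC -scalerA lcstZ.
  have [lj|lj] := ltP (l - j + 1) (1 - e%:Z).
    by rewrite pe // mul0rz scale0r.
  rewrite (below_scale (below_pow_coef (k := k) (i := l) pe) (b := N)) ?scaler0 //.
    by move=> i iN; apply: FN; rewrite iN orbT.
  by lia.
have -> : subst_coef p k.+1 F *+ k.+1 = lcst (k.+1%:R : K) *: subst_coef p k.+1 F.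
  by rewrite rmorph_nat scaler_nat.
rewrite [in RHS]/subst_coef (scale_lsum _ cN1); congr lsum; apply/funext => j.
rewrite scalerA expc_dL // dL_mon (expc_lsum _ (z1_derivation_mon_conv (j := j) pe)).
rewrite (_ : (fun i => _) = (fun l => lcst (p (l - j + 1) *~ j) * pow_coef p k l)).
  rewrite (lsum_scale _ (ck j)); congr lsum; apply/funext => l.
  by rewrite /H mulrC.
by apply/funext => l; rewrite expcZ.
Qed.

Lemma subst_coef_iter k F : bitrunc F ->
  subst_coef p 0 (iter k z1_derivation F) = subst_coef p k F *+ k`!.
Proof.
(* The starting order l is generalised, since each integration by parts raises it by one at the cost
   of a factor l + 1. *)
have H l m G : bitrunc G ->
    subst_coef p l (iter m z1_derivation G) *+ l`! = subst_coef p (l + m) G *+ (l + m)`!.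
  elim: m l G => [|m IH] l G HG; first by rewrite addn0.
  rewrite iterSr IH; last exact: z1_derivation_bitrunc.
  by rewrite subst_coef_derivation // -mulrnA addnS factS.
by move=> HF; rewrite -[LHS]mulr1n -[1%N]/(0`!) H.
Qed.

Lemma iter_z1_derivation_bitrunc k F : bitrunc F -> bitrunc (iter k z1_derivation F).
Proof. by move=> HF; elim: k => //= k IH; apply: z1_derivation_bitrunc. Qed.

Lemma diag_eval_raw F : bitrunc F -> diag_eval (rawF F) = lcoef (subst_coef p 0 F).
Proof.
move=> HF; have [N cN] := pow_coef_conv p 0 HF.
apply/funext => n; rewrite (lsumE _ cN); apply: eq_isum => i.
by rewrite pow_coef0 lmonZ scale1r.
Qed.

(** All k derivations are moved from F to the powers of z1, where D^k(z^i)/k! is the x^k-coefficient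
    of phi^i. *)
Lemma subst_phi_raw F : bitrunc F -> subst_phi p (rawF F) = raw2 (lsubst p F).
Proof.
move=> HF; apply/funext => k; apply/funext => n; rewrite /raw2 series_of_natE.
rewrite /subst_phi /exp_series; case: k => k; last first.
  by rewrite /diag_eval isum0.
have -> : iter k (derivation p) (rawF F) = rawF (iter k z1_derivation F).
  elim: k => // k IH; rewrite !iterS IH derivation_rawF //.
  exact: iter_z1_derivation_bitrunc.
have HFk := iter_z1_derivation_bitrunc k HF.
have kn0 : (k`!)%:R != 0 :> K by case: (k`!) (fact_gt0 k).
apply: (@scalerI _ _ (k`!)%:R kn0).
rewrite [RHS]scaler_nat -lcoefMn -subst_coef_iter // -diag_eval_raw // /diag_eval.
rewrite /diag_eval.
have [N FN] := HFk.
rewrite (isum_morph (f := fun x => (k`!)%:R *: x) (N := (`|N| + absz (n - N)%R)%N)).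
- apply: eq_isum => i.
  rewrite -[LHS]/((k`!)%:R *: ((k`!)%:R^-1 *: rawF (iter k z1_derivation F) i (n - i))).
  by rewrite scalerA divff // scale1r.
- by move=> x y; rewrite scalerDr.
- move=> i iN.
  rewrite -[LHS]/((k`!)%:R^-1 *: rawF (iter k z1_derivation F) i (n - i)).
  by rewrite /rawF FN ?scaler0 //; lia.
Qed.

End ModuleCorrespondence.
End RawCorrespondence.

(** * Modes and annihilating polynomials *)

Section FieldOperators.
Variables (K : fieldType) (W : lmodType K).
Local Notation L := (laurent K).
Local Notation M := (laurent W).
Implicit Types (a b u v : W -> int -> W) (m : M) (q : {poly {poly K}}).

Definition lfield a (w : W) : M := mkL (a w).

(* The coefficients of a(z1)m(z), as a series in z1. *)
Definition field_op a m : int -> M := fun i => lmap (a^~ i) m.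

Section OneField.
Variable a : W -> int -> W.
Hypothesis Ea : calE W a.

Lemma calE_lin i : linear (a^~ i).
Proof. by move=> c x y; have := congr1 (fun f : int -> W => f i) (Ea.1 c x y). Qed.

Lemma calED i : {morph a^~ i : x y / x + y}.
Proof. by move=> x y; have := calE_lin i 1 x y; rewrite !scale1r. Qed.

Lemma calE0 i : a 0 i = 0.
Proof. by apply: (addrI (a 0 i)); rewrite -calED !addr0. Qed.

Lemma lfieldE w n : lfield a w n = a w n.
Proof. by have [N aN] := Ea.2 w; rewrite (@mkLE _ _ N). Qed.

Lemma lfield_lin c x y : lfield a (c *: x + y) = lcst c *: lfield a x + lfield a y.
Proof.
by apply: laurentP => n; rewrite lcoefD lcstZ !lfieldE; apply: calE_lin.
Qed.

Lemma lfield0 : lfield a 0 = 0.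
Proof. by apply: laurentP => n; rewrite lfieldE calE0. Qed.

Lemma field_opE m i n : field_op a m i n = a (m n) i.
Proof. by rewrite lmapE //; apply: calED. Qed.

Lemma field_opD i : {morph (fun m => field_op a m i) : x y / x + y}.
Proof. exact: (lmapD (@calED i)). Qed.

Lemma field_op0 i : field_op a 0 i = 0.
Proof. by apply: (addrI (field_op a 0 i)); rewrite -field_opD !addr0. Qed.

Lemma field_opZ (f : L) m i : field_op a (f *: m) i = f *: field_op a m i.
Proof. exact: (lmapZ (calE_lin i)). Qed.

Lemma field_op_lin i : linear (fun m => field_op a m i).
Proof. by move=> c x y; rewrite field_opD field_opZ. Qed.

Lemma field_op_pact (Q : {poly L}) (F : int -> M) i j :
  field_op a (pact Q F j) i = pact Q (fun j => field_op a (F j) i) j.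
Proof.
apply: (@pact_map _ _ _ _ (fun m => field_op a m i) id) => //.
- exact: field_opD.
- by move=> c m; rewrite field_opZ.
Qed.

End OneField.

Definition field_commutator a b w : int -> M :=
  fun i => field_op a (lfield b w) i - lfield b (a w i).

Lemma field_prod_raw a b w : calE W a -> calE W b ->
  field_prod a b w = rawF (field_op a (lfield b w)).
Proof.
move=> Ea Eb; apply/funext => i; apply/funext => n.
by rewrite /rawF field_opE // lfieldE.
Qed.

Lemma field_comm_raw a b w : calE W a -> calE W b ->
  field_comm a b w = rawF (field_commutator a b w).
Proof.
move=> Ea Eb; apply/funext => i; apply/funext => n.
by rewrite /rawF lcoefB field_opE // !lfieldE.
Qed.

Lemma annihilatesE q a b : calE W a -> calE W b ->
  annihilates q a b <->
  forall w i, pact (polyLL q) (field_commutator a b w) i = 0.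
Proof.
move=> Ea Eb; split=> H w.
  move=> i; apply: laurentP => n.
  have := congr1 (fun G => G i n) (H w).
  by rewrite field_comm_raw // pmul_raw.
rewrite field_comm_raw // pmul_raw; apply/funext => i; apply/funext => n.
by rewrite /rawF H.
Qed.

(** The possible loss [e] comes from the orders in z of the coefficients of Q, so it is the same for
    all F. *)
Lemma ztrunc_pact (Q : {poly L}) : exists e : int, forall (F : int -> M) N,
  (forall i, below N (F i)) -> forall i, below (e + N) (pact Q F i).
Proof.
elim/poly_ind: Q => [|Q c [e1 IH]].
  by exists 0 => F N FN i n _; rewrite pact0l.
have [e ce] := lcoefP c; exists (Num.min e1 e) => F N FN i n nN.
rewrite pactDl pactMX pactC lcoefD (IH (fun i => F (i - 1)) N) ?add0r //.
  by apply: (below_scale ce (FN i)); move: nN; lia.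
by move: nN; lia.
Qed.

Lemma z1trunc_pact (A : comNzRingType) (V : lmodType A) (Q : {poly A}) (F : int -> V) N :
  below N F -> below N (pact Q F).
Proof.
move=> FN i iN; rewrite /pact big1 // => j _; rewrite FN ?scaler0 //.
by apply: le_lt_trans iN; lia.
Qed.

Lemma field_op_ztrunc a m : calE W a -> exists N, forall i, below N (field_op a m i).
Proof.
by move=> Ea; have [N mN] := lcoefP m; exists N => i n nN; rewrite field_opE // mN // calE0.
Qed.

(** The series a(z1)b(z)w is bounded below in z because b(z)w is. After multiplication by q the
    operators may be exchanged, and b(z)a(z1)w is bounded below in z1. The two bounds together give
    membership in W((z1, z)). *)
Lemma annihilates_bitrunc q a b w : calE W a -> calE W b -> annihilates q a b ->
  bitrunc (pact (polyLL q) (field_op a (lfield b w))).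
Proof.
move=> Ea Eb /(annihilatesE _ Ea Eb) H.
have [N aN] := field_op_ztrunc (lfield b w) Ea.
have [e /(_ _ _ aN)] := ztrunc_pact (polyLL q).
set N1 := e + N => HN1.
have [N2 aN2] := Ea.2 w.
have bN2 : below N2 (fun i => lfield b (a w i)).
  by move=> i iN; rewrite aN2 // lfield0.
exists (Num.min N1 N2) => i n /orP[|]; rewrite lt_min => /andP[i1 i2]; last exact: HN1.
have -> : field_op a (lfield b w) =
    fun i => field_commutator a b w i + lfield b (a w i).
  by apply/funext => l; rewrite /field_commutator subrK.
by rewrite pactDr H add0r (z1trunc_pact _ bN2).
Qed.

(* q(z1, z2) G(z1, z2), where the coefficients G i j of z1^i z2^j are series
   in z. *)
Definition act2 q (G : int -> int -> M) : int -> int -> M :=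
  fun i j => \sum_(r < size q) pact (map_poly lcst q`_r) (G (i - r%:Z)) j.

Lemma act2_coef q G i j n :
  act2 q G i j n = pmul q (fun i j => G i j n) i j.
Proof.
rewrite /act2 lcoef_sum; apply: eq_bigr => r _.
rewrite (@pactE _ _ (size q`_r)) ?size_poly // lcoef_sum.
by apply: eq_bigr => s _; rewrite coef_map lcstZ.
Qed.

Lemma act2_commutator q a b m i j : calE W a -> calE W b -> annihilates q a b ->
  act2 q (fun i j => field_op a (field_op b m j) i - field_op b (field_op a m i) j) i j = 0.
Proof.
move=> Ea Eb H; apply: laurentP => n; rewrite act2_coef.
rewrite (_ : (fun i j => _) = field_comm a b (m n)); first by rewrite H.
by apply/funext => k; apply/funext => l; rewrite lcoefB !field_opE.
Qed.

Lemma act2D q G G' i j :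
  act2 q (fun i j => G i j + G' i j) i j = act2 q G i j + act2 q G' i j.
Proof. by rewrite /act2 -big_split; apply: eq_bigr => r _; rewrite pactDr. Qed.

End FieldOperators.

Section Products.
Variables (K : fieldType) (p : laurent K).
Hypothesis char0 : forall n, n.+1%:R != 0 :> K.
Hypothesis p_neq0 : p != 0.
Variable W : lmodType K.
Local Notation L := (laurent K).
Local Notation M := (laurent W).
Implicit Types (a b u v : W -> int -> W) (m : M) (q : {poly {poly K}}).
Local Notation hat := (hat p).

(** Operators on W commute with scalars in C((z)), so the denominator of F serves again. *)
Lemma hat_field_op a (F : int -> M) i : calE W a -> tame F ->
  tame (fun j => field_op a (F j) i) /\
  hat (fun j => field_op a (F j) i) = lmap (fun m => field_op a m i) (hat F).
Proof.
move=> Ea [Q Q0 HQ].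
have E : pact Q (fun j => field_op a (F j) i) = fun j => field_op a (pact Q F j) i.
  by apply/funext => j; rewrite field_op_pact.
have HQ' : bitrunc (pact Q (fun j => field_op a (F j) i)).
  by rewrite E; apply: (bitrunc_lmap (calE_lin Ea i)).
split; first by exists Q.
apply: (hat_uniq char0 p_neq0 Q0 HQ'); rewrite E.
rewrite (lsubst_lmap p (calE_lin Ea i) HQ) -(hatE char0 p_neq0 Q0 HQ).
exact: (esym (lmapZ (field_op_lin Ea i) _ _)).
Qed.

Lemma quasi_local_tame a b w : calE W a -> calE W b -> quasi_local_pair a b ->
  tame (field_op a (lfield b w)).
Proof.
move=> Ea Eb [q q0 H]; exists (polyLL q); first by rewrite polyLL_eq0.
exact: annihilates_bitrunc.
Qed.

(** This removes the polynomial chosen inside [YE]: from here on the modes are coefficients of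
    [hat]. *)
Lemma YE_raw a b w : calE W a -> calE W b -> quasi_local_pair a b ->
  YE p a b w = raw2 (hat (field_op a (lfield b w))).
Proof.
move=> Ea Eb [q' q0' H']; rewrite /YE; set q := xget 0 _.
have [q0 H] : q != 0 /\ annihilates q a b.
  by apply: (@xgetPex _ 0 [set q | q != 0 /\ annihilates q a b]); exists q'.
have Q0 : polyLL q != 0 by rewrite polyLL_eq0.
have HQ := annihilates_bitrunc w Ea Eb H.
rewrite field_prod_raw // pmul_raw subst_phi_raw // eval_phi_raw.
rewrite inv2_raw ?evphi_neq0 // scale2_raw -(hatE char0 p_neq0 Q0 HQ).
by rewrite scalerA mulVf ?evphi_neq0 // scale1r.
Qed.

Lemma YE_modeE a b n w : calE W a -> calE W b -> quasi_local_pair a b ->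
  YE_mode p a n b w = lcoef (hat (field_op a (lfield b w)) (- n - 1)).
Proof. by move=> Ea Eb ab; rewrite /YE_mode YE_raw. Qed.

Lemma hat_lfield_lin a b c x y : calE W a -> calE W b -> quasi_local_pair a b ->
  hat (field_op a (lfield b (c *: x + y))) =
  lcst (lcst c) *: hat (field_op a (lfield b x)) + hat (field_op a (lfield b y)).
Proof.
move=> Ea Eb ab.
have tx := quasi_local_tame x Ea Eb ab; have ty := quasi_local_tame y Ea Eb ab.
rewrite -(hatZ char0 p_neq0 (lcst c) tx) -(hatD char0 p_neq0 (tameZ (lcst c) tx) ty).
by congr hat; apply/funext => i; rewrite lfield_lin // field_opD // field_opZ.
Qed.

Lemma hat_lfield_coef a b c x y i k :
  calE W a -> calE W b -> quasi_local_pair a b ->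
  hat (field_op a (lfield b (c *: x + y))) i k =
  c *: hat (field_op a (lfield b x)) i k + hat (field_op a (lfield b y)) i k.
Proof.
move=> Ea Eb ab; rewrite (hat_lfield_lin c x y Ea Eb ab).
move: (hat (field_op a (lfield b x))) (hat (field_op a (lfield b y))) => X Y.
rewrite (lcoefD (lcst (lcst c) *: X) Y i) (lcstZ (lcst c) X i).
by rewrite (lcoefD (lcst c *: X i) (Y i) k) (lcstZ c (X i) k).
Qed.

(** The bound is one for q(phi(z, x), z)^-1, which does not involve w. It gives both the truncation
    of modes and a single exponent in Dong's lemma. *)
Lemma hat_lfield_below a b : calE W a -> calE W b -> quasi_local_pair a b ->
  exists d, forall w, below d (hat (field_op a (lfield b w))).
Proof.
move=> Ea Eb [q q0 H]; have Q0 : polyLL q != 0 by rewrite polyLL_eq0.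
have [d Hd] := lcoefP (evphi p (polyLL q))^-1.
exists d => w; rewrite -[hat _]scale1r -(mulVf (evphi_neq0 p_neq0 Q0)) -scalerA.
rewrite hatE //; last exact: annihilates_bitrunc.
by move=> n nd; apply: (below_scale Hd (@below_lsubst _ _ _ _)); rewrite addr0.
Qed.

Lemma YE_mode_calE a b n : calE W a -> calE W b -> quasi_local_pair a b ->
  calE W (YE_mode p a n b).
Proof.
move=> Ea Eb ab; split; last first.
  by move=> w; rewrite YE_modeE //; apply: lcoefP.
move=> c x y; apply/funext => k; rewrite !(YE_modeE _ _ Ea Eb ab).
exact: hat_lfield_coef.
Qed.

Lemma lfield_YE_mode a b n w : calE W a -> calE W b -> quasi_local_pair a b ->
  lfield (YE_mode p a n b) w = hat (field_op a (lfield b w)) (- n - 1).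
Proof. by move=> Ea Eb ab; rewrite /lfield YE_modeE // mkLK. Qed.

Definition xcoef (t : int) (P : {poly laurent L}) : {poly L} :=
  \poly_(j < size P) P`_j t.

Lemma coef_xcoef t P j : (xcoef t P)`_j = P`_j t.
Proof. by rewrite coef_poly; case: ltnP => // jP; rewrite nth_default. Qed.

(* If P kills D in W((z))((x))[[z1^+-1]], then a power of its constant term
   in x kills each coefficient of D, by induction on the exponent of x. *)
Lemma xcoef_annihilates (P : {poly laurent L}) (D : int -> laurent M) d N n :
  (forall j, below 0 P`_j) -> (forall i, below d (D i)) ->
  (forall i, pact P D i = 0) -> n < d + N%:Z ->
  pact (xcoef 0 P ^+ N) (fun i => D i n) = fun=> 0.
Proof.
move=> P0 Dd PD; elim: N n => [|N IH] n nN.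
  by apply/funext => i; rewrite expr0 pact1 Dd //; lia.
rewrite exprS; have [nN'|nN'] := ltP n (d + N%:Z).
  by rewrite pactM IH //; apply/funext => i; rewrite pact0r.
have nE : n = d + N%:Z by lia.
have PDn i : \sum_(t < N.+1) pact (xcoef t%:Z P) (fun i => D i (n - t%:Z)) i = 0.
  transitivity (pact P D i n); last by rewrite PD.
  rewrite [in RHS]/pact lcoef_sum.
  under eq_bigr => t _ do rewrite (@pactE _ _ (size P)) ?size_poly //.
  rewrite exchange_big; apply: eq_bigr => j _ /=.
  rewrite lcoefZ (isum_range (a := 0) (N := N.+1)).
    by apply: eq_bigr => t _; rewrite coef_xcoef add0r.
  move=> t tN; have [t0|t0] := ltP t 0; first by rewrite P0 ?scale0r.
  by rewrite Dd ?scaler0 //; lia.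
(* Multiplying the x^n-coefficient of P D by the N-th power of the constant term kills, by
   induction, every summand except t = 0. *)
have PDN : pact (xcoef 0 P ^+ N) (pact (xcoef 0 P) (fun i => D i n)) = fun=> 0.
  apply/funext => i.
  have := congr1 (fun F => F i) (congr1 (pact (xcoef 0 P ^+ N)) (funext PDn)).
  rewrite /= pact0r pact_sum big_ord_recl subr0 big1 ?addr0 // => t _.
  rewrite pact_comm IH ?pact0r //; rewrite lift0; lia.
by rewrite mulrC pactM.
Qed.

Definition evphiK (r : {poly K}) : laurent L := evphi p (map_poly lcst r).

Lemma evphiK_zmod : zmod_morphism evphiK.
Proof. by move=> r s; rewrite /evphiK /evphi !rmorphB hornerD hornerN. Qed.

HB.instance Definition _ :=
  GRing.isZmodMorphism.Build {poly K} (laurent L) evphiK evphiK_zmod.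

Lemma evphiK_monoid : monoid_morphism evphiK.
Proof.
split; first by rewrite /evphiK /evphi !rmorph1 hornerC.
by move=> r s; rewrite /evphiK rmorphM evphiM.
Qed.

HB.instance Definition _ :=
  GRing.isMonoidMorphism.Build {poly K} (laurent L) evphiK evphiK_monoid.

(* q1(z1, phi(z, x)) q2(z1, z) *)
Definition dong_poly q1 q2 : {poly laurent L} :=
  map_poly (lcst \o @polyL K) q2 * map_poly evphiK q1.

Lemma dong_poly_below q1 q2 j : below 0 (dong_poly q1 q2)`_j.
Proof.
rewrite coefM => n n0; rewrite lcoef_sum big1 // => i _.
rewrite !coef_map; apply: (@below_mul _ 0 0) => //.
  exact: lcst_below.
exact: below_evphi.
Qed.

Lemma xcoef_dong_poly q1 q2 : xcoef 0 (dong_poly q1 q2) = polyLL (q2 * q1).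
Proof.
apply/polyP => j; rewrite coef_xcoef /polyLL rmorphM !coefM lcoef_sum.
apply: eq_bigr => i _; rewrite !coef_map.
have := lcoefM_lead (@lcst_below _ (polyL q2`_i)) (@below_evphi _ p (map_poly lcst q1`_(j - i))).
by rewrite addr0 => ->; rewrite lmonE eqxx evphi_coef0.
Qed.

(** * Dong's lemma *)

Section Dong.
Variables (a u v : W -> int -> W) (q1 q2 : {poly {poly K}}).
Hypotheses (Ea : calE W a) (Eu : calE W u) (Ev : calE W v).
Hypotheses (au : annihilates q1 a u) (av : annihilates q2 a v).
Hypothesis uv : quasi_local_pair u v.

(** The coefficient of z1^i z2^j in [a(z1), u(z2) v(z)]w; [Del] below is its image under z2 = phi(z,
    x). *)
Let Gam w i j := field_op a (field_op u (lfield v w) j) i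
  - field_op u (lfield v (a w i)) j.

Let Del w i := lmap (fun m => field_op a m i) (hat (field_op u (lfield v w)))
  - hat (field_op u (lfield v (a w i))).

Let tameN (F : int -> M) : tame F -> tame (fun i => - F i).
Proof.
move=> /(tameZ (-1)); congr tame; apply/funext => i; exact: scaleN1r.
Qed.

Let hatN (F : int -> M) : tame F -> hat (fun i => - F i) = - hat F.
Proof.
move=> HF; rewrite -scaleN1r -(rmorphN1 (@lcst L)) -(hatZ char0 p_neq0 _ HF).
by congr hat; apply/funext => i; rewrite scaleN1r.
Qed.

Let tame_Gam w i : tame (Gam w i).
Proof.
apply: tameD; last exact/tameN/quasi_local_tame.
exact: (hat_field_op i Ea (quasi_local_tame w Eu Ev uv)).1.
Qed.

Let hat_Gam w i : hat (Gam w i) = Del w i.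
Proof.
have [t1 e1] := hat_field_op i Ea (quasi_local_tame w Eu Ev uv).
have t2 := quasi_local_tame (a w i) Eu Ev uv.
by rewrite (hatD char0 p_neq0 t1 (tameN t2)) e1 hatN.
Qed.

(** Leibniz rule [a, u v] = [a, u] v + u [a, v]: [X] and [Z] are the two terms, killed by q1(z1, z2)
    and q2(z1, z) respectively. *)
Let act2_Gam w i j :
  \sum_(s < size q2) polyL q2`_s *: act2 q1 (Gam w) (i - s%:Z) j = 0.
Proof.
pose X i j := field_op a (field_op u (lfield v w) j) i
  - field_op u (field_op a (lfield v w) i) j.
pose Z i j := field_op u (field_commutator a v w i) j.
have GXZ : Gam w = fun i j => X i j + Z i j.
  apply/funext => k; apply/funext => l; rewrite /X /Z /field_commutator.
  have fN x : field_op u (- x) l = - field_op u x l.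
    by apply: (addrI (field_op u x l)); rewrite -field_opD // !subrr field_op0.
  by rewrite field_opD // fN /Gam addrA subrK.
rewrite GXZ; under eq_bigr => s _ do rewrite act2D act2_commutator // add0r.
transitivity (\sum_(r < size q1) pact (map_poly lcst q1`_r)
   (fun j => \sum_(s < size q2) polyL q2`_s *: Z (i - r%:Z - s%:Z) j) j).
  under eq_bigr => s _ do rewrite /act2 scaler_sumr.
  rewrite exchange_big; apply: eq_bigr => r _ /=.
  rewrite pact_sum; apply: eq_bigr => s _.
  by rewrite pactZr addrAC.
apply: big1 => r _.
rewrite (_ : (fun j => _) = fun=> 0) ?pact0r //.
apply/funext => l; have /(annihilatesE _ Ea Ev)/(_ w (i - r%:Z)) H := av.
transitivity (field_op u (pact (polyLL q2) (field_commutator a v w) (i - r%:Z)) l).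
  rewrite (@pactE _ _ (size q2)) ?size_poly //.
  rewrite (big_morph (fun m => field_op u m l) (field_opD Eu l) (field_op0 Eu l)).
  by apply: eq_bigr => s _; rewrite coef_map field_opZ.
by rewrite H field_op0.
Qed.

Let pact_Del w i : pact (dong_poly q1 q2) (Del w) i = 0.
Proof.
rewrite pactM.
transitivity (hat (fun j =>
    \sum_(s < size q2) polyL q2`_s *: act2 q1 (Gam w) (i - s%:Z) j)); last first.
  rewrite (_ : (fun j => _) = fun=> 0); last by apply/funext => j; apply: act2_Gam.
  by rewrite (hat_bitrunc char0 p_neq0 (bitrunc0 W)) lsubst0.
have ta s r : tame (pact (map_poly lcst q1`_r) (Gam w (i - s%:Z - r%:Z))).
  exact: tame_pact.
have H s := hat_sum char0 p_neq0 (index_enum 'I_(size q1)) (fun r : 'I_(size q1) => ta s r).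
have H2 s : tame (fun j => polyL q2`_s *: act2 q1 (Gam w) (i - s%:Z) j).
  exact: (tameZ _ (H s).1).
have := (hat_sum char0 p_neq0 (index_enum 'I_(size q2)) (fun s : 'I_(size q2) => H2 s)).2.
move=> /= ->; rewrite (@pactE _ _ (size q2)) ?size_poly //.
apply: eq_bigr => s _; rewrite hatZ //; last exact: (H s).1.
rewrite coef_map; congr (_ *: _); rewrite (H s).2.
rewrite (@pactE _ _ (size q1)) ?size_poly //; apply: eq_bigr => r _.
by rewrite hat_pact // hat_Gam coef_map.
Qed.

(** Uniformity in w and i matters: the exponent in [dong] has to be chosen before w. *)
Let below_Del : exists d, forall w i, below d (Del w i).
Proof.
have [d bh] := hat_lfield_below Eu Ev uv.
exists d => w i n nd; rewrite lcoefB lmapE; last exact: field_opD.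
transitivity (field_op a 0 i - 0 : M); last by rewrite field_op0 // subr0.
by congr (field_op a _ i - _); apply: bh.
Qed.

Lemma dong n : exists N : nat, annihilates ((q2 * q1) ^+ N) a (YE_mode p u n v).
Proof.
have [d Hd] := below_Del.
(* The mode n is the coefficient of x^(-n-1), and this exponent N ensures -n - 1 < d + N. *)
exists (absz (- n - 1 - d)%R).+1; apply/annihilatesE => //; first exact: YE_mode_calE.
move=> w i; set N := (absz _).+1.
have -> : polyLL ((q2 * q1) ^+ N) = xcoef 0 (dong_poly q1 q2) ^+ N.
  by rewrite xcoef_dong_poly /polyLL rmorphXn.
have nN : - n - 1 < d + N%:Z by rewrite /N; lia.
have := xcoef_annihilates (@dong_poly_below q1 q2) (Hd w) (pact_Del w) nN.
rewrite (_ : (fun i => _) = field_commutator a (YE_mode p u n v) w).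
  by move=> ->.
apply/funext => l; rewrite /field_commutator !lfield_YE_mode // lcoefB lmapE //.
exact: field_opD.
Qed.

End Dong.

End Products.

(** * Locality of the modes *)

Section DoubleSeries.
Variables (A : comNzRingType).
Local Notation R2 := (laurent (laurent A)).
Implicit Types (f g h : R2).

(* In laurent (laurent V) the outer index is the exponent of the second
   variable; quadrant series lie in V[[x1, x2]]. *)
Definition quadrant (V : zmodType) (f : laurent (laurent V)) :=
  forall t s, (t < 0) || (s < 0) -> f t s = 0.

(** A relation and not a map: outside the quadrant the family with exchanged indices need not be an
    iterated Laurent series. *)
Definition transposed (V : zmodType) (f f' : laurent (laurent V)) :=
  forall t s, f' t s = f s t.

Lemma quadrant_below (V : zmodType) (f : laurent (laurent V)) :
  quadrant f -> below 0 f /\ forall t, below 0 (f t).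
Proof.
move=> fq; split=> [t t0|t s s0]; last by rewrite fq // s0 orbT.
by apply: laurentP => s; rewrite fq // t0.
Qed.

Lemma quadrant_transposed (V : zmodType) (f f' : laurent (laurent V)) :
  quadrant f -> transposed f f' -> quadrant f'.
Proof. by move=> fq ff' t s ts; rewrite ff' fq // orbC. Qed.

Lemma transposed_exists (V : zmodType) (f : laurent (laurent V)) :
  quadrant f -> exists f' : laurent (laurent V), transposed f f'.
Proof.
move=> fq; pose F t := mkL (fun s => f s t).
have FE t s : F t s = f s t.
  by rewrite (@mkLE _ _ 0) // => i i0; rewrite fq // i0.
exists (mkL F) => t s; rewrite (@mkLE _ _ 0) ?FE // => i i0.
by apply: laurentP => j; rewrite FE fq // i0 orbT.
Qed.

Lemma quadrantM_coef f g (t s : nat) : quadrant f -> quadrant g ->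
  (f * g) t%:Z s%:Z =
  \sum_(i < t.+1) \sum_(j < s.+1) f i%:Z j%:Z * g (t%:Z - i%:Z) (s%:Z - j%:Z).
Proof.
move=> /quadrant_below[f0 f0'] /quadrant_below[g0 g0'].
rewrite (lcoefM_nat _ f0 g0) lcoef_sum; apply: eq_bigr => i _.
by rewrite (lcoefM_nat _ (f0' i%:Z) (g0' (t%:Z - i%:Z))).
Qed.

Lemma quadrantZ_coef (V : lmodType A) f (X : laurent (laurent V)) (t s : nat) :
  quadrant f -> quadrant X ->
  (f *: X) t%:Z s%:Z =
  \sum_(i < t.+1) \sum_(j < s.+1) f i%:Z j%:Z *: X (t%:Z - i%:Z) (s%:Z - j%:Z).
Proof.
move=> /quadrant_below[f0 f0'] /quadrant_below[g0 g0'].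
rewrite (lcoefZ_nat _ f0 g0) lcoef_sum; apply: eq_bigr => i _.
by rewrite (lcoefZ_nat _ (f0' i%:Z) (g0' (t%:Z - i%:Z))).
Qed.

Lemma quadrantD f g : quadrant f -> quadrant g -> quadrant (f + g).
Proof. by move=> fq gq t s ts; rewrite !lcoefD fq // gq // addr0. Qed.

Lemma quadrantM f g : quadrant f -> quadrant g -> quadrant (f * g).
Proof.
move=> /quadrant_below[f0 f0'] /quadrant_below[g0 g0'] t s /orP[t0|s0].
  by rewrite (below_mul f0 g0).
rewrite lcoefM
  (isum_morph (f := fun h : laurent A => h s) _
  (cauchy_within (@biadditive_mul _) f0 g0)) //.
by apply: isum0 => i; apply: (below_mul (f0' i) (g0' (t - i))).
Qed.

Lemma quadrantZ (V : lmodType A) f (X : laurent (laurent V)) :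
  quadrant f -> quadrant X -> quadrant (f *: X).
Proof.
move=> /quadrant_below[f0 f0'] /quadrant_below[g0 g0'] t s /orP[t0|s0].
  by rewrite (below_scale f0 g0).
rewrite lcoefZ
  (isum_morph (f := fun h : laurent V => h s) _
  (cauchy_within (@biadditive_scale _ _) f0 g0)) //.
by apply: isum0 => i; apply: (below_scale (f0' i) (g0' (t - i))).
Qed.

Lemma transposedM f f' g g' : quadrant f -> quadrant g ->
  transposed f f' -> transposed g g' -> transposed (f * g) (f' * g').
Proof.
move=> fq gq ff' gg'.
have [fq' gq'] := (quadrant_transposed fq ff', quadrant_transposed gq gg').
move=> [t|t] [s|s]; try by rewrite !quadrantM ?orbT.
rewrite !quadrantM_coef // exchange_big /=.
by apply: eq_bigr => i _; apply: eq_bigr => j _; rewrite ff' gg'.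
Qed.

Lemma transposedZ (V : lmodType A) f f' (X X' : laurent (laurent V)) :
  quadrant f -> quadrant X ->
  transposed f f' -> transposed X X' -> transposed (f *: X) (f' *: X').
Proof.
move=> fq gq ff' gg'.
have [fq' gq'] := (quadrant_transposed fq ff', quadrant_transposed gq gg').
move=> [t|t] [s|s]; try by rewrite !quadrantZ ?orbT.
rewrite !quadrantZ_coef // exchange_big /=.
by apply: eq_bigr => i _; apply: eq_bigr => j _; rewrite ff' gg'.
Qed.

(** An element of A[[x1, x2]] seen in both iterated Laurent rings at once; its constant term decides
    invertibility. *)
Definition dseries f f' c := [/\ quadrant f, transposed f f' & f 0 0 = c].

Lemma dseriesD f f' c g g' d :
  dseries f f' c -> dseries g g' d -> dseries (f + g) (f' + g') (c + d).
Proof.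
move=> [fq ft fc] [gq gt gd]; split; first exact: quadrantD.
  by move=> t s; rewrite !lcoefD ft gt.
by rewrite !lcoefD fc gd.
Qed.

Lemma dseriesM f f' c g g' d :
  dseries f f' c -> dseries g g' d -> dseries (f * g) (f' * g') (c * d).
Proof.
move=> [fq ft fc] [gq gt gd]; split; first exact: quadrantM.
  exact: transposedM.
by rewrite (@quadrantM_coef f g 0 0) // !big_ord1 fc gd.
Qed.

Lemma dseries_cst c : dseries (lcst (lcst c)) (lcst (lcst c)) c.
Proof.
have E t s : lcst (lcst c) t s = if (t == 0) && (s == 0) then c else 0.
  by rewrite lmonE; case: eqP => //= _; rewrite lmonE.
split=> [t s ts|t s|]; rewrite ?E //; last by rewrite andbC.
by move: ts; case: eqP => [->|//]; case: eqP => [->|//].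
Qed.

Lemma dseries0 : dseries 0 0 0.
Proof. by split. Qed.

Lemma dseries1 : dseries 1 1 1.
Proof. by have := dseries_cst 1; rewrite !rmorph1. Qed.

Lemma dseriesX f f' c n : dseries f f' c -> dseries (f ^+ n) (f' ^+ n) (c ^+ n).
Proof.
by move=> H; elim: n => [|n IH]; [exact: dseries1|rewrite !exprS; exact: dseriesM].
Qed.

Lemma dseries_in_out (f : laurent A) : below 0 f ->
  dseries (lcst f) (lmap lcst f) (f 0) /\ dseries (lmap lcst f) (lcst f) (f 0).
Proof.
move=> f0.
have Ei t s : lcst f t s = if t == 0 then f s else 0.
  by rewrite lmonE; case: eqP.
have Eo t s : lmap lcst f t s = if s == 0 then f t else 0.
  rewrite lmapE; last by move=> x y; rewrite rmorphD.
  by rewrite lmonE; case: eqP.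
split; split=> [t s|t s|]; rewrite ?Ei ?Eo ?eqxx //.
  by case: eqP => [->|//] /= /f0.
by case: eqP => [->|//]; rewrite orbF => /f0.
Qed.

(** First f(0) is inverted as a power series in one variable, then f, with all coefficients kept in
    the power series. The result lies in the quadrant, so it can be transposed and inverts both
    expansions. *)
Lemma dseries_inverse f f' (c d : A) : dseries f f' c -> d * c = 1 ->
  exists h h', [/\ quadrant h, transposed h h', h * f = 1 & h' * f' = 1].
Proof.
move=> [fq ff' fc] dc; have [f0 f0'] := quadrant_below fq.
have CT (R : comNzRingType) : (forall x y : R, True -> True -> True) by [].
have [u [u0 _ fu]] : exists u : laurent A,
    [/\ below 0 u, (forall i, (fun=> True) (u i)) & f 0 * u = 1].
  apply: (@series_inverse A (fun=> True) I (@CT A) (@CT A) (f 0) d) => //.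
  by rewrite fc.
have C0 : below 0 (0 : laurent A) by [].
have CB (x y : laurent A) : below 0 x -> below 0 y -> below 0 (x - y).
  by move=> x0 y0 i i0; rewrite lcoefB x0 // y0 // subr0.
have CM (x y : laurent A) : below 0 x -> below 0 y -> below 0 (x * y).
  by move=> x0 y0; apply: below_mul x0 y0.
have [h [h0 hC fh]] := @series_inverse (laurent A) (fun x : laurent A => below 0 x)
  C0 CB CM f u f0 f0' u0
  (etrans (mulrC _ _) fu).
have hq : quadrant h by move=> t s /orP[t0|s0]; [rewrite h0|apply: hC].
have [h' hh'] := transposed_exists hq.
exists h, h'; split=> //; first by rewrite mulrC.
have [q1 t1 _] := dseries1.
apply: laurentP => t; apply: laurentP => s.
by rewrite (transposedM hq fq hh' ff' t s) mulrC fh t1.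
Qed.

End DoubleSeries.

Lemma lmap_rmorph_zmod (A B : comNzRingType) (h : {rmorphism A -> B}) :
  zmod_morphism (lmap h).
Proof.
move=> f g; apply: laurentP => n; rewrite lcoefB.
have hD : {morph h : x y / x + y} by move=> x y; rewrite rmorphD.
by rewrite !lmapE // lcoefB rmorphB.
Qed.

Lemma lmap_rmorph_monoid (A B : comNzRingType) (h : {rmorphism A -> B}) :
  monoid_morphism (lmap h).
Proof.
have hD : {morph h : x y / x + y} by move=> x y; rewrite rmorphD.
split; first by rewrite /= lmap_mon // rmorph1.
move=> f g; have [[a fa] [b gb]] := (lcoefP f, lcoefP g).
apply: laurentP => n; rewrite lmapE // !lcoefM.
rewrite (isum_morph hD (cauchy_within (@biadditive_mul A) fa gb)).
by apply: eq_isum => i; rewrite rmorphM !lmapE.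
Qed.

(** With x1 the inner and x2 the outer variable, [lcst f] is f(x1) and [lout f] is f(x2). *)
Definition lout (A : comNzRingType) : laurent A -> laurent (laurent A) := lmap lcst.

HB.instance Definition _ (A : comNzRingType) :=
  GRing.isZmodMorphism.Build (laurent A) (laurent (laurent A)) (@lout A)
    (lmap_rmorph_zmod (@lcst A)).
HB.instance Definition _ (A : comNzRingType) :=
  GRing.isMonoidMorphism.Build (laurent A) (laurent (laurent A)) (@lout A)
    (lmap_rmorph_monoid (@lcst A)).

Section DividedDifference.
Variable A : comNzRingType.
Variable f : laurent A.

(* (f(x1) - f(x2)) / (x1 - x2) *)
Definition divided_difference : laurent (laurent A) :=
  mkL (fun t => mkL (fun s =>
    if (t, s) is (Posz i, Posz j) then f (i + j).+1%:Z else 0)).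

Lemma divided_differenceE t s : divided_difference t s =
  if (t, s) is (Posz i, Posz j) then f (i + j).+1%:Z else 0.
Proof.
rewrite (@mkLE _ _ 0); last first.
  move=> [] // n _; apply: laurentP => m.
  by rewrite (@mkLE _ _ 0) //; case=> n' //; case: n.
by rewrite (@mkLE _ _ 0) //; case=> n' //; case: t.
Qed.

Lemma dseries_divided_difference :
  dseries divided_difference divided_difference (f 1).
Proof.
split=> [t s|t s|]; rewrite !divided_differenceE //.
  by case: t => // t; case: s.
by case: t => t; case: s => // s; rewrite addnC.
Qed.

(** The coefficients of the quotient depend only on the total degree, so multiplication by x1 - x2
    telescopes and leaves the terms on the two axes. *)
Lemma divided_difference_mul : below 0 f ->
  lcst f - lout f = (lcst (lmon 1 1) - lmon 1 1) * divided_difference.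
Proof.
move=> f0; apply: laurentP => t; apply: laurentP => s.
have lD : {morph @lcst A : x y / x + y} by move=> x y; rewrite rmorphD.
rewrite mulrBl; set D := divided_difference.
rewrite (lcoefB (lcst f) (lout f) t) (lcoefB (lcst f t) (lout f t) s).
rewrite (lcoefB (lcst (lmon 1 1) * D) (lmon 1 1 * D) t).
rewrite (lcoefB ((lcst (lmon 1 1) * D) t) ((lmon 1 1 * D) t) s).
rewrite (lcstM (lmon 1 1) D t) (lmonM 1 1 D t) mul1r (lmonM 1 1 (D t) s) mul1r.
rewrite /lout (lmapE lD f t) (lmonE 0 f t) (lmonE 0 (f t) s).
rewrite /D !divided_differenceE.
case: t => t; last first.
  have -> : Negz t - 1 = Negz t.+1 by lia.
  by rewrite [f (Negz t)]f0 //= !subr0; case: eqP => _; rewrite subr0.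
case: s => s; last first.
  have -> : Negz s - 1 = Negz s.+1 by lia.
  by case: eqP => [_|_] /=; rewrite ?f0 //; case: (t%:Z - 1) => *; rewrite ?subr0.
case: t => [|t].
  have -> : 0%N%:Z - 1 = Negz 0 by [].
  case: s => [|s]; first by rewrite /= !subrr.
  have -> : s.+1%:Z - 1 = s%:Z by lia.
  by rewrite /= !subr0.
have -> : t.+1%:Z - 1 = t%:Z by lia.
case: s => [|s]; first by rewrite /= addn0 !sub0r.
have -> : s.+1%:Z - 1 = s%:Z by lia.
by rewrite /= addSnnS !subrr.
Qed.

End DividedDifference.

Section Action2.
Variables (K : fieldType) (W : lmodType K).
Local Notation L := (laurent K).
Local Notation M := (laurent W).
Implicit Types (q : {poly {poly K}}) (G : int -> int -> M).

(** One bound for both degrees lets the sums range over a square, where exchanging z1 and z2 is an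
    exchange of sums. *)
Lemma poly2_bound q : exists N : nat,
  (size q <= N)%N /\ forall i, (size (q`_i)%R <= N)%N.
Proof.
exists (maxn (size q) (\max_(i < size q) size (q`_i)%R)); split.
  exact: leq_maxl.
move=> i; have [iq|qi] := ltnP i (size q); last first.
  by rewrite nth_default // size_poly0.
rewrite (leq_trans _ (leq_maxr _ _)) //.
exact: (leq_bigmax (F := fun i : 'I_(size q) => size (q`_i)%R) (Ordinal iq)).
Qed.

Lemma act2E N q G i j : (size q <= N)%N -> (forall i, (size (q`_i)%R <= N)%N) ->
  act2 q G i j =
  \sum_(r < N) \sum_(s < N) lcst q`_r`_s *: G (i - r%:Z) (j - s%:Z).
Proof.
move=> qN qiN; rewrite /act2 (big_ord_widen N
  (fun r => pact (map_poly lcst q`_r) (G (i - r%:Z)) j) qN).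
rewrite big_mkcond; apply: eq_bigr => r _; case: ltnP => rq.
  rewrite (@pactE _ _ N) ?(leq_trans (size_poly _ _)) //.
  by apply: eq_bigr => s _; rewrite coef_map.
apply/esym; apply: big1 => s _.
by rewrite [q`_r]nth_default // coef0 rmorph0 scale0r.
Qed.

Lemma act2_swap q G i j :
  act2 (swapXY q) (fun j i => G i j) j i = act2 q G i j.
Proof.
have [N1 [H1 H1']] := poly2_bound q.
have [N2 [H2 H2']] := poly2_bound (swapXY q).
pose N := maxn N1 N2.
rewrite !(@act2E N); try by [rewrite (leq_trans H1) ?leq_maxl
  | rewrite (leq_trans H2) ?leq_maxr
  | move=> k; rewrite (leq_trans (H1' k)) ?leq_maxl
  | move=> k; rewrite (leq_trans (H2' k)) ?leq_maxr].
rewrite exchange_big; apply: eq_bigr => r _; apply: eq_bigr => s _.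
by rewrite coef_swapXY.
Qed.

Lemma act2_pact q (Q : {poly L}) G i j :
  act2 q (fun i => pact Q (G i)) i j = pact Q (act2 q G i) j.
Proof.
rewrite /act2 pact_sum; apply: eq_bigr => r _.
by rewrite pact_comm.
Qed.

Lemma pact_exchange (P Q : {poly L}) G i j :
  pact P (fun i => pact Q (G i) j) i = pact Q (fun j => pact P (G^~ j) i) j.
Proof.
rewrite {2}/pact -[RHS]/(\sum_(k < size Q) Q`_k *: pact P (G^~ (j - k%:Z)) i).
rewrite pact_sum; apply: eq_bigr => k _.
by rewrite pactZr.
Qed.

Lemma annihilates_swap q (a b : W -> int -> W) : calE W a -> calE W b ->
  annihilates q a b -> annihilates (swapXY q) b a.
Proof.
move=> Ea Eb H w; apply/funext => j; apply/funext => i.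
have pmE (q' : {poly {poly K}}) F N k l :
    (size q' <= N)%N -> (forall i, (size (q'`_i)%R <= N)%N) ->
    pmul q' F k l = \sum_(r < N) \sum_(s < N) q'`_r`_s *: F (k - r%:Z) (l - s%:Z) :> W.
  move=> qN qiN; rewrite /pmul (big_ord_widen N (fun r => \sum_(s < size q'`_r)
    q'`_r`_s *: F (k - r%:Z) (l - s%:Z)) qN) big_mkcond.
  apply: eq_bigr => r _; case: ltnP => rq.
    rewrite (big_ord_widen N (fun s => q'`_r`_s *: F (k - r%:Z) (l - s%:Z)) (qiN r)).
    rewrite big_mkcond; apply: eq_bigr => s _; case: ltnP => // sq.
    by rewrite nth_default ?scale0r.
  apply/esym; apply: big1 => s _.
  by rewrite [q'`_r]nth_default // coef0 scale0r.
have [N1 [H1 H1']] := poly2_bound q.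
have [N2 [H2 H2']] := poly2_bound (swapXY q).
pose N := maxn N1 N2.
have := congr1 (fun F : int -> int -> W => F i j) (H w).
rewrite !(pmE _ _ N); try by [rewrite (leq_trans H1) ?leq_maxl
  | rewrite (leq_trans H2) ?leq_maxr
  | move=> k; rewrite (leq_trans (H1' k)) ?leq_maxl
  | move=> k; rewrite (leq_trans (H2' k)) ?leq_maxr].
rewrite exchange_big => HN; apply: oppr_inj; rewrite [RHS]oppr0 -[RHS]HN.
rewrite -sumrN; apply: eq_bigr => s _; rewrite -sumrN; apply: eq_bigr => r _ /=.
by rewrite coef_swapXY -scalerN opprB.
Qed.

End Action2.

(** * Iterated products and their common numerator *)

Section WeakCommutativity.
Variables (K : fieldType) (p : laurent K).
Hypothesis char0 : forall n, n.+1%:R != 0 :> K.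
Hypothesis p_neq0 : p != 0.
Variable W : lmodType K.
Local Notation L := (laurent K).
Local Notation M := (laurent W).
Local Notation hat := (hat p).

(* The evaluation at z1 = phi(z, x1) of a polynomial in z1 whose coefficients
   are series in x2. *)
Definition eval_in (P : {poly laurent L}) : laurent (laurent L) :=
  (map_poly (@lout L) P).[lcst (lphi p)].

Lemma eval_inM P Q : eval_in (P * Q) = eval_in P * eval_in Q.
Proof. by rewrite /eval_in rmorphM hornerM. Qed.

Lemma eval_in_coef P u : (eval_in P) u = evphi p (xcoef u P).
Proof.
rewrite /eval_in /evphi (@horner_coef_wide _ (size P)) ?size_poly //.
rewrite (@horner_coef_wide _ (size P)) ?(leq_trans (size_poly _ _)) ?size_poly //.
rewrite lcoef_sum; apply: eq_bigr => j _.
rewrite -rmorphXn !coef_map coef_xcoef mulrC (lcstM (lphi p ^+ j)) mulrC.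
by rewrite /= /lout lmapE // => x y; rewrite rmorphD.
Qed.

Lemma eval_in_map_cst (Q : {poly L}) : eval_in (map_poly lcst Q) = lcst (evphi p Q).
Proof.
rewrite /eval_in -map_poly_comp /evphi -horner_map -map_poly_comp.
congr (_.[_]); apply: eq_map_poly => c /=.
by rewrite /lout lmap_mon // => x y; rewrite rmorphD.
Qed.

Lemma eval_in_cst f : eval_in f%:P = lout f.
Proof. by rewrite /eval_in map_polyC hornerC. Qed.

Definition polybelow (P : {poly laurent L}) := forall j, below 0 P`_j.

Lemma polybelowM P Q : polybelow P -> polybelow Q -> polybelow (P * Q).
Proof.
move=> P0 Q0 j n n0; rewrite coefM lcoef_sum big1 // => i _.
by apply: (below_mul (P0 i) (Q0 (j - i)%N)).
Qed.

Variables (a b : W -> int -> W) (m : M) (q : {poly {poly K}}).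
Variables (Qa Qb : {poly L}).
Hypotheses (Ea : calE W a) (Eb : calE W b) (ab : annihilates q a b).
Hypotheses (Qa0 : Qa != 0) (Qb0 : Qb != 0).
Hypotheses (HQa : bitrunc (pact Qa (field_op a m)))
  (HQb : bitrunc (pact Qb (field_op b m))).
Hypothesis abm : forall t, tame (field_op a (hat (field_op b m) t)).

(* Y(a, x1) Y(b, x2) m *)
Definition iterated_hat (a b : W -> int -> W) : laurent (laurent M) :=
  mkL (fun t => hat (field_op a (hat (field_op b m) t))).

Lemma iterated_hatE t : iterated_hat a b t = hat (field_op a (hat (field_op b m) t)).
Proof.
have [d Hd] := lcoefP (hat (field_op b m)).
rewrite (@mkLE _ _ d) // => i id; rewrite Hd //.
rewrite (_ : field_op a 0 = fun=> 0); last by apply/funext => j; apply: field_op0.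
by rewrite (hat_bitrunc char0 p_neq0 (bitrunc0 W)) lsubst0.
Qed.

(* q(z1, z2) Qa(z1) Qb(z2) a(z1) b(z2) m *)
Definition triple_series (a b : W -> int -> W) q Qa Qb i j : M :=
  pact Qa (fun i => pact Qb (act2 q (fun i j => field_op a (field_op b m j) i) i) j) i.

(** Qb is applied before a, so that a acts on the coefficients of an element of W((z2, z)). *)
Let U i j := field_op a (pact Qb (field_op b m) j) i.

Lemma triple_seriesE i j : triple_series a b q Qa Qb i j =
  pact Qa (fun i => act2 q U i j) i.
Proof.
congr (pact Qa _ i); apply/funext => k; rewrite -act2_pact; congr (act2 q _ k j).
by apply/funext => i'; apply/funext => j'; rewrite /U field_op_pact.
Qed.

(** The factor q kills [a, b], so the two operators may change places. *)
Lemma triple_series_swap i j :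
  triple_series b a (swapXY q) Qb Qa j i = triple_series a b q Qa Qb i j.
Proof.
rewrite /triple_series.
rewrite (pact_exchange Qb Qa (fun j => act2 (swapXY q)
  (fun i j => field_op b (field_op a m j) i) j)).
congr (pact Qa _ i); apply/funext => k; congr (pact Qb _ j); apply/funext => l.
rewrite -[LHS]/(act2 (swapXY q) (fun j i => field_op b (field_op a m i) j) l k).
rewrite (act2_swap q (fun i j => field_op b (field_op a m i) j)).
have := act2_commutator m k l Ea Eb ab.
rewrite (_ : (fun i j => _ - _) = fun i j => field_op a (field_op b m j) i +
    pact (- 1)%:P (fun j => field_op b (field_op a m i) j) j); last first.
  by apply/funext => i'; apply/funext => j'; rewrite pactC scaleN1r.
rewrite act2D (act2_pact q (- 1)%:P (fun i j => field_op b (field_op a m i) j)).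
by rewrite pactC scaleN1r => /eqP; rewrite subr_eq0 => /eqP.
Qed.

(** Qa(z1) q(z1, phi(z, x2)) Qb(phi(z, x2)): the multiplier that remains once z2 has been
    replaced. *)
Let Psi : {poly laurent L} :=
  map_poly lcst Qa * (map_poly (evphiK p) q * (evphi p Qb)%:P).

Lemma eval_in_Psi : eval_in Psi =
  lcst (evphi p Qa) * (eval_in (map_poly (evphiK p) q) * lout (evphi p Qb)).
Proof. by rewrite /Psi !eval_inM eval_in_map_cst eval_in_cst. Qed.

Let polybelow_Psi : polybelow Psi.
Proof.
apply: polybelowM; last apply: polybelowM.
- by move=> j; rewrite coef_map; apply: lcst_below.
- by move=> j; rewrite coef_map; apply: below_evphi.
- by move=> j; rewrite coefC; case: eqP => // _; apply: below_evphi.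
Qed.

Let aB i : laurent M := lmap (fun m => field_op a m i) (hat (field_op b m)).

(** The variable z2 is replaced first, with the exponent i of z1 fixed; each sum over coefficients
    of a polynomial is finite, so [hat] passes through it. *)
Lemma hat_triple_series i :
  tame (triple_series a b q Qa Qb i) /\
  hat (triple_series a b q Qa Qb i) = pact Psi aB i.
Proof.
have tb : tame (field_op b m) by exists Qb.
have tU k : tame (U k) /\ hat (U k) = pact (evphi p Qb)%:P aB k.
  rewrite pactC; have [t e] := hat_field_op char0 p_neq0 k Ea (tame_pact Qb tb).
  split=> //; rewrite /U e hat_pact // /aB.
  exact: (lmapZ (field_op_lin Ea k)).
have tact k : tame (act2 q U k) /\
    hat (act2 q U k) =
    pact (map_poly (evphiK p) q) (pact (evphi p Qb)%:P aB) k.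
  have ta r : tame (pact (map_poly lcst q`_r) (U (k - r%:Z))).
    exact/tame_pact/(tU _).1.
  have [t e] := hat_sum char0 p_neq0 (index_enum 'I_(size q)) (fun r : 'I_(size q) => ta r).
  split; first exact: t.
  rewrite [LHS]e (@pactE _ _ (size q)) ?size_poly //; apply: eq_bigr => r _.
  by rewrite (hat_pact char0 p_neq0 _ (tU _).1) (tU _).2 coef_map.
have tz (r : 'I_(size Qa)) : tame (fun j => Qa`_r *: act2 q U (i - r%:Z) j).
  exact/tameZ/(tact _).1.
have [t e] := hat_sum char0 p_neq0 (index_enum 'I_(size Qa)) tz.
rewrite (_ : triple_series a b q Qa Qb i =
    fun j => \sum_(r < size Qa) Qa`_r *: act2 q U (i - r%:Z) j); last first.
  by apply/funext => j; rewrite triple_seriesE.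
split=> //; rewrite [LHS]e /Psi pactM pactM.
rewrite (@pactE _ _ (size Qa)) ?size_poly //; apply: eq_bigr => r _.
by rewrite (hatZ char0 p_neq0 _ (tact _).1) (tact _).2 coef_map.
Qed.

Lemma z1trunc_U : exists N, forall i j, j < N -> U i j = 0.
Proof.
have [N HN] := HQb; exists N => i j jN.
rewrite /U (_ : pact _ _ _ = 0) ?field_op0 //.
by apply: laurentP => n; rewrite HN ?jN.
Qed.

Lemma ztrunc_U : exists N, forall i j, below N (U i j).
Proof.
have [N HN] := HQb; exists N => i j n nN.
by rewrite /U field_opE // HN ?calE0 // nN orbT.
Qed.

Lemma triple_series_trunc : exists N, forall i j n, (j < N) || (n < N) ->
  triple_series a b q Qa Qb i j n = 0.
Proof.
have [[N1 H1] [N2 H2]] := (z1trunc_U, ztrunc_U).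
have A1 i j : j < N1 -> act2 q U i j = 0.
  move=> jN; rewrite /act2 big1 // => r _; rewrite (z1trunc_pact _ (N := N1)) //.
  by move=> l lN; apply: H1.
have A2 i j : below N2 (act2 q U i j).
  move=> n nN; rewrite /act2 lcoef_sum big1 // => r _.
  rewrite (@pactE _ _ (size q`_r)) ?size_poly // lcoef_sum big1 // => s _.
  by rewrite coef_map lcstZ H2 ?scaler0.
have [e He] := ztrunc_pact W Qa.
exists (Num.min N1 (e + N2)) => i j n jn; rewrite triple_seriesE.
have [jN|jN] := ltP j N1.
  rewrite (_ : (fun i => _) = fun=> 0) ?pact0r //.
  by apply/funext => k; apply: A1.
apply: (He (fun i => act2 q U i j) N2 (fun i => A2 i j)).
by move: jn jN; clear; lia.
Qed.

Hypothesis trunc_swap : exists N, forall i j n, (i < N) || (n < N) ->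
  triple_series b a (swapXY q) Qb Qa j i n = 0.

(** With a on the left the series is bounded below in z2 and z; with b on the left, in z1 and z.
    Equality of the two gives all three bounds. *)
Lemma triple_series_tritrunc : tritrunc (triple_series a b q Qa Qb).
Proof.
have [[N1 H1] [N2 H2]] := (triple_series_trunc, trunc_swap).
exists (Num.min N1 N2) => i j n ijn.
have [iN|iN] := ltP i N2.
  by rewrite -triple_series_swap H2 ?iN.
by apply: H1; move: ijn iN; clear; lia.
Qed.

(* Y(a, x1) Y(b, x2) m is the expansion of a quotient whose numerator is
   obtained from triple_series by substituting phi(z, x1) and phi(z, x2). *)
Lemma eval_iterated_hat t s : (eval_in Psi *: iterated_hat a b) t s =
  if (t, s) is (Posz t, Posz s) then
    subst_coef p s (fun i => subst_coef p t (triple_series a b q Qa Qb i))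
  else 0.
Proof.
have GT := triple_series_tritrunc.
have hE i : lsubst p (triple_series a b q Qa Qb i) = pact Psi aB i.
  by rewrite -(hat_bitrunc char0 p_neq0 (tritrunc_bitrunc i GT)) (hat_triple_series i).2.
have [d Hd] := lcoefP (hat (field_op b m)).
pose N := absz (t - d)%R.
have aBE i u : aB i u = field_op a (hat (field_op b m) u) i.
  by rewrite /aB lmapE //; apply: field_opD.
(* Fix the exponent t of x2. [Psi] has no negative power of x2 and Y(b, x2) m starts at d, so only 0
   <= u <= N contribute. The sum is finite, as needed for the additivity of [hat] in z1. *)
have E : (eval_in Psi *: iterated_hat a b) t =
    hat (fun i => lsubst p (triple_series a b q Qa Qb i) t).
  rewrite lcoefZ (isum_range (a := 0) (N := N.+1)); last first.
    move=> u uN; have [u0|u0] := ltP u 0.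
      rewrite eval_in_coef (_ : xcoef u Psi = 0) ?evphi0 ?scale0r //.
      by apply/polyP => j; rewrite coef_xcoef polybelow_Psi // coef0.
    rewrite iterated_hatE Hd; last by move: uN u0; rewrite /N; clear; lia.
    rewrite (_ : field_op a 0 = fun=> 0); last by apply/funext => j; apply: field_op0.
    by rewrite (hat_bitrunc char0 p_neq0 (bitrunc0 W)) lsubst0 scaler0.
  have tt (u : 'I_N.+1) : tame (pact (xcoef u%:Z Psi)
      (field_op a (hat (field_op b m) (t - u%:Z)))).
    exact/tame_pact/abm.
  transitivity (hat (fun i => \sum_(u < N.+1) pact (xcoef u%:Z Psi)
      (field_op a (hat (field_op b m) (t - u%:Z))) i)).
    rewrite (hat_sum char0 p_neq0 _ tt).2; apply: eq_bigr => u _.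
    by rewrite add0r eval_in_coef iterated_hatE hat_pact.
  congr hat; apply/funext => i; rewrite hE [in RHS]/pact lcoef_sum.
  under eq_bigr => u _ do rewrite (@pactE _ _ (size Psi)) ?size_poly //.
  rewrite exchange_big; apply: eq_bigr => j _ /=.
  rewrite lcoefZ (isum_range (a := 0) (N := N.+1)).
    by apply: eq_bigr => u _; rewrite coef_xcoef add0r aBE.
  move=> u uN; have [u0|u0] := ltP u 0; first by rewrite polybelow_Psi ?scale0r.
  rewrite aBE Hd ?field_op0 ?scaler0 //.
  by move: uN u0; rewrite /N; clear; lia.
rewrite E; case: t {N E} => t; last first.
  rewrite (_ : (fun i => _) = fun=> 0).
    by rewrite (hat_bitrunc char0 p_neq0 (bitrunc0 W)) lsubst0.
  by apply/funext => i; rewrite below_lsubst.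
rewrite (_ : (fun i => _) = fun i => subst_coef p t (triple_series a b q Qa Qb i)).
  have bt := subst_coef_bitrunc p t GT.
  by rewrite (hat_bitrunc char0 p_neq0 bt) series_of_natE; case: s.
by apply/funext => i; rewrite series_of_natE.
Qed.

End WeakCommutativity.

Section BinomialExpansion.
Variables (A : comNzRingType) (V : lmodType A).
Implicit Types X : laurent (laurent V).

Lemma lmon_lcst_scale i j X t s :
  ((lcst (lmon i 1) * lmon j 1 : laurent (laurent A)) *: X) t s = X (t - j) (s - i).
Proof.
rewrite -scalerA (lcstZ (lmon i 1) (lmon j 1 *: X) t).
by rewrite (lmonZ i 1 _ s) scale1r (lmonZ j 1 X t) scale1r.
Qed.

Definition xdiff : laurent (laurent A) := lcst (lmon 1 1) - lmon 1 1.

Lemma xdiff_scale k X t s : (xdiff ^+ k *: X) t s =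
  \sum_(r < k.+1) X (t - r%:Z) (s - (k - r)%N%:Z) *~ ((-1) ^+ r * 'C(k, r)%:Z).
Proof.
rewrite /xdiff exprBn scaler_suml lcoef_sum lcoef_sum; apply: eq_bigr => r _.
rewrite -rmorphXn /= !lmonX -mulrA.
rewrite (_ : (-1) ^+ r * _ *+ _ = ((-1) ^+ r * 'C(k, r)%:Z)%:~R *
    (lcst (lmon (k - r)%N%:Z 1) * lmon r%:Z 1 : laurent (laurent A))).
  by rewrite -scalerA scaler_int !lcoefMz lmon_lcst_scale.
by rewrite rmorphM rmorph_sign -mulr_natl mulrCA mulrA.
Qed.

(** In the other order of the variables x1 is the outer one, so x1 - x2 is [- xdiff]. *)
Lemma xdiffN_scale k X t s : ((- xdiff) ^+ k *: X) s t =
  \sum_(r < k.+1) X (s - (k - r)%N%:Z) (t - r%:Z) *~ ((-1) ^+ r * 'C(k, r)%:Z).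
Proof.
rewrite /xdiff opprB exprBn scaler_suml lcoef_sum lcoef_sum; apply: eq_bigr => r _.
rewrite -rmorphXn /= !lmonX -mulrA [lmon _ _ * _]mulrC.
rewrite (_ : (-1) ^+ r * _ *+ _ = ((-1) ^+ r * 'C(k, r)%:Z)%:~R *
    (lcst (lmon r%:Z 1) * lmon (k - r)%N%:Z 1 : laurent (laurent A))).
  by rewrite -scalerA scaler_int !lcoefMz lmon_lcst_scale.
by rewrite rmorphM rmorph_sign -mulr_natl mulrCA mulrA.
Qed.

End BinomialExpansion.

(** Stated for abstract ring elements, so that [ring] does not have to handle nested series. *)
Lemma cancel_unit_factor (R : comNzRingType) (h ga gb e d x y D : R) :
  h * (ga * (gb * (e * d))) = 1 ->
  h * ((x * ga) * ((e * (D * d)) * (y * gb))) = x * y * D.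
Proof.
move=> hg; transitivity (x * y * D * (h * (ga * (gb * (e * d))))); first by ring.
by rewrite hg mulr1.
Qed.

(** * Comparison of the two iterated products *)

Section Locality.
Variables (K : fieldType) (p : laurent K).
Hypothesis char0 : forall n, n.+1%:R != 0 :> K.
Hypothesis p_neq0 : p != 0.
Variable W : lmodType K.
Local Notation L := (laurent K).
Local Notation M := (laurent W).
Local Notation hat := (hat p).
Implicit Types q : {poly {poly K}}.

(* q(phi(z, x1), phi(z, x2)) *)
Definition eval_phi2 q := eval_in p (map_poly (evphiK p) q).

Lemma eval_phi2M q q' : eval_phi2 (q * q') = eval_phi2 q * eval_phi2 q'.
Proof. by rewrite /eval_phi2 rmorphM eval_inM. Qed.

Lemma eval_phi2_exp q n : eval_phi2 (q ^+ n) = eval_phi2 q ^+ n.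
Proof.
elim: n => [|n IH]; last by rewrite !exprS eval_phi2M IH.
by rewrite /eval_phi2 !rmorph1 /eval_in rmorph1 hornerC.
Qed.

Lemma eval_phi2D q q' : eval_phi2 (q + q') = eval_phi2 q + eval_phi2 q'.
Proof. by rewrite /eval_phi2 /eval_in !rmorphD hornerD. Qed.

Lemma eval_phi2X : eval_phi2 'X = lcst (lphi p).
Proof. by rewrite /eval_phi2 /eval_in !map_polyX hornerX. Qed.

Lemma eval_phi2C r : eval_phi2 r%:P = lout (evphiK p r).
Proof. by rewrite /eval_phi2 map_polyC eval_in_cst. Qed.

Lemma eval_phi2_map_polyC (r : {poly K}) : eval_phi2 r^:P = lcst (evphiK p r).
Proof.
rewrite /eval_phi2 -map_poly_comp -[evphiK p r]/(evphi p (map_poly lcst r)).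
rewrite -eval_in_map_cst -map_poly_comp; congr eval_in; apply: eq_map_poly => c /=.
by rewrite /evphiK map_polyC evphiC.
Qed.

Lemma evphiK_X : evphiK p 'X = lphi p.
Proof. by rewrite /evphiK map_polyX evphiX. Qed.

(** The constant term is q(z, z) because phi(z, 0) = z. *)
Lemma dseries_eval_phi2 q :
  dseries (eval_phi2 q) (eval_phi2 (swapXY q)) (polyLL q).[lmon 1 1].
Proof.
elim/poly_ind: q => [|q r IH].
  rewrite rmorph0 /polyLL rmorph0 horner0 /eval_phi2 rmorph0 /eval_in rmorph0 horner0.
  exact: dseries0.
rewrite rmorphD rmorphM /= swapXY_X swapXY_polyC !eval_phi2D !eval_phi2M.
rewrite eval_phi2X !eval_phi2C eval_phi2_map_polyC evphiK_X.
rewrite /polyLL rmorphD rmorphM /= map_polyX map_polyC hornerMXaddC.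
have [_ H1] := dseries_in_out (@below_evphi _ p (map_poly lcst r)).
have [H2 _] := dseries_in_out (@series_of_nat_below _ (fun k => pow_coef p k 1)).
rewrite evphi_coef0 in H1; rewrite series_of_natE /= pow_coef0 in H2.
by apply: dseriesD => //; apply: dseriesM.
Qed.

Lemma eval_phi2_diff : eval_phi2 ('X - 'Y) = xdiff _ * divided_difference (lphi p).
Proof.
rewrite -divided_difference_mul; last exact: series_of_nat_below.
rewrite -polyCN eval_phi2D eval_phi2X eval_phi2C.
by rewrite (rmorphN (evphiK p)) /= evphiK_X (rmorphN (@lout L)).
Qed.

Lemma eval_phi2_swap_diff :
  eval_phi2 (swapXY ('X - 'Y)) = - xdiff _ * divided_difference (lphi p).
Proof.
rewrite rmorphB /= swapXY_X swapXY_Y -opprB mulNr -eval_phi2_diff.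
apply: (addIr (eval_phi2 ('X - 'Y))).
rewrite -eval_phi2D !addNr -[0 in LHS]polyC0 eval_phi2C.
by rewrite (rmorph0 (evphiK p)) (rmorph0 (@lout L)).
Qed.

Variables (a b : W -> int -> W) (m : M) (q q' : {poly {poly K}}) (k : nat).
Hypotheses (Ea : calE W a) (Eb : calE W b) (ab : annihilates q a b).
Hypotheses (qE : q = q' * ('X - 'Y) ^+ k) (q'0 : ~~ root q' 'X).
Hypotheses (tam : tame (field_op a m)) (tbm : tame (field_op b m)).
Hypothesis abm : forall t, tame (field_op a (hat (field_op b m) t)).
Hypothesis bam : forall t, tame (field_op b (hat (field_op a m) t)).

(** The denominator Qa(phi(z, x1)) q(phi(z, x1), phi(z, x2)) Qb(phi(z, x2)) is a monomial times (x1
    - x2)^k times an invertible double power series. Multiplying the common numerator by the inverse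
    of the latter, in either order of the variables, leaves the two sides up to the same
    monomial. *)
Lemma xdiff_commute t s :
  (xdiff _ ^+ k *: iterated_hat p m a b) t s =
  ((- xdiff _) ^+ k *: iterated_hat p m b a) s t.
Proof.
have [[Qa Qa0 HQa] [Qb Qb0 HQb]] := (tam, tbm).
have [va [ga [ga0 gan0 gaE]]] := laurent_factor (evphi_neq0 p_neq0 Qa0).
have [vb [gb [gb0 gbn0 gbE]]] := laurent_factor (evphi_neq0 p_neq0 Qb0).
pose D := divided_difference (lphi p).
have p1 : lphi p 1 = p by rewrite series_of_natE /= pow_coef11.
(* The constant term of the invertible part. Each factor is nonzero in [L]; for q'(z, z) this is the
   hypothesis that z1 - z2 does not divide q'. *)
pose c := ga 0 * (gb 0 * ((polyLL q').[lmon 1 1] * p ^+ k)).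
have c0 : c^-1 * c = 1.
  apply: mulVf; rewrite !mulf_neq0 ?expf_neq0 //.
  have -> : lmon 1 1 = polyL 'X :> L by rewrite /polyL map_polyX hornerX.
  rewrite /polyLL horner_map /=; apply: contra q'0 => /eqP q'X.
  by apply/eqP/polyL_inj; rewrite q'X rmorph0.
have Dg : dseries (lcst ga * (lout gb * (eval_phi2 q' * D ^+ k)))
    (lout ga * (lcst gb * (eval_phi2 (swapXY q') * D ^+ k))) c.
  have [H1 _] := dseries_in_out ga0; have [_ H2] := dseries_in_out gb0.
  apply: dseriesM H1 (dseriesM H2 (dseriesM (dseries_eval_phi2 q') _)).
  by rewrite -p1; apply/dseriesX/dseries_divided_difference.
have [h [h' [hq hh' hg hg']]] := dseries_inverse Dg c0.
have lout_mon v : lout (lmon v 1) = lmon v 1 :> laurent (laurent L).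
  by rewrite /lout lmap_mon ?rmorph1 // => x y; rewrite rmorphD.
have loutE v (f : laurent L) : lout (lmon v 1 * f) = lmon v 1 * lout f.
  by rewrite -lout_mon; apply: rmorphM.
have lcstE v (f : laurent L) : lcst (lmon v 1 * f) = lcst (lmon v 1) * lcst f.
  exact: rmorphM.
have tr1 := triple_series_trunc q Qa Ea HQb.
have [N2 tr2] := triple_series_trunc (swapXY q) Qb Eb HQa.
have ba := annihilates_swap Ea Eb ab.
have EA := eval_iterated_hat char0 p_neq0 Ea Eb ab Qb0 HQb abm
  (ex_intro _ N2 (fun i j n => tr2 j i n)).
have tr1' : exists N, forall i j n, (i < N) || (n < N) ->
    triple_series m a b (swapXY (swapXY q)) Qa Qb j i n = 0.
  by have [N1 H1] := tr1; exists N1 => i j n; rewrite swapXYK; apply: H1.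
have EB := eval_iterated_hat char0 p_neq0 Eb Ea ba Qa0 HQa bam tr1'.
set E := _ *: iterated_hat p m a b in EA.
set E' := _ *: iterated_hat p m b a in EB.
have Eq : quadrant E.
  by move=> i j ij; rewrite EA; case: i ij => // i; case: j.
have GT := triple_series_tritrunc Ea Eb ab HQb (ex_intro _ N2 (fun i j n => tr2 j i n)).
(* Both numerators come from one triple series, with the two substitutions made in opposite
   orders. *)
have EE' : transposed E E'.
  move=> i j; rewrite [LHS]EB [RHS]EA; case: i => [i|i]; case: j => [j|j] //.
  apply: etrans (esym (subst_coef_exchange p i j GT)).
  congr (subst_coef p j _); apply/funext => k'; congr (subst_coef p i _).
  by apply/funext => l; apply: triple_series_swap.
have e1 : h * (lcst (evphi p Qa) * (eval_phi2 q * lout (evphi p Qb))) =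
    lcst (lmon va 1) * lmon vb 1 * xdiff _ ^+ k.
  rewrite qE eval_phi2M eval_phi2_exp eval_phi2_diff exprMn gaE gbE.
  rewrite lcstE loutE.
  exact: (@cancel_unit_factor (laurent (laurent L)) h (lcst ga) (lout gb)
    (eval_phi2 q') (D ^+ k) (lcst (lmon va 1)) (lmon vb 1) (xdiff _ ^+ k) hg).
have e2 : h' * (lcst (evphi p Qb) * (eval_phi2 (swapXY q) * lout (evphi p Qa))) =
    lcst (lmon vb 1) * lmon va 1 * (- xdiff _) ^+ k.
  rewrite qE (rmorphM swapXY) (rmorphXn swapXY) eval_phi2M.
  rewrite eval_phi2_exp eval_phi2_swap_diff exprMn gaE gbE.
  rewrite lcstE loutE.
  rewrite [lout ga * _]mulrCA in hg'.
  exact: (@cancel_unit_factor (laurent (laurent L)) h' (lcst gb) (lout ga)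
    (eval_phi2 (swapXY q')) (D ^+ k) (lcst (lmon vb 1)) (lmon va 1)
    ((- xdiff _) ^+ k) hg').
have hE : h *: E = (lcst (lmon va 1) * lmon vb 1) *: (xdiff _ ^+ k *: iterated_hat p m a b).
  by rewrite /E eval_in_Psi [LHS]scalerA e1 [RHS]scalerA.
have hE' : h' *: E' = (lcst (lmon vb 1) * lmon va 1) *:
    ((- xdiff _) ^+ k *: iterated_hat p m b a).
  by rewrite /E' eval_in_Psi [LHS]scalerA e2 [RHS]scalerA.
(* Reading coefficients at shifted indices undoes the monomial x1^va x2^vb. *)
have eA (X : laurent (laurent M)) :
    ((lcst (lmon va 1) * lmon vb 1 : laurent (laurent L)) *: X) (t + vb) (s + va) = X t s.
  by rewrite (lmon_lcst_scale va vb X (t + vb) (s + va)) !addrK.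
have eB (X : laurent (laurent M)) :
    ((lcst (lmon vb 1) * lmon va 1 : laurent (laurent L)) *: X) (s + va) (t + vb) = X s t.
  by rewrite (lmon_lcst_scale vb va X (s + va) (t + vb)) !addrK.
have H := transposedZ hq Eq hh' EE' (s + va) (t + vb).
have H1 : (h *: E) (t + vb) (s + va) = (xdiff _ ^+ k *: iterated_hat p m a b) t s.
  by rewrite -eA -hE.
have H2 : (h' *: E') (s + va) (t + vb) = ((- xdiff _) ^+ k *: iterated_hat p m b a) s t.
  by rewrite -eB -hE'.
exact: etrans (esym H1) (etrans (esym H) H2).
Qed.

End Locality.

(** * From locality to the Jacobi identity *)

Section Binomials.
Variable K : fieldType.
Hypothesis char0 : forall n, n.+1%:R != 0 :> K.

(** Extended by 0 to negative lower index, so that all sums run over the integers and can be shifted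
    freely. *)
Definition zbinom (l i : int) : K := if i is Posz k then gbinom K l k else 0.

Let ff (l : int) (i : nat) : K := \prod_(j < i) (l%:~R - j%:R).

Let ffS l i : ff (l + 1) i.+1 = (l + 1)%:~R * ff l i.
Proof.
rewrite /ff big_ord_recl subr0; congr (_ * _); apply: eq_bigr => j _.
by rewrite lift0 -natr1 intrD opprD addrACA subrr addr0.
Qed.

Let ffSr l i : ff l i.+1 = ff l i * (l%:~R - i%:R).
Proof. by rewrite /ff big_ord_recr. Qed.

Let factn0 i : (i`!)%:R != 0 :> K.
Proof. by case: (i`!) (fact_gt0 i). Qed.

Lemma zbinom0 l : zbinom l 0 = 1.
Proof. by rewrite /zbinom /= /gbinom big_ord0 fact0 divr1. Qed.

Lemma zbinom_neg l i : i < 0 -> zbinom l i = 0.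
Proof. by case: i. Qed.

Lemma zbinomD1 l i : zbinom (l + 1) i = zbinom l i + zbinom l (i - 1).
Proof.
case: i => [[|i]|i]; last first.
- by rewrite (_ : Negz i - 1 = Negz i.+1) /= ?addr0 //; lia.
- rewrite (_ : i.+1%:Z - 1 = i%:Z) /=; last by lia.
  rewrite /gbinom -!/(ff _ _) ffS ffSr factS natrM invfM.
  have -> : ff l i / i`!%:R = ff l i * (i.+1%:R * (i.+1%:R^-1 * i`!%:R^-1)).
    by rewrite mulVKf.
  by rewrite intrD -natr1; ring.
by rewrite (_ : 0%:Z - 1 = Negz 0) // !zbinom0 addr0.
Qed.

Lemma zbinom_absorb l i : l%:~R * zbinom (l - 1) (i - 1) = i%:~R * zbinom l i.
Proof.
case: i => [[|i]|i]; last first.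
- by rewrite (_ : Negz i - 1 = Negz i.+1) /= ?mulr0 //; lia.
- rewrite (_ : i.+1%:Z - 1 = i%:Z) /=; last by lia.
  rewrite /gbinom -!/(ff _ _) -{3}(subrK 1 l) ffS subrK factS natrM invfM.
  rewrite -[i.+1%:Z%:~R]/(i.+1%:R).
  transitivity (l%:~R * (ff (l - 1) i * (i.+1%:R * (i.+1%:R^-1 * i`!%:R^-1)))).
    by rewrite mulVKf.
  by move: (i.+1%:R^-1) (i`!%:R^-1) => x y; ring.
by rewrite (_ : 0%:Z - 1 = Negz 0) // mulr0 mul0r.
Qed.

Lemma zbinom_nat (l i : nat) : zbinom l%:Z i%:Z = 'C(l, i)%:R.
Proof.
elim: l i => [|l IH] [|i]; rewrite ?zbinom0 ?bin0 //.
  by rewrite /= /gbinom big_ord_recl subrr mul0r mul0r.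
rewrite (_ : l.+1%:Z = l%:Z + 1); last by lia.
rewrite zbinomD1 (_ : i.+1%:Z - 1 = i%:Z); last by lia.
by rewrite !IH binS natrD.
Qed.

Definition zsign (i : int) : K := (-1) ^ i.

Let sign0 : (-1 : K) != 0. Proof. by rewrite oppr_eq0 oner_eq0. Qed.

Lemma zsignD i j : zsign (i + j) = zsign i * zsign j.
Proof. by rewrite /zsign expfzDr. Qed.

Lemma zsignK i : zsign i * zsign i = 1.
Proof. by rewrite /zsign -exprzMl ?unitrN1 // mulrNN mulr1 exp1rz. Qed.

Lemma zsignN i : zsign (- i) = zsign i.
Proof. by apply: (mulfI (expfz_neq0 i sign0)); rewrite -zsignD subrr -/(zsign i) zsignK. Qed.

Lemma zsign1 : zsign 1 = -1.
Proof. by rewrite /zsign expr1z. Qed.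

Lemma zbinomN1 i : zbinom (-1) i = if 0 <= i then zsign i else 0.
Proof.
suff H (k : nat) : zbinom (-1) k%:Z = zsign k%:Z by case: i => // k; rewrite H.
elim: k => [|k IH]; first by rewrite zbinom0 /zsign expr0z.
have := zbinomD1 (-1) k.+1%:Z; rewrite (_ : k.+1%:Z - 1 = k%:Z); last by lia.
rewrite addNr IH (zbinom_nat 0 k.+1) => /eqP; rewrite eq_sym addr_eq0 => /eqP ->.
by rewrite -addn1 PoszD zsignD zsign1 mulrN1.
Qed.

Lemma zbinom_convolution_within l m q :
  within `|q| (fun i => zbinom l i * zsign (q - i) * zbinom (m - i) (q - i)).
Proof.
move=> i iq; have [i0|i0] := ltP i 0; first by rewrite zbinom_neg ?mul0r.
by rewrite (zbinom_neg (m - i)) ?mulr0 //; lia.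
Qed.

(* By Pascal's rule the sum does not depend on l. *)
Lemma zbinom_convolution l m q :
  isum (fun i => zbinom l i * zsign (q - i) * zbinom (m + l - i) (q - i)) =
  zsign q * zbinom m q.
Proof.
pose S l := isum (fun i => zbinom l i * zsign (q - i) * zbinom (m + l - i) (q - i)).
have S1 k : S (k + 1) = S k.
  pose A i := zbinom k i * zsign (q - i) * zbinom (m + (k + 1) - i) (q - i).
  pose B i := zbinom k (i - 1) * zsign (q - i) * zbinom (m + (k + 1) - i) (q - i).
  have wA : within (`|q| + 1) A.
    by move=> i iq; apply: zbinom_convolution_within; lia.
  have wB : within (`|q| + 1) B.
    move=> i iq; rewrite /B; have [i0|i0] := ltP i 1.
      by rewrite zbinom_neg ?mul0r //; lia.
    by rewrite (zbinom_neg _ (i := q - i)) ?mulr0 //; lia.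
  have -> : S (k + 1) = isum A + isum B.
    rewrite -(isumD wA wB); apply: eq_isum => i.
    by rewrite /A /B zbinomD1 !mulrDl.
  rewrite -(isum_shift 1 B).
  have wB1 : within (`|q| + 2) (fun i => B (i + 1)).
    by move=> i iq; apply: wB; lia.
  rewrite -(isumD (within_widen _ wA) wB1); last by rewrite leq_add2l.
  apply: eq_isum => i; rewrite /A /B addrK.
  rewrite (_ : m + (k + 1) - i = m + k - i + 1); last by lia.
  rewrite (_ : m + (k + 1) - (i + 1) = m + k - i); last by lia.
  rewrite zbinomD1 (_ : q - (i + 1) = q - i - 1); last by lia.
  rewrite (zsignD (q - i) (-1)) zsignN zsign1; ring.
have S0 : S 0 = zsign q * zbinom m q.
  rewrite /S (isum1 (j := 0)) ?zbinom0 ?subr0 ?addr0 ?mul1r // => i i0.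
  suff -> : zbinom 0 i = 0 by rewrite !mul0r.
  by case: i i0 => // -[|i] // _; rewrite (zbinom_nat 0).
rewrite -[LHS]/(S l) -S0; case: l => l.
  by elim: l => // l <-; rewrite -addn1 PoszD S1.
elim: l => [|l IH]; first by rewrite -(S1 (Negz 0)); congr S.
by rewrite -IH -(S1 (Negz l.+1)); congr S; lia.
Qed.

End Binomials.

(** * Skew symmetry, associativity and the Jacobi identity *)

Section LocalityToJacobi.
Variables (K : fieldType) (V : lmodType K).
Hypothesis char0 : forall n, n.+1%:R != 0 :> K.
Variables (Y : V -> int -> V -> V) (one : V).
Hypothesis Y_linl : forall n v, linear (fun u => Y u n v).
Hypothesis Y_linr : forall u n, linear (Y u n).
Hypothesis Y_trunc : forall u v, exists N : int, forall n, N <= n -> Y u n v = 0.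
Hypothesis Y_vacuum : forall n v, Y one n v = if n == -1 then v else 0.
Hypothesis Y_creation : forall v, Y v (-1) one = v /\ forall n, 0 <= n -> Y v n one = 0.
Hypothesis Y_translation : forall u n v,
  Y (Y u n v) (-2) one - Y u n (Y v (-2) one) = - (n%:~R *: Y u (n - 1) v).
Local Notation C := (zbinom K).
Local Notation sg := (zsign K).

(* The two halves of the left-hand side of the Jacobi identity, and its
   right-hand side. *)
Definition jacobi1 u v w (l m n : int) : V :=
  isum (fun i => (sg i * C l i) *: Y u (m + l - i) (Y v (n + i) w)).

Definition jacobi2 u v w (l m n : int) : V :=
  isum (fun i => (sg i * C l i * sg l) *: Y v (n + l - i) (Y u (m + i) w)).

Definition jacobi3 u v w (l m n : int) : V :=
  isum (fun i => C m i *: Y (Y u (l + i) v) (m + n - i) w).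

Hypothesis Y_local : forall u v, exists k : nat, forall w m n,
  \sum_(r < k.+1) Y u (m + k%:Z - r%:Z) (Y v (n + r%:Z) w) *~
    ((-1) ^+ r * 'C(k, r)%:Z) =
  \sum_(r < k.+1) Y v (n + r%:Z) (Y u (m + k%:Z - r%:Z) w) *~
    ((-1) ^+ r * 'C(k, r)%:Z).

Let YDl u v n w : Y (u + v) n w = Y u n w + Y v n w.
Proof. by have := Y_linl n w 1 u v; rewrite !scale1r. Qed.

Let Y0l n w : Y 0 n w = 0.
Proof. by apply: (addrI (Y 0 n w)); rewrite -YDl !addr0. Qed.

Let YZl c u n w : Y (c *: u) n w = c *: Y u n w.
Proof. by have := Y_linl n w c u 0; rewrite Y0l !addr0. Qed.

Let YDr u n : {morph Y u n : v w / v + w}.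
Proof. by move=> v w; have := Y_linr u n 1 v w; rewrite !scale1r. Qed.

Let Y0r u n : Y u n 0 = 0.
Proof. by apply: (addrI (Y u n 0)); rewrite -YDr !addr0. Qed.

Let YZr c u n w : Y u n (c *: w) = c *: Y u n w.
Proof. by have := Y_linr u n c w 0; rewrite Y0r !addr0. Qed.

Let Yb u v : exists N : nat, forall n, N%:Z <= n -> Y u n v = 0.
Proof.
have [N HN] := Y_trunc u v; exists (absz N) => n nN; apply: HN; lia.
Qed.

Let jacobi1_within u v w l m n : exists N, within N
  (fun i => (sg i * C l i) *: Y u (m + l - i) (Y v (n + i) w)).
Proof.
have [N HN] := Yb v w; exists (N + `|n|)%N => i iN.
have [i0|i0] := ltP i 0; first by rewrite zbinom_neg // mulr0 scale0r.
by rewrite HN ?Y0r ?scaler0 //; lia.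
Qed.

Let jacobi2_within u v w l m n : exists N, within N
  (fun i => (sg i * C l i * sg l) *: Y v (n + l - i) (Y u (m + i) w)).
Proof.
have [N HN] := Yb u w; exists (N + `|m|)%N => i iN.
have [i0|i0] := ltP i 0; first by rewrite zbinom_neg // mulr0 mul0r scale0r.
by rewrite HN ?Y0r ?scaler0 //; lia.
Qed.

Let jacobi3_within u v w l m n : exists N, within N
  (fun i => C m i *: Y (Y u (l + i) v) (m + n - i) w).
Proof.
have [N HN] := Yb u v; exists (N + `|l|)%N => i iN.
have [i0|i0] := ltP i 0; first by rewrite zbinom_neg // scale0r.
by rewrite HN ?Y0l ?scaler0 //; lia.
Qed.

Let isum_add (F G : int -> V) : (exists N, within N F) -> (exists N, within N G) ->
  isum (fun i => F i + G i) = isum F + isum G.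
Proof.
move=> [N HN] [N' HN']; apply: (isumD (N := (N + N')%N)).
  by apply: within_widen HN; rewrite leq_addr.
by apply: within_widen HN'; rewrite leq_addl.
Qed.

Let within_shift (F : int -> V) (c : int) :
  (exists N, within N F) -> exists N, within N (fun i => F (i - c)).
Proof. by move=> [N HN]; exists (N + `|c|)%N => i iN; apply: HN; lia. Qed.

Let within_opp (F : int -> V) :
  (exists N, within N F) -> exists N, within N (fun i => - F i).
Proof. by move=> [N HN]; exists N => i iN; rewrite HN ?oppr0. Qed.

(** Pascal's rule, after an index shift in one of the sums. In generating functions this recursion
    and its two analogues say that z0 acts as z1 - z2. *)
Lemma jacobi1_rec u v w l m n : jacobi1 u v w (l + 1) m n =
  jacobi1 u v w l (m + 1) n - jacobi1 u v w l m (n + 1).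
Proof.
have w1 := jacobi1_within u v w l (m + 1) n.
have w2 := jacobi1_within u v w l m (n + 1).
have [N2 HN2] := w2.
have := isum_morph (@opprD V) HN2; rewrite /= => ->.
rewrite -[X in _ = _ + X](isum_shift (-1)) -isum_add //; last first.
  exact: (within_shift 1 (within_opp w2)).
apply: eq_isum => i; rewrite zbinomD1 // mulrDr scalerDl.
rewrite (_ : m + (l + 1) - i = m + 1 + l - i); last by lia.
congr (_ + _); rewrite -scaleNr zsignD zsignN zsign1.
rewrite (_ : m + 1 + l - i = m + l - (i - 1)); last by lia.
rewrite (_ : n + 1 + (i - 1) = n + i); last by lia.
by congr (_ *: _); ring.
Qed.

Lemma jacobi2_rec u v w l m n : jacobi2 u v w (l + 1) m n =
  jacobi2 u v w l (m + 1) n - jacobi2 u v w l m (n + 1).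
Proof.
have w1 := jacobi2_within u v w l (m + 1) n.
have w2 := jacobi2_within u v w l m (n + 1).
have [N2 HN2] := w2.
have := isum_morph (@opprD V) HN2; rewrite /= => ->.
rewrite -[X in _ = X + _](isum_shift (-1)) -isum_add //; last exact: within_opp w2.
  apply: eq_isum => i; rewrite zbinomD1 // mulrDr mulrDl scalerDl addrC.
  rewrite !zsignD zsignN zsign1 (_ : m + 1 + (i - 1) = m + i); last by lia.
  rewrite (_ : n + l - (i - 1) = n + 1 + l - i); last by lia.
  rewrite (_ : n + (l + 1) - i = n + 1 + l - i); last by lia.
  by rewrite -scaleNr; congr (_ *: _ + _ *: _); ring.
exact: (within_shift 1 w1).
Qed.

Lemma jacobi3_rec u v w l m n : jacobi3 u v w (l + 1) m n =
  jacobi3 u v w l (m + 1) n - jacobi3 u v w l m (n + 1).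
Proof.
have w1 := jacobi3_within u v w (l + 1) m n.
have w2 := jacobi3_within u v w l m (n + 1).
apply/eqP; rewrite eq_sym subr_eq; apply/eqP.
rewrite -[X in _ = X + _](isum_shift (-1)) -isum_add //; last exact: (within_shift 1 w1).
apply: eq_isum => i; rewrite zbinomD1 // scalerDl addrC.
rewrite (_ : l + 1 + (i - 1) = l + i); last by lia.
rewrite (_ : m + n - (i - 1) = m + 1 + n - i); last by lia.
by rewrite (_ : m + (n + 1) - i = m + 1 + n - i); last by lia.
Qed.

Let zbinom_scale (k r : nat) (x : V) :
  (sg r%:Z * C k%:Z r%:Z) *: x = x *~ ((-1) ^+ r * 'C(k, r)%:Z).
Proof. by rewrite -scaler_int rmorphM rmorphXn rmorphN1 zbinom_nat. Qed.

Let zbinom_out (k : nat) (i : int) : (i < 0) || (0 + k.+1%:Z <= i) -> C k%:Z i = 0.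
Proof.
case: i => // i /= ki; apply: etrans (zbinom_nat char0 k i) _.
by rewrite bin_small //; move: ki; clear; lia.
Qed.

(** For l = k the binomials cut the sums off and this is [Y_local]; larger l follow by the
    recursion. *)
Lemma local_above u v : exists k : nat, forall (l : nat), (k <= l)%N ->
  forall w m n, jacobi1 u v w l%:Z m n = jacobi2 u v w l%:Z m n.
Proof.
have [k Hk] := Y_local u v; exists k => l kl.
rewrite -(subnKC kl); elim: (l - k)%N => [|d IH] w m n; last first.
  by rewrite addnS -addn1 PoszD jacobi1_rec jacobi2_rec !IH.
rewrite addn0 /jacobi1 (isum_range (a := 0) (N := k.+1)); last first.
  by move=> i ik; rewrite zbinom_out // mulr0 scale0r.
transitivity (\sum_(r < k.+1) Y v (n + r%:Z) (Y u (m + k%:Z - r%:Z) w) *~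
    ((-1) ^+ r * 'C(k, r)%:Z)).
  by rewrite -Hk; apply: eq_bigr => r _; rewrite add0r zbinom_scale.
rewrite /jacobi2 (isum_range (a := 0) (N := k.+1)); last first.
  by move=> i ik; rewrite zbinom_out // mulr0 mul0r scale0r.
(* [jacobi2] counts powers of z1 where [Y_local] counts powers of z2, so the sum is reversed; the
   signs (-1)^(k-r) and (-1)^k combine to (-1)^r. *)
rewrite [RHS](reindex_inj rev_ord_inj); apply: eq_bigr => r _.
have rk : (r <= k)%N by rewrite -ltnS.
rewrite add0r [nat_of_ord (rev_ord r)]/= subSS -subzn // -zbinom_scale mulrAC -zsignD.
rewrite (_ : k%:Z - r%:Z + k%:Z = r%:Z + ((k%:Z - r%:Z) + (k%:Z - r%:Z))); last first.
  by clear; lia.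
rewrite (zsignD _ r%:Z) zsignD zsignK mulr1.
rewrite (_ : C k%:Z (k%:Z - r%:Z) = C k%:Z r%:Z); last first.
  by rewrite subzn // !zbinom_nat // bin_sub.
by congr (_ *: Y v _ (Y u _ w)); clear; lia.
Qed.

(* D^j v / j! *)
Definition divpow (j : int) v := Y v (- j - 1) one.
Local Notation T := (divpow 1).

Let divpow_neg j v : j < 0 -> divpow j v = 0.
Proof. by move=> j0; apply: (Y_creation v).2; lia. Qed.

Let divpow0 v : divpow 0 v = v. Proof. exact: (Y_creation v).1. Qed.

Let divpowD j : {morph divpow j : u v / u + v}.
Proof. by move=> u v; apply: YDl. Qed.

Let divpow00 j : divpow j 0 = 0. Proof. exact: Y0l. Qed.

Let divpowZ j c v : divpow j (c *: v) = c *: divpow j v.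
Proof. exact: YZl. Qed.

Let TE v : T v = Y v (-2) one. Proof. by []. Qed.

Let YT u n v : Y u n (T v) = T (Y u n v) + n%:~R *: Y u (n - 1) v.
Proof.
have := Y_translation u n v; rewrite -!TE => /eqP.
by rewrite subr_eq addrC => /eqP ->; rewrite subrK.
Qed.

(** Translation covariance applied to the vacuum, which D annihilates. *)
Let T_divpow j v : T (divpow j v) = (j + 1)%:~R *: divpow (j + 1) v.
Proof.
have := YT v (- j - 1) one; rewrite -/(divpow j v).
rewrite {1}TE Y_vacuum /= Y0r => /esym/eqP; rewrite addr_eq0 => /eqP ->.
rewrite -scaleNr -rmorphN /= /divpow.
by rewrite (_ : - (- j - 1) = j + 1) 1?(_ : - j - 1 - 1 = - (j + 1) - 1) //; lia.
Qed.

Let divpow_within u r j v : within (`|j|)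
  (fun t => C r t *: divpow (j - t) (Y u (r - t) v)).
Proof.
move=> t tj; have [t0|t0] := ltP t 0; first by rewrite zbinom_neg // scale0r.
by rewrite divpow_neg ?scaler0 //; lia.
Qed.

(** Coefficient form of Y(u, z) e^{xD} = e^{xD} Y(u, z - x). The induction step cancels j + 1. *)
Lemma Y_divpow u r j v :
  Y u r (divpow j v) = isum (fun t => C r t *: divpow (j - t) (Y u (r - t) v)).
Proof.
case: j => [j|j]; last first.
  rewrite divpow_neg // Y0r isum0 // => t.
  have [t0|t0] := ltP t 0; first by rewrite zbinom_neg // scale0r.
  by rewrite divpow_neg ?scaler0 //; lia.
elim: j r => [|j IH] r.
  rewrite divpow0 (isum1 (j := 0)); first by rewrite zbinom0 scale1r subr0 divpow0 subr0.
  move=> t t0; have [t0'|t0'] := ltP t 0; first by rewrite zbinom_neg // scale0r.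
  by rewrite divpow_neg ?scaler0 //; lia.
have jE : j.+1%:Z = j%:Z + 1 by lia.
apply: (scalerI (char0 j)).
have -> : j.+1%:R *: Y u r (divpow j.+1 v) = Y u r (T (divpow j v)).
  by rewrite T_divpow YZr -jE.
rewrite YT IH IH.
rewrite (isum_morph (@divpowD 1) (@divpow_within _ _ _ _)).
have ZD (c : K) : {morph (fun x : V => c *: x) : x y / x + y}.
  by move=> x y; rewrite scalerDr.
rewrite (isum_morph (ZD r%:~R) (@divpow_within u (r - 1) j v)).
rewrite (isum_morph (ZD j.+1%:R) (@divpow_within u r j.+1 v)).
rewrite -[X in _ + X](isum_shift (-1)).
rewrite -(isumD (N := (j + 2)%N)); first last.
- move=> t tj; rewrite divpow_within ?scaler0 //; lia.
- move=> t tj; rewrite divpow_within ?divpow00 //; lia.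
apply: eq_isum => t; rewrite divpowZ T_divpow.
rewrite (_ : j%:Z - t + 1 = j.+1%:Z - t); last by lia.
rewrite (_ : j%:Z - (t - 1) = j.+1%:Z - t); last by lia.
rewrite (_ : r - 1 - (t - 1) = r - t); last by lia.
rewrite !scalerA zbinom_absorb // -scalerDl; congr (_ *: _).
rewrite mulrC -mulrDl -rmorphD /= subrK; congr (_ * _).
Qed.

(** Coefficient form of Y(u, z) v = e^{zD} Y(v, -z) u. In the locality relation on the vacuum, take
    the coefficient of z2^0: on the left one term survives by creation; on the right the powers D^j
    / j! are moved to the left and the binomials collapse by [zbinom_convolution]. *)
Lemma skew_symmetry u v n :
  Y u n v = isum (fun j => sg (n + 1 + j) *: divpow j (Y v (n + j) u)).
Proof.
have [k1 Hk1] := local_above u v; have [k2 Hk2] := Yb v u.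
(* [k1] provides locality. [k2] makes the terms with r < 0 vanish, since there n + j >= k. With this
   m the term i = 0 on the left is [Y u n v]. *)
pose k := (k1 + k2)%N; pose m := n - k%:Z.
have := Hk1 k (leq_addr _ _) one m (-1).
rewrite /jacobi1 (isum1 (j := 0)); last first.
  move=> i i0; have [i0'|i0'] := ltP i 0; first by rewrite zbinom_neg // mulr0 scale0r.
  by rewrite (Y_creation v).2 ?Y0r ?scaler0 //; lia.
rewrite zbinom0 /zsign expr0z mulr1 scale1r subr0 addr0 (Y_creation v).1.
rewrite -/(zsign K _) /m subrK => ->.
rewrite /jacobi2.
pose F (i t : int) := (sg i * C k%:Z i * sg k%:Z * C (-1 + k%:Z - i) t) *:
  divpow (- m - i - 1 - t) (Y v (-1 + k%:Z - i - t) u).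
transitivity (isum (fun i => isum (fun t => F i t))).
  apply: eq_isum => i.
  have -> : Y u (n - k%:Z + i) one = divpow (- m - i - 1) u.
    by rewrite /divpow /m; congr (Y u _ one); lia.
  rewrite Y_divpow (isum_morph (f := fun x => (sg i * C k%:Z i * sg k%:Z) *: x) _
    (@divpow_within _ _ _ _)); last by move=> x y; rewrite scalerDr.
  by apply: eq_isum => t; rewrite scalerA.
transitivity (isum (fun i => isum (fun r => F i (r - i)))).
  by apply: eq_isum => i; rewrite -(isum_shift (- i) (F i)).
have Fz i r : (`|m| + 1 < `|i|)%N || (`|m| + 1 < `|r|)%N -> F i (r - i) = 0.
  move=> ir; rewrite /F; have [i0|i0] := ltP i 0.
    by rewrite zbinom_neg // mulr0 !mul0r scale0r.
  have [r0|r0] := ltP (r - i) 0; first by rewrite (zbinom_neg _ _ r0) mulr0 scale0r.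
  by rewrite divpow_neg ?scaler0 //; lia.
rewrite (isum_exchange Fz).
rewrite -(isum_refl (- m - 1)); apply: eq_isum => j.
set r := - m - 1 - j.
set X := divpow j (Y v (n + j) u).
have -> : isum (fun i => F i (r - i)) = isum (fun i =>
    (sg k%:Z * sg r * (C k%:Z i * sg (r - i) * C (-1 + k%:Z - i) (r - i))) *: X).
  apply: eq_isum => i; rewrite /F /X; congr (_ *: divpow _ (Y v _ u)).
  - rewrite -{2}(subrK i r) zsignD.
    transitivity (sg (r - i) * sg (r - i) * (sg i * C k%:Z i * sg k%:Z *
      C (-1 + k%:Z - i) (r - i))); first by rewrite zsignK mul1r.
    by ring.
  - by rewrite /r /m; lia.
  - by rewrite /r /m; lia.
have fD : {morph (fun c : K => (sg k%:Z * sg r * c) *: X) : x y / x + y}.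
  by move=> x y; rewrite mulrDr scalerDl.
rewrite -(isum_morph fD (@zbinom_convolution_within _ k%:Z (-1 + k%:Z) r)).
rewrite zbinom_convolution // mulrA -[_ * sg r * sg r]mulrA zsignK mulr1.
rewrite zbinomN1 //; case: (leP 0 r) => r0.
  by rewrite -[sg r]zsignN -zsignD; congr (sg _ *: _); rewrite /r /m; clear; lia.
by rewrite mulr0 scale0r /X Hk2 ?divpow00 ?scaler0 //; rewrite /r /m in r0; lia.
Qed.

Let skew_within u v n N : (forall r, N%:Z <= r -> Y v r u = 0) ->
  within (N + `|n|) (fun j => sg (n + 1 + j) *: divpow j (Y v (n + j) u)).
Proof.
move=> HN j jN; have [j0|j0] := ltP j 0; first by rewrite divpow_neg ?scaler0.
by rewrite HN ?divpow00 ?scaler0 //; lia.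
Qed.

(* Skew symmetry moves u past D^j / j!, which turns associativity for (u, v, w)
   into locality of u and w applied to v. *)
Lemma weak_associativity u w : exists M : nat, forall v (l m n : int), M%:Z <= m ->
  jacobi1 u v w l m n = jacobi3 u v w l m n /\ jacobi2 u v w l m n = 0.
Proof.
have [k Hk] := local_above u w; have [k' Hk'] := Yb u w.
(* [k] is for the locality of u and w, used with exponent m; [k'] makes u_(m+i) w vanish for i >=
   0. *)
exists (k + k')%N => v l m n mk; split; last first.
  apply: isum0 => i; have [i0|i0] := ltP i 0.
    by rewrite zbinom_neg // mulr0 mul0r scale0r.
  by rewrite Hk' ?Y0r ?scaler0 //; lia.
have mE : m = (absz m)%:Z by lia.
have Hm s : jacobi1 u w v m l s = jacobi2 u w v m l s.
  by rewrite mE; apply: Hk; lia.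
have [N HN] := Yb w v; have [N' HN'] := Yb u v.
have ZD (c : K) : {morph (fun x : V => c *: x) : x y / x + y}.
  by move=> x y; rewrite scalerDr.
(* Skew symmetry rewrites v_(n+i) w, and the divided powers are moved out past u. With r = i + t and
   s = j - t the sum over i becomes a binomial convolution, leaving the locality sum of u and w on
   v. *)
transitivity (isum (fun s => sg (n + 1 + s) *: divpow s (jacobi1 u w v m l (n + s)))).
  pose F (i j t : int) := (sg i * C l i * sg (n + i + 1 + j) * C (m + l - i) t) *:
    divpow (j - t) (Y u (m + l - i - t) (Y w (n + i + j) v)).
  pose B := (N + `|n|)%N.
  have F0 i j t : (B < `|i|)%N || (B < `|j|)%N || (B < `|t|)%N -> F i j t = 0.
    move=> ijt; rewrite /F; have [i0|i0] := ltP i 0.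
      by rewrite zbinom_neg // mulr0 !mul0r scale0r.
    have [t0|t0] := ltP t 0; first by rewrite (zbinom_neg _ _ t0) mulr0 scale0r.
    have [jt|jt] := ltP (j - t) 0; first by rewrite divpow_neg ?scaler0.
    by rewrite HN ?Y0r ?divpow00 ?scaler0 //; rewrite /B in ijt; lia.
  transitivity (isum (fun i => isum (fun j => isum (fun t => F i j t)))).
    apply: eq_isum => i; rewrite (skew_symmetry v w (n + i)).
    rewrite (isum_morph (@YDr u (m + l - i)) (skew_within (n := n + i) HN)).
    have wN : within (N + `|(n + i)%R|) (fun j => Y u (m + l - i)
        (sg (n + i + 1 + j) *: divpow j (Y w (n + i + j) v))).
      by move=> j jN; rewrite (skew_within HN) ?Y0r.
    rewrite (isum_morph (ZD _) wN); apply: eq_isum => j.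
    rewrite YZr Y_divpow scalerA (isum_morph (ZD _) (@divpow_within _ _ _ _)).
    by apply: eq_isum => t; rewrite scalerA.
  transitivity (isum (fun i => isum (fun r => isum (fun s => F i (s + (r - i)) (r - i))))).
    apply: eq_isum => i; rewrite (isum_exchange (N := B)); last first.
      by move=> j t jt; apply: F0; rewrite -orbA jt orbT.
    rewrite -(isum_shift (- i)); apply: eq_isum => r.
    by rewrite -(isum_shift (r - i)).
  pose G i r s := F i (s + (r - i)) (r - i).
  have G0 i r s : (B + B < `|i|)%N || (B + B < `|r|)%N || (B + B < `|s|)%N -> G i r s = 0.
    by move=> irs; apply: F0; lia.
  transitivity (isum (fun r => isum (fun s => isum (fun i => G i r s)))).
    rewrite (isum_exchange (N := (B + B)%N)); last first.
      by move=> i r ir; apply: isum0 => s; apply: G0; rewrite ir.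
    apply: eq_isum => r; rewrite (isum_exchange (N := (B + B)%N)) //.
    by move=> i s is_; apply: G0; rewrite -orbA orbCA is_ orbT.
  rewrite (isum_exchange (N := (B + B)%N)); last first.
    by move=> r s rs; apply: isum0 => i; apply: G0; rewrite -orbA rs orbT.
  apply: eq_isum => s.
  have [N1 HN1] := jacobi1_within u w v m l (n + s).
  rewrite /jacobi1 (isum_morph (@divpowD s) HN1).
  have wN1 : within N1 (fun i => divpow s ((sg i * C m i) *:
      Y u (l + m - i) (Y w (n + s + i) v))).
    by move=> i iN; rewrite HN1 ?divpow00.
  rewrite (isum_morph (ZD _) wN1); apply: eq_isum => r.
  set X := divpow s (Y u (l + m - r) (Y w (n + s + r) v)).
  have -> : isum (fun i => G i r s) = isum (fun i => (sg (n + 1 + s) *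
      (C l i * sg (r - i) * C (m + l - i) (r - i))) *: X).
    apply: eq_isum => i; rewrite /G /F /X.
    congr (_ *: divpow _ (Y u _ (Y w _ v))); try lia.
    rewrite (_ : n + i + 1 + (s + (r - i)) = n + 1 + s + (r - i) + i); last by lia.
    rewrite (zsignD _ _ i) (zsignD _ _ (r - i)).
    transitivity (sg i * sg i * (sg (n + 1 + s) *
      (C l i * sg (r - i) * C (m + l - i) (r - i)))); first by ring.
    by rewrite zsignK mul1r.
  have fD : {morph (fun c : K => (sg (n + 1 + s) * c) *: X) : x y / x + y}.
    by move=> x y; rewrite mulrDr scalerDl.
  rewrite -(isum_morph fD (@zbinom_convolution_within _ l (m + l) r)).
  by rewrite zbinom_convolution // divpowZ scalerA.
transitivity (isum (fun s => sg (n + 1 + s) *: divpow s (jacobi2 u w v m l (n + s)))).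
  by apply: eq_isum => s; rewrite Hm.
pose A := (N' + `|l|)%N.
(* The truncation of w on u_(l+i) v depends on i. Only i <= A matters, as u_(l+i) v = 0 beyond, so
   finitely many bounds are added up. *)
have [Nf HNf] := choice (fun i : int => Yb w (Y u (l + i) v)).
pose B := (A + \sum_(i < A.+1) Nf i%:Z + `|m| + `|n|)%N.
pose F (i s : int) := (C m i * sg (m + n - i + 1 + s)) *:
  divpow s (Y w (m + n - i + s) (Y u (l + i) v)).
have F0 i s : (B < `|i|)%N || (B < `|s|)%N -> F i s = 0.
  move=> is_; rewrite /F; have [i0|i0] := ltP i 0.
    by rewrite zbinom_neg // mul0r scale0r.
  have [s0|s0] := ltP s 0; first by rewrite divpow_neg ?scaler0.
  have [iA|iA] := leqP (absz i) A; last first.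
    by rewrite HN' ?Y0r ?divpow00 ?scaler0 //; rewrite /A in iA; lia.
  have NB : (Nf i <= \sum_(i < A.+1) Nf i%:Z)%N.
    rewrite (bigD1 (Ordinal (iA : (absz i < A.+1)%N))) //=.
    by rewrite gez0_abs // leq_addr.
  rewrite HNf ?divpow00 ?scaler0 //; move: is_ NB; rewrite /B.
  by move: (\sum_(i < _) _)%N i0 s0 iA; clear; lia.
transitivity (isum (fun s => isum (fun i => F i s))).
  apply: eq_isum => s; have [N1 HN1] := jacobi2_within u w v m l (n + s).
  rewrite /jacobi2 (isum_morph (@divpowD s) HN1).
  have wN1 : within N1 (fun i => divpow s ((sg i * C m i * sg m) *:
      Y w (n + s + m - i) (Y u (l + i) v))).
    by move=> i iN; rewrite HN1 ?divpow00.
  rewrite (isum_morph (ZD _) wN1); apply: eq_isum => i.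
  rewrite divpowZ scalerA /F; congr (_ *: divpow _ (Y w _ _)); last by lia.
  rewrite (_ : m + n - i + 1 + s = n + 1 + s + m + - i); last by lia.
  by rewrite !(zsignD _ _ (- i)) !(zsignD _ _ m) zsignN; ring.
(* Summing over s first is skew symmetry read backwards, for u_(l+i) v and w. *)
rewrite -(isum_exchange F0); apply: eq_isum => i.
rewrite (skew_symmetry (Y u (l + i) v) w (m + n - i)).
rewrite (isum_morph (ZD _) (skew_within (HNf i))); apply: eq_isum => s.
by rewrite scalerA.
Qed.

Lemma locality_jacobi u v w l m n :
  jacobi1 u v w l m n - jacobi2 u v w l m n = jacobi3 u v w l m n.
Proof.
have [k Hk] := local_above u v; have [k' Hk'] := Yb u v.
have [M HM] := weak_associativity u w.
have vanish l1 m1 n1 : (k + k')%:Z <= l1 \/ M%:Z <= m1 ->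
    jacobi1 u v w l1 m1 n1 - jacobi2 u v w l1 m1 n1 = jacobi3 u v w l1 m1 n1.
  case=> [kl|Mm]; last by have [-> ->] := HM v l1 m1 n1 Mm; rewrite subr0.
  have lE : l1 = (absz l1)%:Z by lia.
  rewrite lE Hk ?subrr; last by lia.
  rewrite /jacobi3 isum0 // => i; have [i0|i0] := ltP i 0.
    by rewrite zbinom_neg // scale0r.
  by rewrite Hk' ?Y0l ?scaler0 //; lia.
(* The recursion expresses (l, m, n) through (l + 1, m, n - 1) and (l, m + 1, n - 1), both with
   larger l + m; d counts the steps left. Once l + m reaches k + k' + M, either l >= k + k' or m >=
   M. *)
suff H (d : nat) l1 m1 n1 : (k + k' + M)%:Z <= l1 + m1 + d%:Z ->
    jacobi1 u v w l1 m1 n1 - jacobi2 u v w l1 m1 n1 = jacobi3 u v w l1 m1 n1.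
  by apply: (H (k + k' + M + `|l| + `|m|)%N); lia.
elim: d l1 m1 n1 => [|d IH] l1 m1 n1 Hd.
  by apply: vanish; have [?|?] := lerP (k + k')%:Z l1; [left|right; lia].
have := IH (l1 + 1) m1 (n1 - 1); rewrite jacobi1_rec jacobi2_rec jacobi3_rec subrK.
have := IH l1 (m1 + 1) (n1 - 1) => <-; last by lia.
move: (jacobi1 _ _ _ _ (m1 + 1) _) (jacobi2 _ _ _ _ (m1 + 1) _) => x y.
move=> H; have := H ltac:(lia) => {H}.
rewrite [in LHS]opprB [_ - y]addrC addrACA => /addrI /(congr1 -%R).
by rewrite opprD !opprK.
Qed.

Let nat_isum N (F : int -> V) : (forall i, i < 0 -> F i = 0) -> within N F ->
  \sum_(i \in [set: nat]) F i%:Z = isum F.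
Proof.
move=> F0 FN; rewrite (isum_range (a := 0) (N := N.+1)); last first.
  by move=> i iN; have [/F0//|i0] := ltP i 0; apply: FN; lia.
rewrite (fsbigE (iota 0 N.+1)) ?iota_uniq // => [|i _].
  rewrite (_ : iota 0 N.+1 = index_iota 0 N.+1) ?big_mkord; last by rewrite /index_iota subn0.
  by apply: eq_big => [k|k _]; rewrite ?in_setT ?add0r.
by rewrite mem_iota -leqNgt /= => iN; apply: FN.
Qed.

Theorem local_vertex_algebra : vertex_algebra Y one.
Proof.
split=> // u v w l m n.
have [N1 H1] := jacobi1_within u v w l m n.
have [N2 H2] := jacobi2_within u v w l m n.
have [N3 H3] := jacobi3_within u v w l m n.
transitivity (jacobi3 u v w l m n); last first.
  rewrite /jacobi3 -(nat_isum _ H3) // => i i0.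
  by rewrite zbinom_neg // scale0r.
rewrite -locality_jacobi /jacobi2.
have := isum_morph (@opprD V) H2; rewrite /= => ->.
rewrite /jacobi1 -isum_add; [|by exists N1|by apply: within_opp; exists N2].
rewrite -(nat_isum (N := (N1 + N2)%N)).
- apply: eq_fsbigr => i _; rewrite scalerBr !scalerA -scaleNr.
  by [].
- by move=> i i0; rewrite zbinom_neg // mulr0 mul0r !scale0r subr0.
- by move=> i iN; rewrite H1 ?H2 ?subr0 //; lia.
Qed.

End LocalityToJacobi.

(** * The vertex algebra of a quasi local set *)

Section FieldCombinations.
Variables (K : fieldType) (W : lmodType K).
Local Notation M := (laurent W).
Implicit Types (a b u v : W -> int -> W) (m : M) (q : {poly {poly K}}).

Lemma calE_zero : calE W 0.
Proof.
by split=> [c x y|w]; [rewrite scaler0 addr0|exists 0].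
Qed.

Lemma calE_comb c a b : calE W a -> calE W b -> calE W (c *: a + b).
Proof.
move=> Ea Eb; split=> [d x y|w].
  apply/funext => n; rewrite /GRing.add /= /GRing.scale /=.
  rewrite -[LHS]/(c *: a (d *: x + y) n + b (d *: x + y) n).
  rewrite -[RHS]/(d *: (c *: a x n + b x n) + (c *: a y n + b y n)).
  rewrite (calE_lin Ea) (calE_lin Eb) !scalerDr !scalerA [c * d]mulrC.
  by rewrite addrACA.
have [[N aN] [N' bN]] := (Ea.2 w, Eb.2 w).
exists (Num.min N N') => n nN; rewrite -[LHS]/(c *: a w n + b w n).
by rewrite aN ?bN ?scaler0 ?addr0 //; lia.
Qed.

Lemma calE_id : calE W (id_field W).
Proof.
split=> [c x y|w]; last by exists 0 => n n0; rewrite /id_field lt_eqF.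
apply/funext => n; rewrite -[RHS]/(c *: id_field W x n + id_field W y n).
by rewrite /id_field; case: eqP => // _; rewrite scaler0 addr0.
Qed.

Lemma field_op_comb c a b m i : calE W a -> calE W b ->
  field_op (c *: a + b) m i = lcst c *: field_op a m i + field_op b m i.
Proof.
move=> Ea Eb; apply: laurentP => n.
rewrite field_opE; last exact: calE_comb.
by rewrite lcoefD lcstZ !field_opE.
Qed.

Lemma lfield_comb c a b w : calE W a -> calE W b ->
  lfield (c *: a + b) w = lcst c *: lfield a w + lfield b w.
Proof.
move=> Ea Eb; apply: laurentP => n.
by rewrite lfieldE ?lcoefD ?lcstZ ?lfieldE //; apply: calE_comb.
Qed.

Lemma field_commutator_comb c a b x w i : calE W a -> calE W b -> calE W x ->
  field_commutator x (c *: a + b) w i =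
  lcst c *: field_commutator x a w i + field_commutator x b w i.
Proof.
move=> Ea Eb Ex; rewrite /field_commutator !lfield_comb //.
by rewrite field_opD // field_opZ // scalerBr opprD addrACA.
Qed.

Lemma annihilatesM q q' a b : calE W a -> calE W b ->
  annihilates q a b -> annihilates (q' * q) a b.
Proof.
move=> Ea Eb /(annihilatesE _ Ea Eb) H; apply/(annihilatesE _ Ea Eb) => w i.
rewrite /polyLL rmorphM pactM (_ : pact _ (field_commutator a b w) = fun=> 0).
  by rewrite pact0r.
by apply/funext => j; apply: H.
Qed.

Lemma annihilates_comb q q' c a b x : calE W a -> calE W b -> calE W x ->
  annihilates q x a -> annihilates q' x b -> annihilates (q * q') x (c *: a + b).
Proof.
move=> Ea Eb Ex Ha Hb; have Eab := calE_comb c Ea Eb.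
have {Ha} := annihilatesM q' Ex Ea Ha; rewrite mulrC => Ha.
have {Hb} Hb := annihilatesM q Ex Eb Hb.
apply/(annihilatesE _ Ex Eab) => w i.
rewrite (_ : field_commutator x _ w = fun i =>
    lcst c *: field_commutator x a w i + field_commutator x b w i); last first.
  by apply/funext => j; apply: field_commutator_comb.
rewrite pactDr pactZr.
move/(annihilatesE _ Ex Ea): Ha => ->; move/(annihilatesE _ Ex Eb): Hb => ->.
by rewrite scaler0 addr0.
Qed.

Lemma lfield_id w : lfield (id_field W) w = lmon 0 w.
Proof.
by apply: laurentP => n; rewrite lfieldE ?lmonE //; apply: calE_id.
Qed.

Lemma field_op_mon a n w i : calE W a ->
  field_op a (lmon n w) i = lmon n (a w i).
Proof. by move=> Ea; apply: lmap_mon => x y; apply: (calED Ea). Qed.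

Lemma annihilates_id a : calE W a -> annihilates 1 a (id_field W).
Proof.
move=> Ea; apply/(annihilatesE _ Ea calE_id) => w i.
rewrite /polyLL rmorph1 pact1 /field_commutator !lfield_id field_op_mon //.
exact: subrr.
Qed.

Lemma calE_eq a b : calE W a -> calE W b -> (forall w, lfield a w = lfield b w) -> a = b.
Proof.
move=> Ea Eb ab; apply/funext => w; apply/funext => n.
by rewrite -!lfieldE // ab.
Qed.

End FieldCombinations.

(* YE_mode p a n b is a junk value, possibly outside calE, when (a, b) is not
   quasi local; the premise of generated_mode excludes it. *)
Inductive generated (K : fieldType) (W : lmodType K) (p : int -> K)
    (S : set (W -> int -> W)) : (W -> int -> W) -> Prop :=
| generated_in a : S a -> generated p S a
| generated_id : generated p S (id_field W)
| generated_zero : generated p S 0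
| generated_comb c a b : generated p S a -> generated p S b ->
    generated p S (c *: a + b)
| generated_mode a n b : generated p S a -> generated p S b ->
    quasi_local_pair a b -> generated p S (YE_mode p a n b).

(** * Locality of everything generated by S *)

Section Closure.
Variables (K : fieldType) (p : laurent K).
Hypothesis char0 : forall n, n.+1%:R != 0 :> K.
Hypothesis p_neq0 : p != 0.
Variable W : lmodType K.
Variable Qc : set {poly {poly K}}.
Hypothesis Qc_neq0 : forall q, Qc q -> q != 0.
Hypothesis Qc1 : Qc 1.
Hypothesis QcM : forall q q', Qc q -> Qc q' -> Qc (q * q').
Hypothesis Qc_swap : forall q, Qc q -> Qc (swapXY q).
Implicit Types (a b u v : W -> int -> W) (S : set (W -> int -> W)).

(** The class [Qc] is a parameter in order to treat two cases at once: all nonzero polynomials, or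
    the powers of z1 - z2 up to sign. The sign is forced by closure under exchange of z1 and z2. *)
Definition annihilated a b := exists2 q, Qc q & annihilates q a b.

Let QcX q n : Qc q -> Qc (q ^+ n).
Proof. by move=> Qq; elim: n => // n IH; rewrite exprS; apply: QcM. Qed.

Lemma annihilated_quasi_local a b : annihilated a b -> quasi_local_pair a b.
Proof. by move=> [q /Qc_neq0]; exists q. Qed.

Lemma generated_calE S : S `<=` calE W -> generated p S `<=` calE W.
Proof.
move=> SE a; elim=> {a} [a /SE//||||].
- exact: calE_id.
- exact: calE_zero.
- by move=> c a b _ Ea _ Eb; apply: calE_comb.
- by move=> a n b _ Ea _ Eb ab; apply: YE_mode_calE.
Qed.

(** Dong's lemma is the step for modes; for a linear combination the product of the two polynomials
    works. *)
Lemma annihilated_generated S a : S `<=` calE W -> calE W a ->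
  (forall b, S b -> annihilated a b) ->
  forall b, generated p S b -> annihilated a b.
Proof.
move=> SE Ea aS b; elim=> {b} [b /aS//||||].
- by exists 1 => //; apply: annihilates_id.
- exists 1 => //.
  have := annihilates_comb (-1) (calE_id W) (calE_id W) Ea
    (annihilates_id Ea) (annihilates_id Ea).
  by rewrite mulr1 scaleN1r addNr.
- move=> c b b' /(generated_calE SE) Eb [q Qq ab] /(generated_calE SE) Eb' [q' Qq' ab'].
  by exists (q * q'); [apply: QcM|apply: annihilates_comb].
- move=> b n b' /(generated_calE SE) Eb [q Qq ab] /(generated_calE SE) Eb' [q' Qq' ab'] bb'.
  have [N HN] := dong char0 p_neq0 Ea Eb Eb' ab ab' bb' n.
  by exists ((q' * q) ^+ N) => //; apply/QcX/QcM.
Qed.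

Lemma annihilated_sym a b : calE W a -> calE W b -> annihilated a b -> annihilated b a.
Proof.
by move=> Ea Eb [q Qq ab]; exists (swapXY q); [apply: Qc_swap|apply: annihilates_swap].
Qed.

(** The previous induction enlarges only one argument. It is used against a fixed element of S and
    then, after exchanging the arguments, against a fixed generated field. *)
Lemma generated_annihilated S : S `<=` calE W ->
  (forall a b, S a -> S b -> annihilated a b) ->
  forall a b, generated p S a -> generated p S b -> annihilated a b.
Proof.
move=> SE SS a b Ga Gb; have GE := generated_calE SE.
apply: (annihilated_generated SE (GE _ Ga)) => // {Gb} b Sb.
apply: annihilated_sym; [exact: SE|exact: GE|].
by apply: (annihilated_generated SE (SE _ Sb)) => // c; apply: SS.
Qed.

Lemma generated_closed S : S `<=` calE W ->
  (forall a b, S a -> S b -> annihilated a b) ->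
  YE_closed_subspace p (generated p S).
Proof.
move=> SE SS; split.
- exact: generated_calE.
- exact: generated_zero.
- by move=> c a b; apply: generated_comb.
- move=> a b Ga Gb; apply: annihilated_quasi_local.
  exact: generated_annihilated Gb.
- move=> a b n Ga Gb; apply: generated_mode => //; apply: annihilated_quasi_local.
  exact: generated_annihilated Gb.
Qed.

(** [YE_span] is an intersection; this inclusion lends it the induction principle of [generated]. *)
Lemma YE_span_generated S : S `<=` calE W ->
  (forall a b, S a -> S b -> annihilated a b) ->
  YE_span p S `<=` generated p S.
Proof.
move=> SE SS; apply: smallest_sub; first exact: generated_closed.
by move=> a [Sa|->]; [apply: generated_in|apply: generated_id].
Qed.

Lemma YE_span_annihilated S : S `<=` calE W ->
  (forall a b, S a -> S b -> annihilated a b) ->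
  forall a b, YE_span p S a -> YE_span p S b -> annihilated a b.
Proof.
move=> SE SS a b Sa Sb.
by apply: (generated_annihilated SE SS); apply: YE_span_generated.
Qed.

Lemma YE_span_closed S : S `<=` calE W ->
  (forall a b, S a -> S b -> annihilated a b) ->
  YE_closed_subspace p (YE_span p S).
Proof.
move=> SE SS; have sg := YE_span_generated SE SS; split.
- by move=> a /sg; apply: generated_calE.
- by move=> U [[_ U0 _ _ _] _].
- by move=> c a b Sa Sb U HU; have [[_ _ UD _ _] _] := HU; apply: UD; [apply: Sa|apply: Sb].
- move=> a b Sa Sb; apply: annihilated_quasi_local.
  exact: (YE_span_annihilated SE SS).
- by move=> a b n Sa Sb U HU; have [[_ _ _ _ UY] _] := HU; apply: UY; [apply: Sa|apply: Sb].
Qed.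

End Closure.

(** * Linearity, vacuum, creation and translation *)

Section Modes.
Variables (K : fieldType) (p : laurent K).
Hypothesis char0 : forall n, n.+1%:R != 0 :> K.
Hypothesis p_neq0 : p != 0.
Variable W : lmodType K.
Local Notation M := (laurent W).
Local Notation hat := (hat p).
Implicit Types (a b c u v : W -> int -> W) (m : M).

Lemma YE_mode_combl d a a' b n :
  calE W a -> calE W a' -> calE W b ->
  quasi_local_pair a b -> quasi_local_pair a' b -> quasi_local_pair (d *: a + a') b ->
  YE_mode p (d *: a + a') n b = d *: YE_mode p a n b + YE_mode p a' n b.
Proof.
move=> Ea Ea' Eb ab a'b aab; have Eaa := calE_comb d Ea Ea'.
apply: calE_eq; first exact: YE_mode_calE.
  by apply: calE_comb; apply: YE_mode_calE.
move=> w; rewrite lfield_comb; try exact: YE_mode_calE.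
rewrite !lfield_YE_mode //.
have ta := quasi_local_tame w Ea Eb ab; have ta' := quasi_local_tame w Ea' Eb a'b.
rewrite (_ : field_op (d *: a + a') (lfield b w) = fun i =>
    lcst d *: field_op a (lfield b w) i + field_op a' (lfield b w) i).
  rewrite (hatD char0 p_neq0 (tameZ _ ta) ta') (hatZ char0 p_neq0 _ ta).
  move: (hat _) (hat _) => Y X.
  by rewrite (lcoefD (lcst (lcst d) *: X) Y) (lcstZ (lcst d) X).
by apply/funext => i; apply: field_op_comb.
Qed.

Lemma YE_mode_combr d a b b' n :
  calE W a -> calE W b -> calE W b' ->
  quasi_local_pair a b -> quasi_local_pair a b' -> quasi_local_pair a (d *: b + b') ->
  YE_mode p a n (d *: b + b') = d *: YE_mode p a n b + YE_mode p a n b'.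
Proof.
move=> Ea Eb Eb' ab ab' abb; have Ebb := calE_comb d Eb Eb'.
apply: calE_eq; first exact: YE_mode_calE.
  by apply: calE_comb; apply: YE_mode_calE.
move=> w; rewrite lfield_comb; try exact: YE_mode_calE.
rewrite !lfield_YE_mode //.
have tb := quasi_local_tame w Ea Eb ab; have tb' := quasi_local_tame w Ea Eb' ab'.
rewrite (_ : field_op a (lfield (d *: b + b') w) = fun i =>
    lcst d *: field_op a (lfield b w) i + field_op a (lfield b' w) i).
  rewrite (hatD char0 p_neq0 (tameZ _ tb) tb') (hatZ char0 p_neq0 _ tb).
  move: (hat _) (hat _) => Y X.
  by rewrite (lcoefD (lcst (lcst d) *: X) Y) (lcstZ (lcst d) X).
by apply/funext => i; rewrite lfield_comb // field_opD // field_opZ.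
Qed.

Lemma YE_mode_truncated a b : calE W a -> calE W b -> quasi_local_pair a b ->
  exists N : int, forall n, N <= n -> YE_mode p a n b = 0.
Proof.
move=> Ea Eb ab; have [d Hd] := hat_lfield_below char0 p_neq0 Ea Eb ab.
exists (- d) => n nd; apply: calE_eq; [exact: YE_mode_calE|exact: calE_zero|].
move=> w; rewrite lfield_YE_mode // Hd; last by lia.
by apply: laurentP => k; rewrite lfieldE //; apply: calE_zero.
Qed.

Lemma quasi_local_idl a : calE W a -> quasi_local_pair (id_field W) a.
Proof.
move=> Ea; exists (swapXY 1); last exact: annihilates_swap (calE_id W) (annihilates_id Ea).
by rewrite rmorph1 oner_neq0.
Qed.

Lemma quasi_local_idr a : calE W a -> quasi_local_pair a (id_field W).
Proof. by move=> Ea; exists 1; [apply: oner_neq0|apply: annihilates_id]. Qed.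

Lemma field_op_id m i : field_op (id_field W) m i = if i == 0 then m else 0.
Proof.
apply: laurentP => n; rewrite field_opE; last exact: calE_id.
by rewrite /id_field; case: eqP.
Qed.

(** 1_W has only a z1^0 coefficient, so replacing z1 changes nothing. *)
Lemma YE_mode_vacuum b n : calE W b ->
  YE_mode p (id_field W) n b = if n == -1 then b else 0.
Proof.
move=> Eb; have Ei := calE_id W; have ib := quasi_local_idl Eb.
apply: calE_eq; [exact: YE_mode_calE|by case: eqP => // _; apply: calE_zero|].
move=> w; rewrite lfield_YE_mode //; set F := field_op _ _.
have FE i : F i = if i == 0 then lfield b w else 0 by apply: field_op_id.
have HF : bitrunc F.
  have [N HN] := lcoefP (lfield b w); exists (Num.min 0 N) => i k ik.
  rewrite FE; case: eqP => // i0; apply: HN; move: ik i0; clear; lia.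
rewrite (hat_bitrunc char0 p_neq0 HF) series_of_natE.
have l0 : lfield (0 : W -> int -> W) w = 0.
  by apply: laurentP => k; rewrite lfieldE //; apply: calE_zero.
have sE k : subst_coef p k F = if k == 0%N then lfield b w else 0.
  have [N cN] := pow_coef_conv p k HF.
  apply: laurentP => j; rewrite (lsumE _ cN) (isum1 (j := 0)) => [|i /negPf i0].
    by rewrite FE eqxx pow_coef_cst //; case: eqP => _; rewrite ?scale1r ?scale0r.
  by rewrite FE i0 scaler0.
case: eqP => [->|n1]; first by rewrite (_ : - -1 - 1 = 0%:Z :> int) // sE.
rewrite l0; case E : (- n - 1) => [k|k] //; rewrite sE; case: eqP => // k0.
by case: n1; rewrite k0 in E; move: E; clear; lia.
Qed.

Let bitrunc_mon a w : calE W a -> bitrunc (field_op a (lmon 0 w)).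
Proof.
move=> Ea; have [N aN] := Ea.2 w; exists (Num.min 0 N) => i k ik.
rewrite field_op_mon // lmonE; case: eqP => // k0; apply: aN.
by move: ik k0; clear; lia.
Qed.

Let subst_coef0_mon a w : calE W a ->
  subst_coef p 0 (field_op a (lmon 0 w)) = lfield a w.
Proof.
move=> Ea; have [N cN] := pow_coef_conv p 0 (bitrunc_mon w Ea).
apply: laurentP => j; rewrite (lsumE _ cN) (isum1 (j := j)) => [|i ij].
  by rewrite field_op_mon // pow_coef0 lmonZ scale1r subrr lmonE eqxx lfieldE.
rewrite field_op_mon // pow_coef0 lmonZ scale1r lmonE subr_eq0.
by rewrite eq_sym (negPf ij).
Qed.

(** Y_E(a, x) 1_W is a(phi(z, x)); the substitution applies directly since a(z1)w lies in
    W((z1)). *)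
Lemma lfield_YE_mode_id a n w : calE W a ->
  lfield (YE_mode p a n (id_field W)) w =
  lsubst p (field_op a (lmon 0 w)) (- n - 1).
Proof.
move=> Ea; rewrite lfield_YE_mode //; try exact: calE_id; last exact: quasi_local_idr.
by rewrite lfield_id (hat_bitrunc char0 p_neq0) //; apply: bitrunc_mon.
Qed.

Lemma YE_mode_creation a : calE W a ->
  YE_mode p a (-1) (id_field W) = a /\
  forall n, 0 <= n -> YE_mode p a n (id_field W) = 0.
Proof.
move=> Ea; have Ei := calE_id W; have ai := quasi_local_idr Ea.
split=> [|n n0].
  apply: calE_eq => // [|w]; first exact: YE_mode_calE.
  rewrite lfield_YE_mode_id // (_ : - -1 - 1 = 0%:Z :> int) //.
  by rewrite series_of_natE subst_coef0_mon.
apply: calE_eq; [exact: YE_mode_calE|exact: calE_zero|move=> w].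
rewrite lfield_YE_mode_id // below_lsubst; last by lia.
by apply: laurentP => k; rewrite lfieldE //; apply: calE_zero.
Qed.

(** The x-coefficient of a(phi(z, x)): the translation operator of the vertex algebra is p d/dz. *)
Lemma lfield_translation a w : calE W a ->
  lfield (YE_mode p a (-2) (id_field W)) w = dM p (lfield a w).
Proof.
move=> Ea; have HF := bitrunc_mon w Ea.
rewrite lfield_YE_mode_id // (_ : - -2 - 1 = 1%:Z :> int) // series_of_natE.
rewrite -(subst_coef0_mon w Ea) (dM_subst_coef char0 p_neq0 0 HF).
rewrite (_ : (fun i => dM p _) = fun=> 0).
  have s0 : subst_coef p 0 (fun=> 0 : M) = 0.
    by have := congr1 (fun f : laurent M => f 0) (lsubst0 p W); rewrite series_of_natE.
  by rewrite s0 addr0.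
by apply/funext => i; rewrite field_op_mon // /dM der_cst scaler0.
Qed.

Lemma field_op_dM a m i : calE W a -> dM p (field_op a m i) = field_op a (dM p m) i.
Proof.
move=> Ea; rewrite /dM field_opZ //; congr (_ *: _); apply: laurentP => n.
rewrite derE !field_opE // derE.
have := calE_lin Ea i (n + 1)%:~R (m (n + 1)) 0.
by rewrite calE0 // !addr0 !scaler_int.
Qed.

(** The coefficient of x^(-n-1) in [nabla_hat]; there d/dx produces the mode n - 1 with factor
    -n. *)
Lemma YE_mode_translation u n v : calE W u -> calE W v ->
  quasi_local_pair u v -> quasi_local_pair u (YE_mode p v (-2) (id_field W)) ->
  YE_mode p (YE_mode p u n v) (-2) (id_field W) -
    YE_mode p u n (YE_mode p v (-2) (id_field W)) =
  - (n%:~R *: YE_mode p u (n - 1) v).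
Proof.
move=> Eu Ev uv uTv; have Ei := calE_id W.
have ETv : calE W (YE_mode p v (-2) (id_field W)).
  exact: YE_mode_calE (quasi_local_idr Ev).
have Euv k : calE W (YE_mode p u k v) by apply: YE_mode_calE.
have Tuv : calE W (YE_mode p (YE_mode p u n v) (-2) (id_field W)).
  exact: YE_mode_calE (quasi_local_idr (Euv n)).
have EuTv : calE W (YE_mode p u n (YE_mode p v (-2) (id_field W))).
  exact: YE_mode_calE.
apply/eqP; rewrite subr_eq -scaleNr; apply/eqP.
apply: calE_eq => // [|w]; first exact: calE_comb.
rewrite lfield_comb // lfield_translation //.
rewrite [lfield (YE_mode p u n v) w]lfield_YE_mode //.
rewrite [lfield (YE_mode p u n _) w]lfield_YE_mode //.
rewrite [lfield (YE_mode p u (n - 1) v) w]lfield_YE_mode //.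
have t := quasi_local_tame w Eu Ev uv.
have -> : field_op u (lfield (YE_mode p v (-2) (id_field W)) w) =
    fun i => dM p (field_op u (lfield v w) i).
  by apply/funext => i; rewrite lfield_translation // field_op_dM.
rewrite -(nabla_hat char0 p_neq0 t); move: (hat _) => X.
rewrite (lcoefB (lmap (@dM _ p W) X) (der X)) lmapE; last exact: dMD.
rewrite derE (_ : - n - 1 + 1 = - n); last by lia.
rewrite (_ : - (n - 1) - 1 = - n); last by lia.
by rewrite -rmorphN /= rmorph_int scaler_int [RHS]addrC subrK.
Qed.

End Modes.

(** * Locality and associativity of the modes *)

Section ModeLocality.
Variables (K : fieldType) (p : laurent K).
Hypothesis char0 : forall n, n.+1%:R != 0 :> K.
Hypothesis p_neq0 : p != 0.
Variable W : lmodType K.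
Local Notation M := (laurent W).
Local Notation hat := (hat p).
Implicit Types (a b c u v : W -> int -> W).

Lemma iterated_hat_mode a b c w t s : calE W a -> calE W b -> calE W c ->
  quasi_local_pair b c -> (forall n, quasi_local_pair a (YE_mode p b n c)) ->
  iterated_hat p (lfield c w) a b t s =
  lfield (YE_mode p a (- s - 1) (YE_mode p b (- t - 1) c)) w.
Proof.
move=> Ea Eb Ec bc abc; rewrite (iterated_hatE char0 p_neq0 _ _ Ea).
rewrite lfield_YE_mode //; last exact: YE_mode_calE.
rewrite lfield_YE_mode //.
have -> : - (- t - 1) - 1 = t by clear; lia.
by have -> : - (- s - 1) - 1 = s by clear; lia.
Qed.

(** The exponent is the multiplicity of z1 - z2 in some q killing [a, b], hence independent of c.
    The conditions on c ensure that all iterated modes are given by [hat]. *)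
Lemma YE_mode_locality a b : calE W a -> calE W b -> quasi_local_pair a b ->
  exists k : nat, forall c, calE W c ->
    quasi_local_pair a c -> quasi_local_pair b c ->
    (forall n, quasi_local_pair a (YE_mode p b n c)) ->
    (forall n, quasi_local_pair b (YE_mode p a n c)) ->
  forall m n : int,
  \sum_(r < k.+1) YE_mode p a (m + k%:Z - r%:Z) (YE_mode p b (n + r%:Z) c) *~
    ((-1) ^+ r * 'C(k, r)%:Z) =
  \sum_(r < k.+1) YE_mode p b (n + r%:Z) (YE_mode p a (m + k%:Z - r%:Z) c) *~
    ((-1) ^+ r * 'C(k, r)%:Z).
Proof.
move=> Ea Eb [q q0 ab]; have [k [q']] := multiplicity_XsubC q 'X.
rewrite q0 /= => q'0 qE; exists k => c Ec ac bc abc bac m n.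
have Ebc i : calE W (YE_mode p b i c) by apply: YE_mode_calE.
have Eac i : calE W (YE_mode p a i c) by apply: YE_mode_calE.
have Eabc i j : calE W (YE_mode p a i (YE_mode p b j c)) by apply: YE_mode_calE.
have Ebac i j : calE W (YE_mode p b i (YE_mode p a j c)) by apply: YE_mode_calE.
have Hsum (I : Type) (s : seq I) (F : I -> W -> int -> W) :
    (forall i, calE W (F i)) ->
    calE W (\sum_(i <- s) F i) /\
    forall w, lfield (\sum_(i <- s) F i) w = \sum_(i <- s) lfield (F i) w.
  move=> HF; elim: s => [|i s [IH1 IH2]].
    rewrite big_nil; split=> [|w]; first exact: calE_zero.
    rewrite big_nil; apply: laurentP => j.
    by rewrite lfieldE //; apply: calE_zero.
  rewrite big_cons -[F i]scale1r; split=> [|w]; first exact: calE_comb.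
  by rewrite big_cons lfield_comb // IH2 rmorph1 scale1r.
have HMz a' z : calE W a' -> calE W (a' *~ z) /\ forall w, lfield (a' *~ z) w = lfield a' w *~ z.
  move=> Ea'; have := calE_comb z%:~R Ea' (calE_zero W); rewrite addr0 scaler_int.
  split=> // w; rewrite -scaler_int -[_ *: a']addr0 lfield_comb //; last exact: calE_zero.
  rewrite rmorph_int scaler_int (_ : lfield 0 w = 0) ?addr0 //.
  by apply: laurentP => j; rewrite lfieldE //; apply: calE_zero.
have tm x : calE W x -> quasi_local_pair x c -> forall w, tame (field_op x (lfield c w)).
  by move=> Ex xc w; apply: quasi_local_tame.
apply: calE_eq.
- by apply: (Hsum _ _ _ _).1 => r; apply: (HMz _ _ _).1.
- by apply: (Hsum _ _ _ _).1 => r; apply: (HMz _ _ _).1.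
move=> w.
rewrite (Hsum _ _ _ _).2; last by move=> r; apply: (HMz _ _ _).1.
rewrite (Hsum _ _ _ _).2; last by move=> r; apply: (HMz _ _ _).1.
have tab t : tame (field_op a (hat (field_op b (lfield c w)) t)).
  have := quasi_local_tame w Ea (Ebc (- t - 1)) (abc (- t - 1)).
  by rewrite lfield_YE_mode // (_ : - (- t - 1) - 1 = t); last by clear; lia.
have tba t : tame (field_op b (hat (field_op a (lfield c w)) t)).
  have := quasi_local_tame w Eb (Eac (- t - 1)) (bac (- t - 1)).
  by rewrite lfield_YE_mode // (_ : - (- t - 1) - 1 = t); last by clear; lia.
have := xdiff_commute char0 p_neq0 Ea Eb ab qE q'0 (tm _ Ea ac w) (tm _ Eb bc w)
  tab tba (- n - 1) (- m - 1).
rewrite xdiff_scale xdiffN_scale => H.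
have e1 (r : 'I_k.+1) : - (- m - 1 - (k - r)%N%:Z) - 1 = m + k%:Z - r%:Z.
  by have := ltn_ord r; clear; lia.
have e2 (r : 'I_k.+1) : - (- n - 1 - r%:Z) - 1 = n + r%:Z by clear; lia.
transitivity (\sum_(r < k.+1) iterated_hat p (lfield c w) a b (- n - 1 - r%:Z)
  (- m - 1 - (k - r)%N%:Z) *~ ((-1) ^+ r * 'C(k, r)%:Z)).
  apply: eq_bigr => r _; rewrite (HMz _ _ _).2 //.
  by rewrite (iterated_hat_mode _ _ _ Ea Eb Ec bc abc) e1 e2.
rewrite H; apply: eq_bigr => r _; rewrite (HMz _ _ _).2 //.
by rewrite (iterated_hat_mode _ _ _ Eb Ea Ec ac bac) e1 e2.
Qed.

(** Since [hatE] holds for every denominator, any nonzero polynomial killing the commutator serves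
    in the associativity axiom; quasi modules and modules are thus treated alike. *)
Lemma annihilates_phi_associative (V : lmodType K) (Y : V -> int -> V -> V)
    (YW : V -> W -> int -> W) (q : {poly {poly K}}) (u v : V) :
  calE W (YW u) -> calE W (YW v) -> q != 0 -> annihilates q (YW u) (YW v) ->
  (forall n, YW (Y u n v) = YE_mode p (YW u) n (YW v)) ->
  phi_associative p Y YW q u v.
Proof.
move=> Eu Ev q0 uv Yuv.
have Q0 : polyLL q != 0 by rewrite polyLL_eq0.
have HQ w := annihilates_bitrunc w Eu Ev uv.
split=> w.
  by rewrite field_prod_raw // pmul_raw; have [N HN] := HQ w; exists N.
rewrite field_prod_raw // pmul_raw subst_phi_raw // eval_phi_raw.
rewrite -(hatE char0 p_neq0 Q0 (HQ w)) -scale2_raw; congr scale2.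
apply/funext => k; rewrite Yuv YE_modeE //; last by exists q.
by rewrite (_ : - (- k - 1) - 1 = k) //; lia.
Qed.

End ModeLocality.

(** * The vertex algebra structure on the span and its module *)

Section SpanVertexAlgebra.
Variables (K : fieldType) (p : laurent K).
Hypothesis char0 : forall n, n.+1%:R != 0 :> K.
Hypothesis p_neq0 : p != 0.
Variable W : lmodType K.
Variable S : set (W -> int -> W).
Hypothesis S_calE : S `<=` calE W.
Hypothesis S_quasi_local : quasi_local S.
Local Notation V := (YE_spanT p S).
Local Notation Y := (YE_span_mode p S).
Local Notation one := (YE_span_one p S).

Lemma YE_span_is_closed : YE_closed_subspace p (YE_span p S).
Proof.
apply: (@YE_span_closed _ p char0 p_neq0 W [set q | q != 0]) => //=.
- exact: oner_neq0.
- by move=> q q' q0 q'0; rewrite mulf_neq0.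
- move=> q; apply: contra => /eqP q0.
  by rewrite -(swapXYK q) q0 rmorph0.
Qed.

Let V_span (u : V) : YE_span p S (val u).
Proof. by case: u => a /= /asboolP. Qed.

Let V_calE (u : V) : calE W (val u).
Proof. by have [SE _ _ _ _] := YE_span_is_closed; apply: SE. Qed.

Let V_quasi_local (u v : V) : quasi_local_pair (val u) (val v).
Proof. by have [_ _ _ Sq _] := YE_span_is_closed; apply: Sq. Qed.

Let valY u n v : val (Y u n v) = YE_mode p (val u) n (val v). Proof. by []. Qed.

Let V_mode_quasi_local (u v w : V) n : quasi_local_pair (val u) (YE_mode p (val v) n (val w)).
Proof. exact: (V_quasi_local u (Y v n w)). Qed.

Let val_comb c (u v : V) : val (c *: u + v) = c *: val u + val v.
Proof. by []. Qed.

Lemma YE_span_vertex_algebra : vertex_algebra Y one.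
Proof.
apply: (local_vertex_algebra char0).
- move=> n v c u u'; apply: val_inj; rewrite val_comb !valY val_comb.
  apply: YE_mode_combl => //.
  by have := V_quasi_local (c *: u + u') v; rewrite val_comb.
- move=> u n c v v'; apply: val_inj; rewrite val_comb !valY val_comb.
  apply: YE_mode_combr => //.
  by have := V_quasi_local u (c *: v + v'); rewrite val_comb.
- move=> u v.
  have [N HN] := YE_mode_truncated char0 p_neq0 (V_calE u) (V_calE v) (V_quasi_local u v).
  by exists N => n nN; apply: val_inj; rewrite valY HN.
- move=> n v; apply: val_inj; rewrite valY.
  rewrite [val one]/= (YE_mode_vacuum char0 p_neq0 n (V_calE v)).
  by case: eqP.
- move=> v; have [H1 H2] := YE_mode_creation char0 p_neq0 (V_calE v).
  by split=> [|n n0]; apply: val_inj; [apply: H1|apply: H2].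
- move=> u n v; apply: val_inj.
  have := YE_mode_translation char0 p_neq0 n (V_calE u) (V_calE v) (V_quasi_local u v)
    (V_mode_quasi_local u v one (-2)).
  by rewrite raddfB raddfN /= linearZ.
- move=> u v.
  have [k Hk] := YE_mode_locality char0 p_neq0 (V_calE u) (V_calE v) (V_quasi_local u v).
  have val_sum (F : 'I_k.+1 -> V) (z : 'I_k.+1 -> int) :
      val (\sum_r F r *~ z r) = \sum_r val (F r) *~ z r.
    by rewrite raddf_sum; apply: eq_bigr => r _; rewrite raddfMz.
  exists k => w m n; apply: val_inj; rewrite !val_sum.
  by apply: Hk.
Qed.

(** A vertex subalgebra containing S has as image in E(W) a closed subspace containing S and 1_W,
    quasi local because the span is. Minimality of the span then forces equality. *)
Lemma YE_span_generating : generating_set Y one [set u : V | S (val u)].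
Proof.
rewrite /generating_set; apply/seteqP; split=> // u _ X [[X1 XD XY] SX].
pose U := [set a | exists2 v : V, val v = a & X v].
have UE : U `<=` YE_span p S by move=> _ [v <- _].
have UC : YE_closed_subspace p U.
  have [SE _ _ Sq _] := YE_span_is_closed; split.
  - by move=> a /UE/SE.
  - exists (-1 *: one + one); last exact: XD.
    by rewrite val_comb scaleN1r addNr.
  - move=> c _ _ [v <- Xv] [v' <- Xv']; exists (c *: v + v'); last exact: XD.
    exact: val_comb.
  - by move=> a b /UE Ua /UE Ub; apply: Sq.
  - by move=> _ _ n [v <- Xv] [v' <- Xv']; exists (Y v n v') => //; apply: XY.
have SU : S `|` [set id_field W] `<=` U.
  move=> a [Sa|->]; last by exists one.
  have Ga : YE_span_pred p S a by apply/asboolP => U' [_]; apply; left.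
  by exists (Sub a Ga) => //; apply: SX.
by have [v /val_inj <-] := smallest_sub UC SU (V_span u).
Qed.

Lemma YE_span_phi_coordinated (Q : set {poly {poly K}}) :
  (forall q, Q q -> q != 0) ->
  (forall u v : V, exists2 q, Q q & annihilates q (val u) (val v)) ->
  phi_coordinated p Y one (YE_span_action p S) Q.
Proof.
move=> Q0 HQ; split=> //.
move=> u v; have [q Qq uv] := HQ u v; exists q => //.
exact: annihilates_phi_associative (V_calE u) (V_calE v) (Q0 q Qq) uv _.
Qed.

End SpanVertexAlgebra.

Lemma local_annihilated (K : fieldType) (p : laurent K) (W : lmodType K)
    (S : set (W -> int -> W)) :
  (forall n, n.+1%:R != 0 :> K) -> p != 0 -> S `<=` calE W -> local S ->
  forall u v : YE_spanT p S,
  exists2 q, (exists k : nat, q = ('X - 'Y) ^+ k) & annihilates q (val u) (val v).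
Proof.
move=> char0 p_neq0 SE Sl u v.
pose Qc : set {poly {poly K}} := [set q | exists e k : nat, q = (-1) ^+ e * ('X - 'Y) ^+ k].
have Qc_neq0 q : Qc q -> q != 0.
  by move=> [e [k ->]]; rewrite mulf_neq0 ?signr_eq0 // expf_neq0 // polyXsubC_eq0.
have Qc1 : Qc 1 by exists 0%N, 0%N; rewrite mulr1.
have QcM q q' : Qc q -> Qc q' -> Qc (q * q').
  by move=> [e [k ->]] [e' [k' ->]]; exists (e + e')%N, (k + k')%N; rewrite mulrACA !exprD.
have Qc_swap q : Qc q -> Qc (swapXY q).
  move=> [e [k ->]]; exists (e + k)%N, k.
  rewrite rmorphM !rmorphXn rmorphN1 rmorphB /= swapXY_X swapXY_Y -opprB.
  by rewrite exprD -mulrA -exprMn mulN1r.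
have Sa a b : S a -> S b -> annihilated Qc a b.
  by move=> Sa Sb; have [k ab] := Sl a b Sa Sb; exists (('X - 'Y) ^+ k) => //;
    exists 0%N, k; rewrite mul1r.
have [/asboolP Su /asboolP Sv] := (valP u, valP v).
have [q [e [k qE]] uv] := YE_span_annihilated char0 p_neq0 Qc_neq0 Qc1 QcM Qc_swap SE Sa Su Sv.
exists (('X - 'Y) ^+ k); first by exists k.
have [SE' _ _ _ _] := YE_span_closed char0 p_neq0 Qc_neq0 Qc1 QcM Qc_swap SE Sa.
(* The sign is removed by multiplying with it once more. *)
have := annihilatesM ((-1) ^+ e) (SE' _ Su) (SE' _ Sv) uv.
by rewrite qE mulrA -exprD addnn -mul2n exprM sqrrN expr1n expr1n mul1r.
Qed.

Theorem theorem3p9 (R : realType) (W : lmodType R[i]) (p : int -> R[i])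
    (S : set (W -> int -> W)) :
  lower_truncated p -> p <> 0 ->
  S `<=` calE W -> quasi_local S ->
  YE_closed_subspace p (YE_span p S) /\
  vertex_algebra (YE_span_mode p S) (YE_span_one p S) /\
  generating_set (YE_span_mode p S) (YE_span_one p S)
    [set a | S (val a)] /\
  phi_coordinated_quasi_module p (YE_span_mode p S) (YE_span_one p S)
    (YE_span_action p S) /\
  faithful (YE_span_action p S) /\
  (local S ->
     phi_coordinated_module p (YE_span_mode p S) (YE_span_one p S)
       (YE_span_action p S)).
Proof.
move=> pt p0 SE Sq.
have char0 n : n.+1%:R != 0 :> R[i] by rewrite pnatr_eq0.
have [P PE] : exists P : laurent R[i], lcoef P = p.
  by exists (Laurent (asboolT pt)).
have P0 : P != 0.
  by apply/eqP => P0; apply: p0; rewrite -PE P0.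
rewrite -PE; split; first exact: YE_span_is_closed.
split; first exact: YE_span_vertex_algebra.
split; first exact: YE_span_generating.
have [_ _ _ Ql _] := YE_span_is_closed char0 P0 SE Sq.
split; [|split].
- apply: YE_span_phi_coordinated => // u v.
  by have [q] := Ql _ _ (asboolW (valP u)) (asboolW (valP v)); exists q.
- exact: val_inj.
- move=> Sl; apply: YE_span_phi_coordinated => // [q [k ->]|].
    by rewrite expf_neq0 // polyXsubC_eq0.
  exact: local_annihilated.
Qed.
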